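(* Let $\epsilon>0$ be arbitrary, let $R>0$, and let $B_R$ be the ball of radius $R$ around the origin of $\mathbb{R}^n$. Let $f\ge 0$ be in $C^{0,\alpha}(B_R)\cap C(\overline{B_R})$ and let $g$ be a continuous function on $\overline{B_R}$. Assume in addition that $$f(x)=O\big((R^2-|x|^2)^3|x|^2\big),$$ i.e. there is a constant $C$ with $0\le f(x)\le C(R^2-|x|^2)^3|x|^2$ for all $x\in\overline{B_R}$. Then the boundary value problem $$\begin{cases}\epsilon\,\Delta v+(\Delta v)^3|D(\Delta v)|^2=f(x) & \text{in } B_R,\\ v=g & \text{on }\partial B_R,\\ \Delta v=0 & \text{on }\partial B_R\end{cases}$$ has a viscosity solution $v_\epsilon\in C^{2,\beta}(B_R)\cap C(\overline{B_R})$ for some $\beta$ with $0<\beta\le\alpha$.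
   Context: Here $0<\alpha<1$, $D$ denotes the gradient, and $C^{k,\alpha}(B_R)$ denotes functions whose derivatives of order $k$ are locally $\alpha$-Hölder continuous in the open ball $B_R$. The third-order problem is understood in factored form: $v$ is a viscosity solution of the boundary value problem if there is a function $w\in C(\overline{B_R})$ that is a viscosity solution (in the usual sense for first-order equations) of $\epsilon w+w^3|Dw|^2=f(x)$ in $B_R$ with $w=0$ on $\partial B_R$, and $\Delta v=w$ in $B_R$, $v=g$ on $\partial B_R$. The usual sense: $w$ is a subsolution (supersolution) of $G(x,w,Dw)=0$ if, whenever $\varphi$ is smooth and $w-\varphi$ has a local maximum (minimum) at $x\in B_R$, one has $G(x,w(x),D\varphi(x))\le 0$ ($\ge 0$); a viscosity solution is both. Here $G(x,s,p)=\epsilon s+s^3|p|^2-f(x)$. *)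

(* Defs.v *)
From HB Require Import structures.
From mathcomp Require Import all_boot all_order all_algebra.
From mathcomp Require Import all_classical all_reals all_analysis.

Set Implicit Arguments.
Unset Strict Implicit.
Unset Printing Implicit Defensive.

Import Order.TTheory GRing.Theory Num.Theory.
Import numFieldNormedType.Exports.

Local Open Scope classical_set_scope.
Local Open Scope ring_scope.

(* Euclidean R^n is 'rV[R]_n.  The library norm `|x| and the library balls on
   this type are those of the sup norm, which induces the same topology (used
   below for continuity, derivatives and compactness); every metric quantity
   is expressed with the Euclidean norm [enorm]. *)

Section Euclidean.
Context {R : realType} {n : nat}.
Implicit Types (x p : 'rV[R]_n) (r : R).

Definition enorm x : R := Num.sqrt (\sum_(i < n) x ord0 i ^+ 2).

Definition eball r : set 'rV[R]_n := [set x | enorm x < r].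
Definition eclosed_ball r : set 'rV[R]_n := [set x | enorm x <= r].
Definition esphere r : set 'rV[R]_n := [set x | enorm x = r].

End Euclidean.

Section Regularity.
Context {R : realType} {n : nat}.
Implicit Types (u : 'rV[R]_n -> R) (U : set 'rV[R]_n) (a : R) (k : nat).

(* The classes below are meant for an open set U; they depend only on the
   values of the function on U. *)

Definition partial (i : 'I_n) u : 'rV[R]_n -> R := 'D_(delta_mx ord0 i) u.

Definition gradient u (x : 'rV[R]_n) : 'rV[R]_n := \row_(i < n) partial i u x.

Definition laplacian u (x : 'rV[R]_n) : R :=
  \sum_(i < n) partial i (partial i u) x.

Fixpoint Ck k U u : Prop :=
  (forall x, U x -> {for x, continuous u}) /\
  if k is k'.+1 then
    forall i : 'I_n,
      (forall x, U x -> derivable u x (delta_mx ord0 i)) /\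
      Ck k' U (partial i u)
  else True.

Definition smooth_on U u : Prop := forall k, Ck k U u.

Definition locally_holder a U u : Prop :=
  forall K : set 'rV[R]_n, compact K -> K `<=` U ->
  exists M : R, forall x y, K x -> K y ->
    `|u x - u y| <= M * enorm (x - y) `^ a.

Definition Ck_holder k a U u : Prop :=
  Ck k U u /\
  forall s : seq 'I_n, size s = k -> locally_holder a U (foldr partial u s).

End Regularity.

Section Viscosity.
Context {R : realType} {n : nat}.
Implicit Types (G : 'rV[R]_n -> R -> 'rV[R]_n -> R).
Implicit Types (U : set 'rV[R]_n) (w phi : 'rV[R]_n -> R).

Definition viscosity_subsolution G U w : Prop :=
  forall phi x, smooth_on U phi -> U x ->
    (\forall y \near x, w y - phi y <= w x - phi x) ->
    G x (w x) (gradient phi x) <= 0.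

Definition viscosity_supersolution G U w : Prop :=
  forall phi x, smooth_on U phi -> U x ->
    (\forall y \near x, w x - phi x <= w y - phi y) ->
    0 <= G x (w x) (gradient phi x).

Definition viscosity_solution G U w : Prop :=
  viscosity_subsolution G U w /\ viscosity_supersolution G U w.

End Viscosity.

Section Problem.
Context {R : realType} {n : nat}.
Implicit Types (f g v : 'rV[R]_n -> R).

(* G(x, s, p) = eps s + s^3 |p|^2 - f(x) *)
Definition first_order_op (eps : R) f (x : 'rV[R]_n) (s : R) (p : 'rV[R]_n) : R :=
  eps * s + s ^+ 3 * enorm p ^+ 2 - f x.

(* The equation laplacian v = w is understood classically, hence the [Ck 2]
   clause: [partial] is a total operator, with junk values where the derivative
   does not exist. *)
Definition viscosity_solution_bvp (eps r : R) f g v : Prop :=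
  exists w : 'rV[R]_n -> R,
    [/\ {within eclosed_ball r, continuous w},
        viscosity_solution (first_order_op eps f) (eball r) w
      & forall x, esphere r x -> w x = 0] /\
    [/\ Ck 2 (eball r) v,
        forall x, eball r x -> laplacian v x = w x
      & forall x, esphere r x -> v x = g x].

End Problem.

(* Main.v *)
From HB Require Import structures.
Require Import Defs.
From mathcomp Require Import all_boot all_order all_algebra.
From mathcomp Require Import all_classical all_reals all_analysis.
From mathcomp Require Import ring lra.
Import Order.TTheory GRing.Theory Num.Theory.
Import numFieldNormedType.Exports.
Local Open Scope classical_set_scope.
Local Open Scope ring_scope.
Set Implicit Arguments.
Unset Strict Implicit.
Unset Printing Implicit Defensive.

(** The two equations of the factored problem are solved one after the other.

The first-order equation [eps w + w^3 |Dw|^2 = f] is solved by Perron's method.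
The constant [0] is a subsolution because [f >= 0], and [f / eps] is a
supersolution because [w^3 |Dw|^2 >= 0]; the growth condition on [f] makes both
vanish on the sphere, so every function squeezed between them has the right
boundary values.  For a nonnegative solution [|D(w^3)|^2 = 9 w (w^3 |Dw|^2)] is
bounded by a multiple of [sup f^2].  The Perron class is therefore restricted to
subsolutions whose cube is Lipschitz with a fixed constant, which makes the
supremum [W] continuous without any comparison principle.  That [W] is a
subsolution is [perron_sup_subsolution]; if it failed to be a supersolution, a
bump could be added to it without leaving the class ([perron_bump]).  The
Lipschitz bound for the cube shows that [W] is Hoelder continuous with exponent
[1/3].

The Poisson equation [laplacian v = w], [v = g] on the sphere, is solved without
integrals.  For polynomial data in a ball the solution is a polynomial:
[q |-> laplacian ((rho^2 - |x-a|^2) q)] maps the polynomials of degree at most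
[d] to themselves, it is injective by the maximum principle, hence onto because
the space is finitely spanned ([poly_dirichlet]).  Continuous data are
approximated uniformly by polynomials ([weierstrass_ball]), and the maximum
principle makes the polynomial solutions converge uniformly ([poisson_exists]).

The interior regularity of the limit [v] comes from its approximation by
quadratic polynomials.  Harmonic polynomials satisfy interior derivative bounds,
again by the maximum principle ([gradient_bound]), and so are close to their
second-order Taylor polynomials.  On a ball of radius [rho lam^j] around [a] one
subtracts from [v] the current quadratic polynomial, compares the difference with
a harmonic polynomial, and adds the Taylor polynomial of the latter; since [w]
has modulus of continuity [t^(1/3)], the error is [O((rho lam^j)^(2 + 1/3))] at
every scale ([quad_approx]).  Comparing these quadratic polynomials between
scales and between neighbouring centres yields second-order expansions of [v]
with Hoelder continuous coefficients ([taylor_expansions]), that is, [v] is of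
class C^2 with second derivatives locally Hoelder continuous of exponent
[1/3].  The theorem holds with [beta = min(alpha, 1/3)]. *)

(** * Euclidean, taxicab and sup norms *)
Section Norms.
Context {R : realType} {n : nat}.
Implicit Types (x y : 'rV[R]_n) (i : 'I_n).

Definition l1norm x : R := \sum_(i < n) `|x ord0 i|.
Definition dotp x y : R := \sum_(i < n) x ord0 i * y ord0 i.

Lemma enorm_ge0 x : 0 <= enorm x.
Proof. exact: sqrtr_ge0. Qed.

Lemma sqr_enorm x : enorm x ^+ 2 = \sum_(i < n) x ord0 i ^+ 2.
Proof. by rewrite sqr_sqrtr// sumr_ge0// => i _; exact: sqr_ge0. Qed.

Lemma enorm0 : enorm (0 : 'rV[R]_n) = 0.
Proof.
by rewrite /enorm big1 ?sqrtr0// => i _; rewrite mxE expr0n.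
Qed.

Lemma l1norm_ge0 x : 0 <= l1norm x.
Proof. exact: sumr_ge0. Qed.

Lemma le_coord_norm x i : `|x ord0 i| <= `|x|.
Proof.
rewrite [leRHS]/Num.norm /= mx_normrE.
by apply/bigmax_geP; right => /=; exists (ord0, i).
Qed.

Lemma norm_le x (e : R) : 0 <= e -> (forall i, `|x ord0 i| <= e) -> `|x| <= e.
Proof.
move=> e0 xe; rewrite [leLHS]/Num.norm /= mx_normrE.
by apply/bigmax_leP; split => // -[i j] _ /=; rewrite (ord1 i).
Qed.

Lemma le_coord_enorm x i : `|x ord0 i| <= enorm x.
Proof.
rewrite -sqrtr_sqr ler_wsqrtr// (bigD1 i)//= lerDl.
by rewrite sumr_ge0// => j _; exact: sqr_ge0.
Qed.

Lemma norm_le_enorm x : `|x| <= enorm x.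
Proof. by apply: norm_le => [|i]; [exact: enorm_ge0|exact: le_coord_enorm]. Qed.

Lemma enorm_le_l1norm x : enorm x <= l1norm x.
Proof.
rewrite -(@ler_pXn2r _ 2)// ?nnegrE ?enorm_ge0 ?l1norm_ge0// sqr_enorm.
rewrite [leRHS]expr2 [X in _ <= X * _]/l1norm mulr_suml; apply: ler_sum => i _.
rewrite -real_normK ?num_real// expr2 ler_wpM2l//.
by rewrite /l1norm (bigD1 i)//= lerDl sumr_ge0.
Qed.

Lemma l1norm_le_norm x : l1norm x <= n%:R * `|x|.
Proof.
apply: (@le_trans _ _ (\sum_(i < n) `|x|)).
  by apply: ler_sum => i _; exact: le_coord_norm.
by rewrite sumr_const card_ord mulr_natl.
Qed.

Lemma enorm_le_norm x : enorm x <= n%:R * `|x|.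
Proof. exact: le_trans (enorm_le_l1norm x) (l1norm_le_norm x). Qed.

Lemma l1normB x y : l1norm (x - y) = l1norm (y - x).
Proof. by apply: eq_bigr => i _; rewrite !mxE distrC. Qed.

Lemma l1normZ (t : R) x : l1norm (t *: x) = `|t| * l1norm x.
Proof. by rewrite /l1norm mulr_sumr; apply: eq_bigr => i _; rewrite mxE normrM. Qed.

Lemma enormZ (t : R) x : enorm (t *: x) = `|t| * enorm x.
Proof.
rewrite -sqrtr_sqr -sqrtrM ?sqr_ge0//; congr Num.sqrt.
by rewrite mulr_sumr; apply: eq_bigr => i _; rewrite mxE exprMn.
Qed.

Lemma enormN x : enorm (- x) = enorm x.
Proof. by rewrite -scaleN1r enormZ normrN normr1 mul1r. Qed.

Lemma enorm_eq0 x : enorm x = 0 -> x = 0.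
Proof.
move=> x0; apply/rowP => i; rewrite mxE; apply/eqP; rewrite -normr_eq0.
by rewrite eq_le normr_ge0 andbT -x0 le_coord_enorm.
Qed.

Lemma cauchy_schwarz x y : dotp x y <= enorm x * enorm y.
Proof.
have [->|x0] := eqVneq x 0.
  by rewrite enorm0 mul0r /dotp big1// => i _; rewrite mxE mul0r.
have [->|y0] := eqVneq y 0.
  by rewrite enorm0 mulr0 /dotp big1// => i _; rewrite mxE mulr0.
have pos (z : 'rV[R]_n) : z != 0 -> 0 < enorm z.
  move=> z0; rewrite lt_neqAle enorm_ge0 andbT eq_sym.
  by apply: contraNneq z0 => /enorm_eq0 ->.
have a0 := pos _ x0; have b0 := pos _ y0.
have ineq i : x ord0 i * y ord0 i <=
    (x ord0 i ^+ 2 * (enorm y / enorm x) + y ord0 i ^+ 2 * (enorm x / enorm y)) / 2.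
  rewrite -subr_ge0 [leRHS](_ : _ =
    (x ord0 i * enorm y - y ord0 i * enorm x) ^+ 2 / (2 * enorm x * enorm y)).
    by apply: divr_ge0; [exact: sqr_ge0|rewrite !mulr_ge0// ltW].
  by field; rewrite !gt_eqF.
apply: (le_trans (ler_sum _ (fun i _ => ineq i))).
rewrite -mulr_suml big_split/= -!mulr_suml -!sqr_enorm le_eqVlt; apply/orP; left.
by apply/eqP; field; rewrite !gt_eqF.
Qed.

Lemma enormD x y : enorm (x + y) <= enorm x + enorm y.
Proof.
rewrite -(@ler_pXn2r _ 2)// ?nnegrE ?addr_ge0 ?enorm_ge0//.
have -> : enorm (x + y) ^+ 2 = enorm x ^+ 2 + enorm y ^+ 2 + 2 * dotp x y.
  rewrite !sqr_enorm /dotp mulr_sumr -!big_split/=.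
  by apply: eq_bigr => i _; rewrite mxE; ring.
have := cauchy_schwarz x y; lra.
Qed.

Lemma enorm_triangle (z x y : 'rV[R]_n) : enorm (x - y) <= enorm (x - z) + enorm (z - y).
Proof. by rewrite -[x - y](_ : (x - z) + (z - y) = _) ?enormD// addrA subrK. Qed.

Lemma enorm_delta i : enorm (delta_mx ord0 i : 'rV[R]_n) = 1.
Proof.
rewrite /enorm (bigD1 i)//= big1 ?addr0 => [|j ji].
  by rewrite !mxE !eqxx expr1n sqrtr1.
by rewrite !mxE (negbTE ji) andbF expr0n.
Qed.

Lemma norm_delta_le i : `|delta_mx ord0 i : 'rV[R]_n| <= 1.
Proof. by rewrite -(enorm_delta i) norm_le_enorm. Qed.

Lemma nearP x (P : set 'rV[R]_n) : (\forall y \near x, P y) <->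
  exists2 e : R, 0 < e & forall y, `|y - x| < e -> P y.
Proof.
split.
  move/nbhs_ballP => [e /= e0 xe]; exists e => // y yx; apply: xe.
  by rewrite -ball_normE/= distrC.
move=> [e e0 xe]; apply/nbhs_ballP; exists e => //= y.
by rewrite -ball_normE/= distrC; exact: xe.
Qed.

Lemma cvg_sumr (T : Type) (F : set_system T) {FF : Filter F}
    (f : 'I_n -> T -> R) (a : 'I_n -> R) :
  (forall i, f i t @[t --> F] --> a i) ->
  \sum_(i < n) f i t @[t --> F] --> \sum_(i < n) a i.
Proof. by move=> fa; apply: cvg_big => // x; exact: add_continuous. Qed.

Lemma within_continuousP (A : set 'rV[R]_n) (u : 'rV[R]_n -> R) :
  {within A, continuous u} <-> forall x, A x -> forall e, 0 < e ->
    exists2 d, 0 < d & forall y, A y -> `|y - x| < d -> `|u y - u x| < e.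
Proof.
rewrite subspace_continuousP; split => uc x Ax.
  move=> e e0; have /cvgrPdist_lt/(_ _ e0)/nearP[d d0 H] := uc x Ax.
  by exists d => // y Ay yx; rewrite distrC; exact: H.
apply/cvgrPdist_lt => e e0; have [d d0 H] := uc x Ax e e0.
by apply/nearP; exists d => // y yx Ay; rewrite distrC; exact: H.
Qed.

Lemma enorm_continuous : continuous (@enorm R n).
Proof.
move=> x; have sumc : \sum_(i < n) y ord0 i ^+ 2 @[y --> x] -->
    \sum_(i < n) x ord0 i ^+ 2.
  apply: (@cvg_sumr _ (nbhs x) _ (fun i (y : 'rV[R]_n) => y ord0 i ^+ 2)) => i.
  apply: (@continuous_comp _ _ _ (fun y : 'rV[R]_n => y ord0 i) (fun t : R => t ^+ 2)).
    exact: coord_continuous.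
  exact: exprn_continuous.
exact: (@continuous_comp _ _ _ (fun y : 'rV[R]_n => \sum_(i < n) y ord0 i ^+ 2)
  (@Num.sqrt R) x sumc (@sqrt_continuous R _)).
Qed.

Lemma translation_continuous (a : 'rV[R]_n) : continuous (fun x : 'rV[R]_n => x + a).
Proof.
move=> x; apply: (@cvgD _ _ _ (nbhs x) _ id (cst a)); first exact: cvg_id.
exact: cvg_cst.
Qed.

Lemma open_eball (r : R) : open (eball r : set 'rV[R]_n).
Proof.
rewrite (_ : eball r = (@enorm R n) @^-1` [set t | t < r])//.
by apply: open_comp => [x _|]; [exact: enorm_continuous|exact: open_lt].
Qed.

Lemma compact_eclosed_ball (r : R) : compact (eclosed_ball r : set 'rV[R]_n).
Proof.
apply: bounded_closed_compact.
  exists r; split; first exact: num_real.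
  by move=> M rM x xr; apply: le_trans (norm_le_enorm x) (le_trans xr (ltW rM)).
rewrite (_ : eclosed_ball r = (@enorm R n) @^-1` [set t | t <= r])//.
apply: preimage_closed; first by move=> x _; exact: enorm_continuous.
exact: closed_le.
Qed.

Lemma eballS (r : R) : (eball r : set 'rV[R]_n) `<=` eclosed_ball r.
Proof. by move=> x /= /ltW. Qed.

Lemma within_bounded (r : R) (u : 'rV[R]_n -> R) :
  {within eclosed_ball r, continuous u} ->
  exists2 M, 0 <= M & forall x, enorm x <= r -> `|u x| <= M.
Proof.
move=> uc; have /ex_strict_bound_gt0[M M0 uM] : bounded_set (u @` eclosed_ball r).
  by apply/compact_bounded/continuous_compact => //; exact: compact_eclosed_ball.
by exists M => [|x xr]; [exact: ltW|apply/ltW/uM; exists x].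
Qed.

End Norms.

Lemma near_gt (R : realType) (T : topologicalType) (u : T -> R) (x : T) (c : R) :
  {for x, continuous u} -> c < u x -> \forall y \near x, c < u y.
Proof. by move=> cu cx; exact: (@cvgr_gt _ _ (nbhs x) _ u (u x) cu c cx). Qed.

Lemma near_lt (R : realType) (T : topologicalType) (u : T -> R) (x : T) (c : R) :
  {for x, continuous u} -> u x < c -> \forall y \near x, u y < c.
Proof. by move=> cu cx; exact: (@cvgr_lt _ _ (nbhs x) _ u (u x) cu c cx). Qed.

Lemma near_dist_lt (R : realType) (T : topologicalType) (u : T -> R) (x : T) (e : R) :
  {for x, continuous u} -> 0 < e -> \forall y \near x, `|u y - u x| < e.
Proof.
move=> cu e0; have l : u x - e < u x by rewrite gtrBl.
have g : u x < u x + e by rewrite ltrDl.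
apply: filterS2 (near_gt cu l) (near_lt cu g) => y h1 h2.
by rewrite ltr_norml; apply/andP; split; lra.
Qed.

(** * Partial derivatives *)
Section Partial.
Context {R : realType} {n : nat}.
Implicit Types (x y : 'rV[R]_n) (i : 'I_n) (q : 'rV[R]_n -> R).

Local Notation e_ i := (delta_mx ord0 i : 'rV[R]_n).

Lemma is_derive_line q x v (t : R) : derivable q (x + t *: v) v ->
  is_derive t 1 (fun s => q (x + s *: v)) ('D_v q (x + t *: v)).
Proof.
move=> qd.
have eqf : (fun h : R => h^-1 *: (((fun s => q (x + s *: v)) \o shift t) (h *: 1) -
    q (x + t *: v))) =
  (fun h : R => h^-1 *: ((q \o shift (x + t *: v)) (h *: v) - q (x + t *: v))).
  apply/funext => h; rewrite /shift/= [h *: 1]mulr1 scalerDl.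
  by rewrite addrCA.
apply: DeriveDef; first by rewrite /derivable eqf.
by rewrite /derive eqf.
Qed.

(** The segment from [x] to [y] is replaced by the path that changes one
coordinate at a time, which only meets partial derivatives; the path stays in
any sup-norm ball containing both ends. *)
Lemma mvt_coord q (c : 'rV[R]_n) (rho : R) (D : 'I_n -> R) :
  (forall y i, `|y - c| <= rho -> derivable q y (e_ i)) ->
  (forall y i, `|y - c| <= rho -> `|partial i q y| <= D i) ->
  forall x y, `|x - c| <= rho -> `|y - c| <= rho ->
  `|q y - q x| <= \sum_(i < n) D i * `|y ord0 i - x ord0 i|.
Proof.
move=> qd qD x y xc yc.
have rho0 : 0 <= rho by exact: le_trans (normr_ge0 _) xc.
pose z (k : nat) : 'rV[R]_n := \row_i (if (i < k)%N then y ord0 i else x ord0 i).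
have z0 : z 0 = x by apply/rowP => i; rewrite mxE ltn0.
have zn : z n = y by apply/rowP => i; rewrite mxE ltn_ord.
have seg (k : 'I_n) (t : R) : 0 <= t <= 1 ->
    `|z k + (t * (y ord0 k - x ord0 k)) *: e_ k - c| <= rho.
  move=> /andP[t0 t1]; apply: norm_le => // i; rewrite !mxE eqxx/=.
  have xi : `|x ord0 i - c ord0 i| <= rho.
    by apply: le_trans xc; have := le_coord_norm (x - c) i; rewrite !mxE.
  have yi : `|y ord0 i - c ord0 i| <= rho.
    by apply: le_trans yc; have := le_coord_norm (y - c) i; rewrite !mxE.
  have [->|ik] := eqVneq i k.
    rewrite ltnn mulr1; case: (eqVneq i k) xi yi => [->|_] xi yi.
      rewrite (_ : _ - _ = (1 - t) * (x ord0 k - c ord0 k) + t * (y ord0 k - c ord0 k)).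
        apply: le_trans (ler_normD _ _) _; rewrite !normrM (ger0_norm t0).
        rewrite ger0_norm ?subr_ge0//; nra.
      by ring.
    have := le_coord_norm (x - c) k; have := le_coord_norm (y - c) k.
    rewrite !mxE => yk xk.
    rewrite (_ : _ - _ = (1 - t) * (x ord0 k - c ord0 k) + t * (y ord0 k - c ord0 k)).
      apply: le_trans (ler_normD _ _) _; rewrite !normrM (ger0_norm t0).
      rewrite ger0_norm ?subr_ge0//; nra.
    by ring.
  by rewrite mulr0 addr0; case: ifP.
have step (k : 'I_n) : `|q (z k.+1) - q (z k)| <= D k * `|y ord0 k - x ord0 k|.
  set d := y ord0 k - x ord0 k.
  have zS : z k.+1 = z k + d *: e_ k.
    apply/rowP => i; rewrite !mxE eqxx/= ltnS.
    have [->|ik] := eqVneq i k; first by rewrite leqnn ltnn /d mulr1; ring.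
    by rewrite mulr0 addr0 ltn_neqAle ik.
  pose g (t : R) := q (z k + t *: (d *: e_ k)).
  have gd (t : R) : 0 <= t <= 1 -> is_derive t 1 g (d * partial k q (z k + t *: (d *: e_ k))).
    move=> t01.
    have := seg k t t01; rewrite -/d => zt.
    have dk := qd _ k zt.
    have dfk : derivable q (z k + (t * d) *: e_ k) (e_ k) by [].
    have := is_derive_line dfk.
    move=> lin.
    have eqg : g = (fun s => q (z k + s *: e_ k)) \o (fun t : R => t * d).
      by apply/funext => s; rewrite /g /= scalerA.
    rewrite eqg scalerA mulrC.
    have dd : is_derive t 1 (fun t : R => t * d) d.
      rewrite (_ : (fun t : R => t * d) = d \*: id); last first.
        by apply/funext => s; rewrite /= mulrC.
      by apply: is_derive_eq; rewrite [LHS]mulr1.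
    have := @is_derive1_comp _ _ _ t _ _ lin dd.
    by rewrite mulrC.
  have g01 : {within `[0, 1], continuous g}.
    apply: derivable_within_continuous => t; rewrite in_itv/= => t01.
    exact: (@ex_derive _ _ _ _ _ _ _ (gd t t01)).
  have [t] := @MVT_segment R g (fun t => d * partial k q (z k + t *: (d *: e_ k))) 0 1 ler01
    (fun t t01 => gd t (subset_itv_oo_cc t01)) g01.
  rewrite in_itv/= => t01.
  rewrite /g scale1r scale0r addr0 -zS => ->; rewrite subr0 mulr1 normrM mulrC.
  apply: ler_wpM2r => //; apply: qD; rewrite scalerA; exact: seg.
have -> : q y - q x = \sum_(k < n) (q (z k.+1) - q (z k)).
  by rewrite -(big_mkord xpredT (fun k => q (z k.+1) - q (z k))) telescope_sumr// z0 zn.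
by apply: le_trans (ler_norm_sum _ _ _) _; apply: ler_sum => k _; exact: step.
Qed.

End Partial.

(** * Polynomial functions *)
Section Polynomials.
Context {R : realType} {n : nat}.
Implicit Types (x y : 'rV[R]_n) (i j : 'I_n) (p q : 'rV[R]_n -> R).

Local Notation e_ i := (delta_mx ord0 i : 'rV[R]_n).

Fixpoint poly_deg (d : nat) q : Prop :=
  if d is d'.+1 then
    exists p0 (p : 'I_n -> 'rV[R]_n -> R),
      [/\ poly_deg d' p0, forall i, poly_deg d' (p i) &
          q = fun x => p0 x + \sum_(i < n) x ord0 i * p i x]
  else exists c, q = fun=> c.

Definition is_poly q := exists d, poly_deg d q.

Lemma poly_deg_cst d (c : R) : poly_deg d (fun=> c).
Proof.
elim: d c => [|d IH] c /=; first by exists c.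
exists (fun=> c), (fun=> fun=> 0); split => //.
by apply/funext => x; rewrite big1 ?addr0// => i _; rewrite mulr0.
Qed.

Lemma poly_degS d q : poly_deg d q -> poly_deg d.+1 q.
Proof.
move=> qd; exists q, (fun=> fun=> 0); split => //.
  by move=> _; exact: poly_deg_cst.
by apply/funext => x; rewrite big1 ?addr0// => i _; rewrite mulr0.
Qed.

Lemma poly_deg_le d d' q : (d <= d')%N -> poly_deg d q -> poly_deg d' q.
Proof.
by move=> /subnK <-; elim: (d' - d)%N => //= k IH qd; exact/poly_degS/IH.
Qed.

Lemma poly_degD d p q : poly_deg d p -> poly_deg d q ->
  poly_deg d (fun x => p x + q x).
Proof.
elim: d p q => [|d IH] p q /=.
  by move=> [c ->] [c' ->]; exists (c + c').
move=> [p0 [pi [p0d pid ->]]] [q0 [qi [q0d qid ->]]].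
exists (fun x => p0 x + q0 x), (fun i x => pi i x + qi i x); split.
- exact: IH.
- by move=> i; exact: IH.
- apply/funext => x; rewrite addrACA -big_split/=; congr (_ + _).
  by apply: eq_bigr => i _; rewrite mulrDr.
Qed.

Lemma poly_degM d d' p q : poly_deg d p -> poly_deg d' q ->
  poly_deg (d + d') (fun x => p x * q x).
Proof.
elim: d p => [|d IH] p /=.
  move=> [c ->]; elim: d' q => [|d' IH'] q /=.
    by move=> [c' ->]; exists (c * c').
  move=> [q0 [qi [q0d qid ->]]].
  exists (fun x => c * q0 x), (fun i x => c * qi i x); split.
  - exact: IH'.
  - by move=> i; exact: IH'.
  - apply/funext => x; rewrite mulrDr mulr_sumr; congr (_ + _).
    by apply: eq_bigr => i _; rewrite mulrCA.
move=> [p0 [pi [p0d pid ->]]] qd'.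
exists (fun x => p0 x * q x), (fun i x => pi i x * q x); split.
- exact: IH.
- by move=> i; exact: IH.
- apply/funext => x; rewrite mulrDl mulr_suml; congr (_ + _).
  by apply: eq_bigr => i _; rewrite mulrA.
Qed.

Lemma poly_degZ d (c : R) q : poly_deg d q -> poly_deg d (fun x => c * q x).
Proof. exact: (@poly_degM 0 d (fun=> c) q (poly_deg_cst 0 c)). Qed.

Lemma poly_deg_coord i : poly_deg 1 (fun x => x ord0 i).
Proof.
exists (fun=> 0), (fun j => fun=> (j == i)%:R); split.
- exact: poly_deg_cst.
- by move=> j; exact: poly_deg_cst.
- apply/funext => x; rewrite add0r (bigD1 i)//= eqxx mulr1 big1 ?addr0//.
  by move=> j /negbTE ->; rewrite mulr0.
Qed.

Lemma is_poly_cst (c : R) : is_poly (fun=> c).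
Proof. by exists 0%N; exact: poly_deg_cst. Qed.

Lemma is_poly_coord i : is_poly (fun x => x ord0 i).
Proof. by exists 1%N; exact: poly_deg_coord. Qed.

Lemma is_polyM p q : is_poly p -> is_poly q -> is_poly (fun x => p x * q x).
Proof. by move=> [d pd] [d' qd]; exists (d + d')%N; exact: poly_degM. Qed.

Lemma is_polyD p q : is_poly p -> is_poly q -> is_poly (fun x => p x + q x).
Proof.
move=> [d pd] [d' qd]; exists (maxn d d'); apply: poly_degD.
- exact: poly_deg_le (leq_maxl _ _) pd.
- exact: poly_deg_le (leq_maxr _ _) qd.
Qed.

Lemma is_polyZ (c : R) q : is_poly q -> is_poly (fun x => c * q x).
Proof. by move=> qd; apply: is_polyM => //; exact: is_poly_cst. Qed.

Lemma is_polyB p q : is_poly p -> is_poly q -> is_poly (fun x => p x - q x).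
Proof.
move=> pp qp; rewrite (_ : (fun x => _) = fun x => p x + (-1) * q x).
  exact/is_polyD/is_polyZ.
by apply/funext => x; rewrite mulN1r.
Qed.

Lemma is_poly_sum (I : finType) (p : I -> 'rV[R]_n -> R) :
  (forall k, is_poly (p k)) -> is_poly (fun x => \sum_k p k x).
Proof.
move=> pp; elim: (index_enum I) => [|k s IH].
  rewrite (_ : (fun x => _) = fun=> 0); first exact: is_poly_cst.
  by apply/funext => x; rewrite big_nil.
rewrite (_ : (fun x => _) = fun x => p k x + \sum_(j <- s) p j x).
  exact: is_polyD.
by apply/funext => x; rewrite big_cons.
Qed.

Lemma is_polyX p m : is_poly p -> is_poly (fun x => p x ^+ m).
Proof.
move=> pp; elim: m => [|m IH]; first exact: is_poly_cst.
rewrite (_ : (fun x => _) = fun x => p x * p x ^+ m); first exact: is_polyM.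
by apply/funext => x; rewrite exprS.
Qed.

Lemma differentiable_poly q x : is_poly q -> differentiable q x.
Proof.
move=> [d]; elim: d q => [|d IH] q /=; first by move=> [c ->].
move=> [p0 [p [p0d pd ->]]].
have -> : (fun y => p0 y + \sum_(i < n) y ord0 i * p i y) =
  p0 + \sum_(i < n) ((fun y : 'rV[R]_n => y ord0 i) * p i).
  by apply/funext => y; rewrite fctE fct_sumE.
apply: differentiableD; first exact: IH.
apply: differentiable_sum => i.
apply: differentiableM; last exact: IH.
exact: differentiable_coord.
Qed.

Lemma derivable_poly q x v : is_poly q -> derivable q x v.
Proof. by move=> /(differentiable_poly x)/diff_derivable. Qed.

Lemma continuous_poly q : is_poly q -> continuous q.
Proof.
by move=> qp x; apply: differentiable_continuous; exact: differentiable_poly.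
Qed.

Fact pder_subproof :
  {D : 'I_n -> ('rV[R]_n -> R) -> 'rV[R]_n -> R | forall i q, D i q = partial i q}.
Proof. by exists partial. Qed.

(** [partial] behind an opaque constant: comparing two second derivatives would
otherwise unfold the limits that define them. *)
Definition pder := sval pder_subproof.

Definition lap q x : R := \sum_(i < n) pder i (pder i q) x.

Lemma pderE i q : pder i q = partial i q.
Proof. exact: (svalP pder_subproof). Qed.

Lemma pder_cst i (c : R) : pder i (fun=> c) = fun=> 0.
Proof. by rewrite pderE; apply/funext => x; rewrite /partial derive_cst. Qed.

Lemma pder_coord i j : pder i (fun x => x ord0 j) = fun=> (j == i)%:R.
Proof.
rewrite pderE; apply/funext => x.
rewrite /partial deriveE; last exact: differentiable_coord.
have lin : linear (fun x : 'rV[R]_n => x ord0 j).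
  by move=> a u v; rewrite !mxE.
pose f : {linear 'rV[R]_n -> R} := HB.pack (fun x : 'rV[R]_n => x ord0 j)
  (GRing.isLinear.Build _ _ _ _ _ lin).
rewrite (_ : (fun x => _) = f)// diff_lin; last exact: coord_continuous.
by rewrite /f/= mxE eqxx.
Qed.

Lemma pderD i p q : is_poly p -> is_poly q ->
  pder i (fun x => p x + q x) = fun x => pder i p x + pder i q x.
Proof.
move=> pp qp; rewrite !pderE; apply/funext => x; rewrite /partial -deriveD//;
  exact: derivable_poly.
Qed.

Lemma pderM i p q : is_poly p -> is_poly q ->
  pder i (fun x => p x * q x) = fun x => pder i p x * q x + p x * pder i q x.
Proof.
move=> pp qp; rewrite !pderE; apply/funext => x; rewrite /partial.
have -> : (fun x => p x * q x) = p * q by [].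
rewrite deriveM; [|exact: derivable_poly..].
by rewrite addrC /GRing.scale/= mulrC.
Qed.

Lemma pderZ i (c : R) q : is_poly q ->
  pder i (fun x => c * q x) = fun x => c * pder i q x.
Proof.
move=> qp; rewrite pderM//; last exact: is_poly_cst.
by rewrite pder_cst; apply/funext => x; rewrite mul0r add0r.
Qed.

Lemma pderB i p q : is_poly p -> is_poly q ->
  pder i (fun x => p x - q x) = fun x => pder i p x - pder i q x.
Proof.
move=> pp qp; rewrite (_ : (fun x => _) = fun x => p x + (-1) * q x).
  rewrite pderD ?pderZ//; last exact: is_polyZ.
  by apply/funext => x; rewrite mulN1r.
by apply/funext => x; rewrite mulN1r.
Qed.

Lemma pder_sum i (I : finType) (p : I -> 'rV[R]_n -> R) :
  (forall k, is_poly (p k)) ->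
  pder i (fun x => \sum_k p k x) = fun x => \sum_k pder i (p k) x.
Proof.
move=> pp.
have sump s : is_poly (fun x => \sum_(k <- s) p k x).
  elim: s => [|k s IH].
    rewrite (_ : (fun x => _) = fun=> 0); first exact: is_poly_cst.
    by apply/funext => x; rewrite big_nil.
  rewrite (_ : (fun x => _) = fun x => p k x + \sum_(j <- s) p j x).
    exact: is_polyD.
  by apply/funext => x; rewrite big_cons.
elim: (index_enum I) => [|k s IH].
  rewrite (_ : (fun x => _) = fun=> 0); last by apply/funext => x; rewrite big_nil.
  by rewrite pder_cst; apply/funext => x; rewrite big_nil.
rewrite (_ : (fun x => _) = fun x => p k x + \sum_(j <- s) p j x); last first.
  by apply/funext => x; rewrite big_cons.
by rewrite pderD// IH; apply/funext => x; rewrite big_cons.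
Qed.

Lemma poly_deg_pder0 i q : poly_deg 0 q -> pder i q = fun=> 0.
Proof. by move=> [c ->]; exact: pder_cst. Qed.

Lemma pder_coord_expansion i p0 (p : 'I_n -> 'rV[R]_n -> R) :
  is_poly p0 -> (forall k, is_poly (p k)) ->
  pder i (fun x => p0 x + \sum_(k < n) x ord0 k * p k x) =
  fun x => p i x + (pder i p0 x + \sum_(k < n) x ord0 k * pder i (p k) x).
Proof.
move=> p0p pp.
have xp k : is_poly (fun x => x ord0 k * p k x).
  by apply: is_polyM => //; exact: is_poly_coord.
rewrite pderD ?pder_sum//; last exact: is_poly_sum.
apply/funext => x; rewrite [RHS]addrCA; congr (_ + _).
rewrite [X in _ = X + _](_ : _ = \sum_(k < n) (k == i)%:R * p k x); last first.
  rewrite (bigD1 i)//= eqxx mul1r big1 ?addr0// => k /negbTE ->.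
  by rewrite mul0r.
rewrite -big_split/=; apply: eq_bigr => k _.
by rewrite pderM ?pder_coord//; exact: is_poly_coord.
Qed.

Lemma poly_deg_pder d i q : poly_deg d.+1 q -> poly_deg d (pder i q).
Proof.
elim: d q => [|d IH] q [p0 [p [p0d pd ->]]].
  rewrite pder_coord_expansion => [||k]; last 2 first.
  - by exists 0%N.
  - by exists 0%N; exact: pd.
  rewrite (poly_deg_pder0 i p0d).
  rewrite (_ : (fun x => _) = p i)//; apply/funext => x.
  by rewrite big1 ?addr0// => k _; rewrite (poly_deg_pder0 i (pd k)) mulr0.
rewrite pder_coord_expansion => [||k]; last 2 first.
- by exists d.+1.
- by exists d.+1; exact: pd.
apply: poly_degD; first exact: pd.
exists (pder i p0), (fun k => pder i (p k)); split => //; first exact: IH.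
by move=> k; exact: IH.
Qed.

Lemma is_poly_pder i q : is_poly q -> is_poly (pder i q).
Proof.
move=> [[|d] qd]; last by exists d; exact: poly_deg_pder.
by rewrite (poly_deg_pder0 _ qd); exact: is_poly_cst.
Qed.

Lemma is_poly_lap q : is_poly q -> is_poly (lap q).
Proof. by move=> qp; apply: is_poly_sum => i; exact/is_poly_pder/is_poly_pder. Qed.

Lemma lap_cst (c : R) : lap (fun _ : 'rV[R]_n => c) = fun=> 0.
Proof.
by apply/funext => x; rewrite /lap big1// => i _; rewrite !pder_cst.
Qed.

Lemma lapD p q : is_poly p -> is_poly q ->
  lap (fun x => p x + q x) = fun x => lap p x + lap q x.
Proof.
move=> pp qp; apply/funext => x; rewrite /lap -big_split/=.
apply: eq_bigr => i _; rewrite !pderD//; exact: is_poly_pder.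
Qed.

Lemma lapZ (c : R) q : is_poly q ->
  lap (fun x => c * q x) = fun x => c * lap q x.
Proof.
move=> qp; apply/funext => x; rewrite /lap mulr_sumr.
apply: eq_bigr => i _; rewrite !pderZ//; exact: is_poly_pder.
Qed.

Lemma lapB p q : is_poly p -> is_poly q ->
  lap (fun x => p x - q x) = fun x => lap p x - lap q x.
Proof.
move=> pp qp; apply/funext => x; rewrite /lap -sumrB.
apply: eq_bigr => i _; rewrite !pderB//; exact: is_poly_pder.
Qed.

Lemma lapM p q : is_poly p -> is_poly q ->
  lap (fun x => p x * q x) = fun x => lap p x * q x +
    2 * (\sum_(i < n) pder i p x * pder i q x) + p x * lap q x.
Proof.
move=> pp qp; apply/funext => x.
rewrite /lap mulr_suml !mulr_sumr -!big_split/=.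
have ip i := is_poly_pder i pp; have iq i := is_poly_pder i qp.
apply: eq_bigr => i _; rewrite pderM// pderD ?pderM//; [|exact: is_polyM..].
move: (pder i (pder i p) x) (pder i (pder i q) x) => a b.
move: (pder i p x) (pder i q x) (p x) (q x) => c d e f; ring.
Qed.

(** The square of [enorm (x - a)], written so as to be visibly a polynomial. *)
Definition sqdist (a : 'rV[R]_n) x : R := \sum_(i < n) (x ord0 i - a ord0 i) ^+ 2.

Lemma sqdistE a x : sqdist a x = enorm (x - a) ^+ 2.
Proof. by rewrite sqr_enorm; apply: eq_bigr => i _; rewrite !mxE. Qed.

Lemma poly_deg_sqdist a : poly_deg 2 (sqdist a).
Proof.
exists (fun=> \sum_(i < n) a ord0 i ^+ 2), (fun i x => x ord0 i + - (2 * a ord0 i)).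
split; first exact: poly_deg_cst.
  by move=> i; apply: poly_degD; [exact: poly_deg_coord|exact: poly_deg_cst].
apply/funext => x; rewrite -big_split; apply: eq_bigr => i _ /=; ring.
Qed.

Lemma is_poly_sqdist a : is_poly (sqdist a).
Proof. by exists 2%N; exact: poly_deg_sqdist. Qed.

Lemma pder_sqdist i a : pder i (sqdist a) = fun x => 2 * (x ord0 i - a ord0 i).
Proof.
have pc k : is_poly (fun x => x ord0 k - a ord0 k).
  by apply: is_polyB; [exact: is_poly_coord|exact: is_poly_cst].
have pk k : pder i (fun x => (x ord0 k - a ord0 k) ^+ 2) =
    fun x => (k == i)%:R * (2 * (x ord0 k - a ord0 k)).
  rewrite (_ : (fun x => _) = fun x => (x ord0 k - a ord0 k) * (x ord0 k - a ord0 k));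
    last by apply/funext => y; rewrite expr2.
  rewrite pderM// pderB; [|exact: is_poly_coord|exact: is_poly_cst].
  by rewrite pder_coord pder_cst; apply/funext => x; ring.
rewrite pder_sum => [|k]; last exact: is_polyX.
apply/funext => x; rewrite (bigD1 i)//= big1 ?addr0 => [|k ki].
  by rewrite pk eqxx mul1r.
by rewrite pk (negbTE ki) mul0r.
Qed.

Lemma lap_sqdist a : lap (sqdist a) = fun=> 2 * n%:R.
Proof.
apply/funext => x; rewrite /lap.
under eq_bigr => i _.
  rewrite pder_sqdist pderZ; last first.
    by apply: is_polyB; [exact: is_poly_coord|exact: is_poly_cst].
  rewrite pderB; [|exact: is_poly_coord|exact: is_poly_cst].
  rewrite pder_coord pder_cst eqxx subr0 mulr1; over.
by rewrite sumr_const card_ord mulr_natr.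
Qed.

End Polynomials.
Arguments continuous_poly {R n q} _ _.

(** * Local maxima and the maximum principle *)
Section MaximumPrinciple.
Context {R : realType} {n : nat}.
Implicit Types (x y a c : 'rV[R]_n) (i j : 'I_n) (p q : 'rV[R]_n -> R).

Local Notation e_ i := (delta_mx ord0 i : 'rV[R]_n).

Lemma norm_scale_delta (t : R) i : `|t *: e_ i| <= `|t|.
Proof. by rewrite normrZ ler_piMr// norm_delta_le. Qed.

Lemma partial_locmax q c i :
  (\forall y \near c, derivable q y (e_ i)) -> (\forall y \near c, q y <= q c) ->
  partial i q c = 0.
Proof.
move=> /nearP[d d0 qd] /nearP[e e0 qe].
set r := Num.min d e; have r0 : 0 < r by rewrite lt_min d0.
have near0 (t : R) : t \in `]-r, r[ -> `|c + t *: e_ i - c| < d /\ `|c + t *: e_ i - c| < e.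
  rewrite in_itv/= => /andP[t1 t2].
  have tr : `|t| < r by rewrite ltr_norml t1.
  rewrite [c + _]addrC addrK.
  by split; apply: le_lt_trans (norm_scale_delta _ _) (lt_le_trans tr _);
    rewrite ge_min lexx ?orbT.
have zero : (0 : R) \in `]-r, r[ by rewrite in_itv/= oppr_lt0 r0.
have ld (t : R) : t \in `]-r, r[ ->
    is_derive t 1 (fun s => q (c + s *: e_ i)) (partial i q (c + t *: e_ i)).
  by move=> /near0[/qd qt _]; exact: is_derive_line.
have D0 : is_derive (0:R) 1 (fun s => q (c + s *: e_ i)) 0.
  apply: (@derive1_at_max _ _ (-r) r) => //.
  - by rewrite ge0_cp// ltW.
  - by move=> t /ld[].
  - by move=> t /near0[_ /qe]; rewrite scale0r addr0.
have := ld _ zero; rewrite scale0r addr0 => D1.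
by rewrite -(@derive_val _ _ _ _ _ _ _ D1) (@derive_val _ _ _ _ _ _ _ D0).
Qed.

Lemma pder2_locmax q c i : is_poly q -> (\forall y \near c, q y <= q c) ->
  pder i (pder i q) c <= 0.
Proof.
move=> qp qc; rewrite leNgt; apply/negP => q2.
have pq := is_poly_pder i qp; have ppq := is_poly_pder i pq.
have q1 : pder i q c = 0.
  rewrite pderE; apply: partial_locmax => //.
  by apply: (@filterE _ (nbhs c)) => y; exact: derivable_poly.
have : \forall y \near c, 0 < pder i (pder i q) y.
  exact: near_gt (continuous_poly ppq c) q2.
move/nearP => [d d0 qd]; move/nearP: qc => [e e0 qe].
set r := Num.min d e / 2.
have m0 : 0 < Num.min d e by rewrite lt_min d0.
have r0 : 0 < r by rewrite divr_gt0.
have rm : r < Num.min d e by rewrite /r; lra.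
have near0 (t : R) : t \in `[0, r] -> `|c + t *: e_ i - c| < d /\ `|c + t *: e_ i - c| < e.
  rewrite in_itv/= => /andP[t1 t2].
  have tr : `|t| < Num.min d e by rewrite ger0_norm// (le_lt_trans t2).
  rewrite [c + _]addrC addrK.
  by split; apply: le_lt_trans (norm_scale_delta _ _) (lt_le_trans tr _);
    rewrite ge_min lexx ?orbT.
have D p (t : R) : is_poly p ->
    is_derive t 1 (fun s => p (c + s *: e_ i)) (pder i p (c + t *: e_ i)).
  by move=> pp; rewrite pderE; apply: is_derive_line; exact: derivable_poly.
have C p (A : set R) : is_poly p -> {within A, continuous (fun s => p (c + s *: e_ i))}.
  move=> pp; apply: continuous_subspaceT => t.
  apply: (@differentiable_continuous _ R R); apply/derivable1_diffP.
  by have [] := D p t pp.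
have [t tr] := @MVT R (fun s => q (c + s *: e_ i)) (fun s => pder i q (c + s *: e_ i))
  0 r r0 (fun s _ => D q s qp) (C q _ qp).
rewrite scale0r addr0 subr0 => qr.
have t0 : 0 < t by move: tr; rewrite in_itv/= => /andP[].
have tr' : t <= r by move: tr; rewrite in_itv/= => /andP[_ /ltW].
have [s st] := @MVT R (fun s => pder i q (c + s *: e_ i))
  (fun s => pder i (pder i q) (c + s *: e_ i))
  0 t t0 (fun s _ => D _ s pq) (C _ _ pq).
rewrite scale0r addr0 subr0 q1 subr0 => qt.
have : 0 < pder i (pder i q) (c + s *: e_ i).
  apply: qd; apply: (near0 s _).1; move: st; rewrite !in_itv/= => /andP[s0 s1].
  by rewrite (ltW s0) (le_trans (ltW s1)).
move=> pos; have : q (c + r *: e_ i) <= q c.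
  by apply: qe; apply: (near0 r _).2; rewrite in_itv/= lexx ltW.
by rewrite -subr_le0 qr qt leNgt !mulr_gt0.
Qed.

Lemma compact_cball a (rho : R) : compact [set x | enorm (x - a) <= rho].
Proof.
rewrite (_ : mkset _ = (fun x => x + a) @` eclosed_ball rho).
  apply: continuous_compact; last exact: compact_eclosed_ball.
  by apply: continuous_subspaceT; exact: translation_continuous.
apply/seteqP; split => x /=.
  by move=> xa; exists (x - a) => //; rewrite subrK.
by move=> [y ya <-]; rewrite addrK.
Qed.

Lemma near_ball a (rho : R) x : enorm (x - a) < rho ->
  \forall y \near x, enorm (y - a) < rho.
Proof.
move=> xa; have cont : {for x, continuous (fun y => enorm (y - a))}.
  apply: (@continuous_comp _ _ _ (fun y => y - a) (@enorm R n)).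
    exact: translation_continuous.
  exact: enorm_continuous.
exact: near_lt cont xa.
Qed.

(** A function with positive Laplacian cannot have an interior maximum, and
adding a small multiple of the squared distance to [a] makes a nonnegative
Laplacian positive. *)
Lemma max_principle q a (rho M : R) : (0 < n)%N -> is_poly q ->
  (forall x, enorm (x - a) < rho -> 0 <= lap q x) ->
  (forall x, enorm (x - a) = rho -> q x <= M) ->
  forall x, enorm (x - a) <= rho -> q x <= M.
Proof.
move=> n0 qp qsub qbd.
have strict p N : is_poly p ->
    (forall x, enorm (x - a) < rho -> 0 < lap p x) ->
    (forall x, enorm (x - a) = rho -> p x <= N) ->
    forall x, enorm (x - a) <= rho -> p x <= N.
  move=> pp psub pbd x xa.
  have [|||c] := @compact_EVT_max _ _ p [set x | enorm (x - a) <= rho].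
  - by exists x.
  - exact: compact_cball.
  - by apply: continuous_subspaceT; exact: continuous_poly.
  rewrite inE/= => ca cmax; apply: (@le_trans _ _ (p c)).
    by apply: cmax; rewrite inE.
  move: ca; rewrite le_eqVlt => /orP[/eqP/pbd//|ca].
  have : lap p c <= 0.
    apply: sumr_le0 => i _; apply: pder2_locmax => //.
    apply: filterS (near_ball ca) => y ya.
    by apply: cmax; rewrite inE/= ltW.
  by rewrite leNgt psub.
move=> x xa; rewrite leNgt; apply/negP => qM.
have rho0 : 0 <= rho by apply: le_trans xa; exact: enorm_ge0.
pose e := (q x - M) / (rho ^+ 2 + 1).
have d0 : 0 < rho ^+ 2 + 1 by rewrite ltr_wpDl// sqr_ge0.
have e0 : 0 < e by rewrite divr_gt0// subr_gt0.
have Ep : is_poly (fun x => e * sqdist a x) by apply: is_polyZ; exact: is_poly_sqdist.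
have qEp : is_poly (fun x => q x + e * sqdist a x) by exact: is_polyD.
have qEsub y : enorm (y - a) < rho -> 0 < lap (fun x => q x + e * sqdist a x) y.
  move=> ya; rewrite lapD// lapZ; last exact: is_poly_sqdist.
  rewrite lap_sqdist; apply: ltr_wpDl; first exact: qsub.
  by apply: mulr_gt0 => //; apply: mulr_gt0 => //; rewrite ltr0n.
have qEbd y : enorm (y - a) = rho -> q y + e * sqdist a y <= M + e * rho ^+ 2.
  by move=> ya; rewrite sqdistE ya lerD2r qbd.
have := strict _ _ qEp qEsub qEbd x xa.
have : 0 <= e * sqdist a x.
  by apply: mulr_ge0; [exact: ltW|rewrite sqdistE sqr_ge0].
have : e * (rho ^+ 2 + 1) = q x - M by rewrite /e divfK// gt_eqF.
lra.
Qed.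

Lemma max_principle_abs q a (rho M : R) : (0 < n)%N -> is_poly q ->
  (forall x, enorm (x - a) < rho -> lap q x = 0) ->
  (forall x, enorm (x - a) = rho -> `|q x| <= M) ->
  forall x, enorm (x - a) <= rho -> `|q x| <= M.
Proof.
move=> n0 qp q0 qM x xa; rewrite ler_norml; apply/andP; split.
  rewrite lerNl -mulN1r.
  apply: (@max_principle (fun x => -1 * q x) a rho M) => //; first exact: is_polyZ.
    by move=> y ya; rewrite lapZ// q0// mulr0.
  by move=> y /qM; rewrite mulN1r ler_norml lerNl => /andP[].
apply: (@max_principle q a rho M) => //; first by move=> y /q0 ->.
by move=> y /qM /ler_normlW.
Qed.

(** Adding [eta * |x-a|^2] to [q] or to [-q] gives a function of nonnegative
Laplacian, to which the maximum principle applies. *)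
Lemma poisson_bound q a (rho eta M : R) : (0 < n)%N -> 0 <= eta -> is_poly q ->
  (forall x, enorm (x - a) < rho -> `|lap q x| <= eta) ->
  (forall x, enorm (x - a) = rho -> `|q x| <= M) ->
  forall x, enorm (x - a) <= rho -> `|q x| <= M + eta * rho ^+ 2.
Proof.
move=> n0 eta0 qp qeta qM.
have half p : is_poly p ->
    (forall x, enorm (x - a) < rho -> - eta <= lap p x) ->
    (forall x, enorm (x - a) = rho -> p x <= M) ->
    forall x, enorm (x - a) <= rho -> p x <= M + eta * rho ^+ 2.
  move=> pp peta pM x xa.
  have Ep : is_poly (fun x => eta * sqdist a x) by apply: is_polyZ; exact: is_poly_sqdist.
  have pEp : is_poly (fun x => p x + eta * sqdist a x) by exact: is_polyD.
  have pEsub y : enorm (y - a) < rho -> 0 <= lap (fun x => p x + eta * sqdist a x) y.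
    move=> ya; rewrite lapD// lapZ; last exact: is_poly_sqdist.
    rewrite lap_sqdist.
    have := peta y ya; have : (1 : R) <= n%:R by rewrite ler1n.
    nra.
  have pEbd y : enorm (y - a) = rho -> p y + eta * sqdist a y <= M + eta * rho ^+ 2.
    by move=> ya; rewrite sqdistE ya lerD2r pM.
  apply: le_trans (max_principle n0 pEp pEsub pEbd xa).
  by rewrite lerDl; apply: mulr_ge0 => //; rewrite sqdistE sqr_ge0.
move=> x xa; rewrite ler_norml; apply/andP; split.
  rewrite lerNl -mulN1r; apply: (half (fun x => -1 * q x)) => //; first exact: is_polyZ.
    move=> y ya; rewrite lapZ//= mulN1r lerN2.
    exact: le_trans (ler_norm _) (qeta _ ya).
  by move=> y /qM; rewrite mulN1r ler_norml lerNl => /andP[].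
apply: half => // y; first by move=> /qeta; rewrite ler_norml => /andP[].
by move=> /qM /ler_normlW.
Qed.

End MaximumPrinciple.

(** * The Dirichlet problem in a ball with polynomial data *)
Section FiniteSpan.
Context {R : fieldType} {X : Type}.
Implicit Types (P : (X -> R) -> Prop) (u v : X -> R).

Definition spans (I : finType) (b : I -> X -> R) P :=
  forall u, P u <-> exists c : I -> R, u = fun x => \sum_i c i * b i x.

(** A linear injective endomorphism of a finitely spanned space of functions is
onto: in a spanning family of least size, which is free, its matrix is
row-free, hence invertible. *)
Lemma inj_surj_spans P (T : (X -> R) -> X -> R) :
  (exists (I : finType) (b : I -> X -> R), spans b P) ->
  (forall m (c : 'I_m -> R) (b : 'I_m -> X -> R), (forall i, P (b i)) ->
    T (fun x => \sum_i c i * b i x) = fun x => \sum_i c i * T (b i) x) ->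
  (forall u, P u -> P (T u)) ->
  (forall u, P u -> T u = (fun=> 0) -> u = fun=> 0) ->
  forall v, P v -> exists2 u, P u & T u = v.
Proof.
move=> [I [b0 b0P]] Tlin TP Tinj.
have exm : exists m, `[< exists b : 'I_m -> X -> R, spans b P >].
  exists #|I|; apply/asboolP; exists (fun k => b0 (enum_val k)) => u.
  rewrite b0P; split => -[c ->].
    exists (fun k => c (enum_val k)); apply/funext => x.
    by rewrite (reindex_onto enum_val enum_rank)/= => [|i _]; [|exact: enum_rankK];
      apply: eq_bigl => k; rewrite enum_valK eqxx.
  exists (fun i => c (enum_rank i)); apply/funext => x.
  rewrite [RHS](reindex_onto enum_val enum_rank)/= => [|i _]; last exact: enum_rankK.
  by apply: eq_big => [k|k _]; rewrite enum_valK ?eqxx.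
pose m := ex_minn exm.
have [/asboolP[b bP] mmin] : `[< exists b : 'I_m -> X -> R, spans b P >] /\
    forall k, `[< exists b : 'I_k -> X -> R, spans b P >] -> (m <= k)%N.
  by rewrite /m; case: ex_minnP.
have bb i : P (b i).
  apply/bP; exists (fun k => (k == i)%:R); apply/funext => x.
  by rewrite (bigD1 i)//= eqxx mul1r big1 ?addr0// => k /negbTE ->; rewrite mul0r.
have bfree (c : 'I_m -> R) : (fun x => \sum_i c i * b i x) = (fun=> 0) -> forall i, c i = 0.
  move=> cb k; apply/eqP; apply: contraT => ck.
  have [m' mm'] : exists m', m = m'.+1.
    by case: (m) k {b bP mmin bb c cb ck} => [[]//|m' _]; exists m'.
  have bk : b k = fun x => \sum_(i < m | i != k) (- (c i / c k)) * b i x.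
    apply/funext => x; have /(congr1 (fun f => f x)) := cb.
    rewrite (bigD1 k)//= => /eqP; rewrite addr_eq0 => /eqP ckb.
    apply: (mulfI ck); rewrite ckb mulr_sumr -sumrN.
    by apply: eq_bigr => i _; field.
  suff : (m <= m')%N by rewrite mm' ltnn.
  have mm'' : m' = m.-1 by rewrite mm'.
  rewrite mm''; apply: mmin; apply/asboolP; exists (fun i => b (lift k i)) => u.
  rewrite bP; split => -[d ->].
    exists (fun i => d (lift k i) - d k * (c (lift k i) / c k)); apply/funext => x.
    rewrite (bigD1_ord k)//= [X in d k * X](_ : b k x =
      \sum_(i < m.-1) (- (c (lift k i) / c k)) * b (lift k i) x); last first.
      rewrite {1}bk (reindex_omap (lift k) (unlift k)); last first.
        by move=> i; case: unliftP => [j ->|->]//=; rewrite eqxx.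
      by apply: eq_bigl => i; rewrite liftK eqxx andbT eq_sym neq_lift.
    rewrite mulr_sumr -big_split/=; apply: eq_bigr => i _.
    by rewrite mulrBl mulNr mulrN [RHS]addrC mulrA.
  exists (fun i => oapp d 0 (unlift k i)); apply/funext => x.
  rewrite [RHS](bigD1_ord k)//= unlift_none/= mul0r add0r.
  by apply: eq_bigr => i _; rewrite liftK.
have /choice[A TA] : forall i, exists c : 'I_m -> R, T (b i) = fun x => \sum_j c j * b j x.
  by move=> i; apply/bP/TP.
pose Am := \matrix_(i < m, j < m) A i j.
have Tc (c : 'rV[R]_m) : T (fun x => \sum_i c ord0 i * b i x) =
    fun x => \sum_j (c *m Am) ord0 j * b j x.
  rewrite Tlin//; apply/funext => x.
  under eq_bigr do rewrite TA mulr_sumr.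
  rewrite exchange_big/=; apply: eq_bigr => j _.
  by rewrite mxE mulr_suml; apply: eq_bigr => i _; rewrite mxE mulrA.
have Aunit : Am \in unitmx.
  rewrite -row_free_unit; apply: inj_row_free => c cA.
  have /bfree c0 : (fun x => \sum_i c ord0 i * b i x) = fun=> 0.
    apply: Tinj; first by apply/bP; eexists.
    rewrite Tc cA; apply/funext => x; rewrite big1// => j _.
    by rewrite mxE mul0r.
  by apply/rowP => i; rewrite mxE c0.
move=> v /bP[d ->]; pose c : 'rV[R]_m := (\row_i d i) *m invmx Am.
exists (fun x => \sum_i c ord0 i * b i x); first by apply/bP; eexists.
rewrite Tc -mulmxA mulVmx// mulmx1; apply/funext => x.
by apply: eq_bigr => j _; rewrite mxE.
Qed.

End FiniteSpan.

Section Dirichlet.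
Context {R : realType} {n : nat}.
Implicit Types (x y a : 'rV[R]_n) (i j : 'I_n) (p q : 'rV[R]_n -> R).

Lemma poly_on_line q x y : is_poly q ->
  exists P : {poly R}, forall t, q (x + t *: y) = P.[t].
Proof.
move=> [d]; elim: d q => [|d IH] q /=.
  by move=> [c ->]; exists c%:P => t; rewrite hornerC.
move=> [p0 [p [/IH[P0 P0E] pd ->]]].
have /choice[P PE] i := IH _ (pd i).
exists (P0 + \sum_(i < n) ((x ord0 i)%:P + (y ord0 i) *: 'X) * P i) => t.
rewrite P0E hornerD horner_sum; congr (_ + _); apply: eq_bigr => i _.
by rewrite hornerM PE !mxE hornerD hornerC hornerZ hornerX [t * _]mulrC.
Qed.

(** On each line through [a] the restriction is a one-variable polynomial with
infinitely many roots. *)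
Lemma poly_eq0_ball q a (rho : R) : 0 < rho -> is_poly q ->
  (forall x, enorm (x - a) < rho -> q x = 0) -> q = fun=> 0.
Proof.
move=> rho0 qp q0; apply/funext => z.
have [P PE] := poly_on_line a (z - a) qp.
suff P0 : P = 0.
  by have := PE 1; rewrite scale1r addrC subrK P0 horner0.
apply/eqP; apply: contraT => Pn0.
have en0 : 0 < enorm (z - a) + 1 by rewrite ltr_wpDl// enorm_ge0.
pose t (k : nat) : R := rho / (enorm (z - a) + 1) / k.+2%:R.
have t0 k : 0 < t k by rewrite !divr_gt0// ltr0n.
have tE k : t k * (enorm (z - a) + 1) * k.+2%:R = rho.
  rewrite /t; field; rewrite (gt_eqF en0) andbT.
  by rewrite -[2 + _]natrD gt_eqF// ltr0n.
have troot k : root P (t k).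
  apply/rootP; rewrite -PE; apply: q0; rewrite [a + _]addrC addrK enormZ gtr0_norm//.
  have := tE k; have := enorm_ge0 (z - a); have := t0 k.
  have : (2 : R) <= k.+2%:R by rewrite ler_nat.
  set e := enorm _; set s := t k; set m := k.+2%:R => m2 s0 e0 <-.
  have se : 0 <= s * e by rewrite mulr_ge0// ltW.
  nra.
have tinj : injective t.
  move=> k l kl; have := tE l; rewrite -kl -(tE k).
  move/(mulfI (lt0r_neq0 (mulr_gt0 (t0 k) en0)))/eqP.
  by rewrite eqr_nat => /eqP[].
have := @max_poly_roots _ P (map t (iota 0 (size P))) Pn0.
rewrite size_map size_iota ltnn; apply => //.
  by apply/allP => s /mapP[k _ ->]; exact: troot.
by rewrite map_inj_uniq ?iota_uniq.
Qed.

Lemma poly_deg_lin d m (c : 'I_m -> R) (b : 'I_m -> 'rV[R]_n -> R) :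
  (forall k, poly_deg d (b k)) -> poly_deg d (fun x => \sum_k c k * b k x).
Proof.
move=> bd; elim: (index_enum _) => [|k s IH].
  rewrite (_ : (fun x => _) = fun=> 0); first exact: poly_deg_cst.
  by apply/funext => x; rewrite big_nil.
rewrite (_ : (fun x => _) = fun x => c k * b k x + \sum_(j <- s) c j * b j x).
  by apply: poly_degD => //; exact: poly_degZ.
by apply/funext => x; rewrite big_cons.
Qed.

Lemma poly_deg_spans d : exists (I : finType) (b : I -> 'rV[R]_n -> R),
  spans b (poly_deg d).
Proof.
suff [I [b [bd bs]]] : exists (I : finType) (b : I -> 'rV[R]_n -> R),
    (forall k, poly_deg d (b k)) /\
    forall q, poly_deg d q -> exists c : I -> R, q = fun x => \sum_k c k * b k x.
  exists I, b => q; split; first exact: bs.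
  move=> [c ->]; rewrite (_ : (fun x => _) =
      fun x => \sum_(k < #|I|) c (enum_val k) * b (enum_val k) x).
    by apply: (@poly_deg_lin d _ (fun k => c (enum_val k)) (fun k => b (enum_val k))).
  apply/funext => x.
  rewrite (reindex_onto enum_val enum_rank)/= => [|i _]; last exact: enum_rankK.
  by apply: eq_bigl => k; rewrite enum_valK eqxx.
elim: d => [|d [I [b [bd bs]]]].
  exists unit, (fun=> fun=> 1); split; first by move=> _; exists 1.
  move=> q [c ->]; exists (fun=> c); apply/funext => x.
  by rewrite (big_pred1 tt) ?mulr1// => -[].
exists (I + ('I_n * I))%type, (fun k => match k with
  | inl i => b i | inr ji => fun x => x ord0 ji.1 * b ji.2 x end).
split.
  move=> [i|[j i]]; first exact/poly_degS/bd.
  exact: (@poly_degM _ _ 1 d _ _ (poly_deg_coord j) (bd i)).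
move=> q [p0 [p [/bs[c0 ->] pd ->]]].
have /choice[c cE] j := bs _ (pd j).
exists (fun k => match k with inl i => c0 i | inr ji => c ji.1 ji.2 end).
apply/funext => x; rewrite big_sumType/=; congr (_ + _).
rewrite -(pair_bigA _ (fun j k => c j k * (x ord0 j * b k x)))/=.
apply: eq_bigr => j _; rewrite cE mulr_sumr; apply: eq_bigr => k _.
by rewrite mulrCA.
Qed.

Lemma pder_lin i m (c : 'I_m -> R) (b : 'I_m -> 'rV[R]_n -> R) :
  (forall k, is_poly (b k)) ->
  pder i (fun x => \sum_k c k * b k x) = fun x => \sum_k c k * pder i (b k) x.
Proof.
move=> bp; rewrite pder_sum => [|k]; last exact: is_polyZ.
by apply/funext => x; apply: eq_bigr => k _; rewrite pderZ.
Qed.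

Lemma lap_lin m (c : 'I_m -> R) (b : 'I_m -> 'rV[R]_n -> R) :
  (forall k, is_poly (b k)) ->
  lap (fun x => \sum_k c k * b k x) = fun x => \sum_k c k * lap (b k) x.
Proof.
move=> bp; have E i : pder i (pder i (fun x => \sum_k c k * b k x)) =
    fun x => \sum_k c k * pder i (pder i (b k)) x.
  by rewrite pder_lin// pder_lin// => k; exact: is_poly_pder.
apply/funext => x.
transitivity (\sum_(i < n) \sum_k c k * pder i (pder i (b k)) x).
  by apply: eq_bigr => i _; rewrite E.
by rewrite exchange_big; apply: eq_bigr => k _; rewrite mulr_sumr.
Qed.

(** With [eta = rho^2 - |x-a|^2], the map [q |-> lap (eta * q)] sends
polynomials of degree at most [d] to themselves and is injective by the maximum
principle, hence onto; correcting [p] by a multiple of [eta] prescribes the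
Laplacian without changing the values on the sphere. *)
Theorem poly_dirichlet a (rho : R) p phi : (0 < n)%N -> 0 < rho ->
  is_poly p -> is_poly phi ->
  exists v, [/\ is_poly v, lap v = phi &
    forall x, enorm (x - a) = rho -> v x = p x].
Proof.
move=> n0 rho0 pp phip.
pose eta x := rho ^+ 2 - sqdist a x.
have etaP : poly_deg 2 eta.
  rewrite (_ : eta = fun x => rho ^+ 2 + -1 * sqdist a x); last first.
    by apply/funext => x; rewrite mulN1r.
  by apply: poly_degD; [exact: poly_deg_cst|apply: poly_degZ; exact: poly_deg_sqdist].
have etap : is_poly eta by exists 2%N.
have [d dP] : is_poly (fun x => phi x - lap p x).
  by apply: is_polyB => //; exact: is_poly_lap.
pose T q := lap (fun x => eta x * q x).
have qp q : poly_deg d q -> is_poly q by move=> qd; exists d.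
have [||||q qd Tq] := @inj_surj_spans _ _ (poly_deg d) T _ _ _ _ _ dP.
- exact: poly_deg_spans.
- move=> m c b bd; rewrite /T -lap_lin => [|k]; last first.
    by apply: is_polyM => //; exact: qp (bd k).
  congr lap; apply/funext => x; rewrite mulr_sumr.
  by apply: eq_bigr => k _; rewrite mulrCA.
- move=> q qd; have eqd : poly_deg d.+2 (fun x => eta x * q x).
    exact: (@poly_degM _ _ 2 d).
  rewrite /T /lap.
  rewrite (_ : (fun x => _) = fun x => \sum_(i < n) 1 * pder i (pder i (fun x => eta x * q x)) x).
    by apply: poly_deg_lin => i; do 2!apply: poly_deg_pder.
  by apply/funext => x; apply: eq_bigr => i _; rewrite mul1r.
- move=> q qd Tq0.
  have eqp : is_poly (fun x => eta x * q x) by apply: is_polyM => //; exact: qp.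
  apply: (@poly_eq0_ball q a rho) => //; first exact: qp.
  move=> x xa.
  have : `|eta x * q x| <= 0.
    apply: (@max_principle_abs _ _ _ a rho 0 n0 eqp) => [y _|y ya|]; last exact: ltW.
      by rewrite -/(T q) Tq0.
    by rewrite /eta sqdistE ya subrr mul0r normr0.
  rewrite normr_le0 mulf_eq0 => /orP[|/eqP//].
  rewrite /eta subr_eq0 sqdistE eqrXn2 ?enorm_ge0 ?(ltW rho0)// => /eqP rx.
  by move: xa; rewrite -rx ltxx.
exists (fun x => p x + eta x * q x); have eqp : is_poly (fun x => eta x * q x).
  by apply: is_polyM => //; exact: qp.
split.
- exact: is_polyD.
- rewrite lapD// -/(T q) Tq; apply/funext => x.
  by rewrite addrC subrK.
- by move=> x xa; rewrite /eta sqdistE xa subrr mul0r addr0.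
Qed.

End Dirichlet.

(** * Uniform approximation by polynomials on a ball *)
Section Weierstrass.
Context {R : realType} {n : nat}.
Implicit Types (x y z c : 'rV[R]_n) (i j : 'I_n) (F G u : 'rV[R]_n -> R).

Local Notation e_ i := (delta_mx ord0 i : 'rV[R]_n).

(** Expected value of [F] at the position reached from [z] after [m] independent
steps, each of which is [h e_i] with probability [w i y] and zero otherwise.  As
a function of [y] it is a polynomial when the weights are affine: this is the
Bernstein operator of a simplex, in a form suited to induction on [m]. *)
Fixpoint walk (w : 'I_n -> 'rV[R]_n -> R) (h : R) (m : nat) F z y : R :=
  if m is m'.+1 then
    (1 - \sum_(i < n) w i y) * walk w h m' F z y +
    \sum_(i < n) w i y * walk w h m' F (z + h *: e_ i) y
  else F z.

Variable w : 'I_n -> 'rV[R]_n -> R.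

Lemma is_poly_walk h m F z : (forall i, is_poly (w i)) -> is_poly (walk w h m F z).
Proof.
move=> wp; elim: m z => [|m IH] z /=; first exact: is_poly_cst.
apply: is_polyD.
  apply: is_polyM => //; apply: is_polyB; first exact: is_poly_cst.
  exact: is_poly_sum.
by apply: is_poly_sum => i; exact: is_polyM.
Qed.

Lemma walk_affine h m F z y (a k : R) :
  walk w h m (fun x => a + k * F x) z y = a + k * walk w h m F z y.
Proof.
elim: m z => [//|m IH] z /=.
have -> : \sum_(i < n) w i y * walk w h m (fun x => a + k * F x) (z + h *: e_ i) y =
    (\sum_(i < n) w i y) * a + k * \sum_(i < n) w i y * walk w h m F (z + h *: e_ i) y.
  rewrite mulr_suml mulr_sumr -big_split; apply: eq_bigr => i _.
  by rewrite IH mulrDr mulrCA.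
by rewrite IH; ring.
Qed.

Lemma ler_walk h m F G z y : (forall i, 0 <= w i y) -> \sum_(i < n) w i y <= 1 ->
  (forall x, F x <= G x) -> walk w h m F z y <= walk w h m G z y.
Proof.
move=> wy0 wy1 FG; elim: m z => [//|m IH] z /=.
apply: lerD; first by rewrite ler_wpM2l// subr_ge0.
by apply: ler_sum => i _; rewrite ler_wpM2l.
Qed.

(** The second moment about [c]: squared bias plus variance. *)
Lemma walk_sqdist h m c z y : walk w h m (sqdist c) z y =
  \sum_(i < n) (z ord0 i - c ord0 i + h * m%:R * w i y) ^+ 2 +
  h ^+ 2 * m%:R * \sum_(i < n) w i y * (1 - w i y).
Proof.
elim: m z => [|m IH] z /=.
  by rewrite !mulr0 mul0r addr0; apply: eq_bigr => i _; rewrite mul0r addr0.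
rewrite IH.
pose A i := z ord0 i - c ord0 i + h * m%:R * w i y.
set V := h ^+ 2 * m%:R * _.
have -> : \sum_(j < n) w j y * walk w h m (sqdist c) (z + h *: e_ j) y =
    \sum_(j < n) w j y * (\sum_(i < n) A i ^+ 2 + V) +
    \sum_(j < n) w j y * (2 * h * A j + h ^+ 2).
  rewrite -big_split/=; apply: eq_bigr => j _; rewrite -mulrDr IH -/V; congr (_ * _).
  rewrite addrAC; congr (_ + V).
  rewrite (bigD1 j)//= [in RHS](bigD1 j)//= [RHS]addrAC; congr (_ + _).
    by rewrite !mxE !eqxx/= /A; ring.
  by apply: eq_bigr => i ij; rewrite !mxE (negbTE ij) andbF mulr0 addr0.
rewrite -mulr_suml addrA -mulrDl subrK mul1r /V !mulr_sumr -!big_split/=.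
by apply: eq_bigr => i _; rewrite /A -[m.+1]addn1 natrD; ring.
Qed.

End Weierstrass.

Section Weierstrass_ball.
Context {R : realType} {n : nat}.
Implicit Types (x y z c : 'rV[R]_n) (i j : 'I_n) (F G u : 'rV[R]_n -> R).

(** The walk with steps of length [D / m] from the corner [(-r, ..., -r)] has mean
position [y] after [m] steps and variance at most [D^2 / m]; the weights below
are probabilities as long as [y] lies in the ball. *)
Lemma walk_approx F (r e K : R) : (0 < n)%N -> 0 < r -> 0 < e -> 0 <= K ->
  (forall y z, enorm y <= r -> `|F z - F y| <= e + K * sqdist y z) ->
  exists p, is_poly p /\ forall y, enorm y <= r -> `|p y - F y| <= 2 * e.
Proof.
move=> n0 r0 e0 K0 Fe.
have nn0 : (0 : R) < n%:R by rewrite ltr0n.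
pose D := 2 * n%:R * r; have D0 : 0 < D by rewrite !mulr_gt0.
pose w i y := D^-1 * (y ord0 i + r).
have wp i : is_poly (w i).
  by apply: is_polyZ; apply: is_polyD; [exact: is_poly_coord|exact: is_poly_cst].
have [m mK] : exists m : nat, K * D ^+ 2 / e < m%:R.
  exists (Num.Def.archi_bound (K * D ^+ 2 / e)).
  by apply: archi_boundP; rewrite divr_ge0 ?mulr_ge0 ?sqr_ge0// ltW.
have m0 : (0 : R) < m%:R.
  by apply: le_lt_trans mK; rewrite divr_ge0 ?mulr_ge0 ?sqr_ge0// ltW.
pose h := D / m%:R.
exists (walk w h m F (const_mx (- r))); split; first exact: is_poly_walk.
move=> y yr.
have yi i : - r <= y ord0 i <= r.
  by rewrite -ler_norml; apply: le_trans yr; exact: le_coord_enorm.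
have wy0 i : 0 <= w i y.
  by apply: mulr_ge0; [rewrite invr_ge0 ltW|have /andP[] := yi i; lra].
have wy1 : \sum_(i < n) w i y <= 1.
  rewrite -mulr_sumr mulrC ler_pdivrMr// mul1r.
  apply: (@le_trans _ _ (\sum_(i < n) 2 * r)).
    by apply: ler_sum => i _; have /andP[] := yi i; lra.
  by rewrite sumr_const card_ord -mulr_natr /D le_eqVlt; apply/orP; left; apply/eqP; ring.
have var : K * walk w h m (sqdist y) (const_mx (- r)) y <= e.
  rewrite walk_sqdist big1 ?add0r => [|i _]; last first.
    by rewrite mxE /h /w; apply/eqP; rewrite sqrf_eq0; apply/eqP; field; rewrite !gt_eqF.
  have S1 : \sum_(i < n) w i y * (1 - w i y) <= 1.
    apply: le_trans wy1; apply: ler_sum => i _.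
    by rewrite ler_piMr// gerBl.
  have -> : h ^+ 2 * m%:R = D ^+ 2 / m%:R by rewrite /h; field; rewrite gt_eqF.
  apply: (@le_trans _ _ (K * (D ^+ 2 / m%:R))).
    by rewrite ler_wpM2l// ler_piMr// divr_ge0 ?sqr_ge0// ltW.
  by rewrite mulrA ler_pdivrMr// [e * _]mulrC -ler_pdivrMr// ltW.
have up : walk w h m F (const_mx (- r)) y <= (F y + e) + K * walk w h m (sqdist y) (const_mx (- r)) y.
  rewrite -walk_affine; apply: ler_walk => // z.
  by have := Fe y z yr; rewrite ler_norml => /andP[_]; lra.
have lo : (F y - e) + (- K) * walk w h m (sqdist y) (const_mx (- r)) y <= walk w h m F (const_mx (- r)) y.
  rewrite -walk_affine; apply: ler_walk => // z.
  by have := Fe y z yr; rewrite ler_norml => /andP[+ _]; lra.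
by rewrite ler_norml; apply/andP; split; lra.
Qed.

(** Nearest-point projection on the closed ball. *)
Definition ball_proj (r : R) z : 'rV[R]_n :=
  if enorm z <= r then z else (r / enorm z) *: z.

Lemma ball_proj_in r z : 0 < r -> enorm (ball_proj r z) <= r.
Proof.
move=> r0; rewrite /ball_proj; case: ifPn => //; rewrite -ltNge => zr.
have z0 : 0 < enorm z by exact: lt_trans zr.
rewrite enormZ ger0_norm; last by apply: divr_ge0; exact: ltW.
by rewrite divfK ?gt_eqF.
Qed.

Lemma ball_proj_dist r y z : 0 < r -> enorm y <= r ->
  enorm (ball_proj r z - y) <= 2 * enorm (z - y).
Proof.
move=> r0 yr; rewrite /ball_proj; case: ifPn => [_|].
  by rewrite ler_peMl ?enorm_ge0// ler1n.
rewrite -ltNge => zr; have z0 : 0 < enorm z by exact: lt_trans zr.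
apply: (le_trans (enorm_triangle z _ _)).
rewrite -[X in _ *: _ - X]scale1r -scalerBl enormZ.
have -> : `|r / enorm z - 1| * enorm z = enorm z - r.
  rewrite ltr0_norm; first by field; rewrite gt_eqF.
  by rewrite subr_lt0 ltr_pdivrMr// mul1r.
have := enormD (z - y) y; rewrite subrK; lra.
Qed.

Lemma uniform_continuity u (r e : R) : 0 < e ->
  {within eclosed_ball r, continuous u} ->
  exists2 d : R, 0 < d & forall x y, enorm x <= r -> enorm y <= r ->
    `|x - y| < d -> `|u x - u y| <= e.
Proof.
move=> e0 uc.
have cover : \forall d \near (0 : R)^'+, eclosed_ball r `<=` (fun x => enorm x <= r ->
    forall y, enorm y <= r -> `|x - y| < d -> `|u x - u y| <= e).
  apply: ((compact_near_coveringP _).1 (@compact_eclosed_ball R n r)) => x xr.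
  have [d d0 H] := (within_continuousP _ _).1 uc x xr _ (divr_gt0 e0 (ltr0Sn R 1)).
  have d20 : 0 < d / 2 by rewrite divr_gt0.
  exists ([set x' | `|x' - x| < d / 2], [set t | t < d / 2]) => /=.
    split; first by apply/nearP; exists (d / 2).
    exact: nbhs_right_lt.
  move=> [x' t]/= [x'd td] x'r y yr x'y.
  have yx : `|y - x| < d.
    rewrite -[y - x](_ : (x' - x) - (x' - y) = _); last first.
      by rewrite opprB addrC addrA subrK.
    by apply: le_lt_trans (ler_normB _ _) _; lra.
  have ux' : `|u x' - u x| < e / 2 by apply: H => //; lra.
  have uy := H _ yr yx.
  rewrite (_ : u x' - u y = (u x' - u x) - (u y - u x)); last by ring.
  by apply: le_trans (ler_normB _ _) _; lra.
have [d [dP d0]] : exists d : R, (eclosed_ball r `<=` (fun x => enorm x <= r ->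
    forall y, enorm y <= r -> `|x - y| < d -> `|u x - u y| <= e)) /\ 0 < d.
  by apply: (@filter_ex _ (0 : R)^'+); apply: filterI => //; exact: nbhs_right_gt.
by exists d => // x y xr; exact: dP.
Qed.

(** Composing with the projection on the ball extends [u] to the whole space;
uniform continuity and boundedness then give the quadratic modulus required by
the variance estimate for the random walk. *)
Theorem weierstrass_ball u (r e : R) : (0 < n)%N -> 0 < r -> 0 < e ->
  {within eclosed_ball r, continuous u} ->
  exists p, is_poly p /\ forall y, enorm y <= r -> `|p y - u y| <= e.
Proof.
move=> n0 r0 e0 uc.
have e20 : 0 < e / 2 by rewrite divr_gt0.
have [d d0 ud] := uniform_continuity e20 uc.
have [M M0 uM] := within_bounded uc.
have K0 : 0 <= 8 * M / d ^+ 2.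
  by apply: divr_ge0; [exact: mulr_ge0|exact: sqr_ge0].
have [y z yr|p [pp pu]] := walk_approx (F := u \o ball_proj r) n0 r0 e20 K0.
  have -> : (u \o ball_proj r) y = u y by rewrite /= /ball_proj yr.
  have zr := ball_proj_in z r0; rewrite /=.
  have sq0 : 0 <= 8 * M / d ^+ 2 * sqdist y z.
    by rewrite mulr_ge0// sqdistE sqr_ge0.
  have [zy|zy] := ltP (2 * enorm (z - y)) d.
    have zyd : `|ball_proj r z - y| < d.
      apply: le_lt_trans zy; apply: le_trans (norm_le_enorm _) _.
      exact: ball_proj_dist.
    by apply: le_trans (ud _ _ zr yr zyd) _; rewrite lerDl.
  apply: (@le_trans _ _ (2 * M)).
    by apply: le_trans (ler_normB _ _) _; have := uM _ zr; have := uM _ yr; lra.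
  rewrite ler_wpDl ?(ltW e20)// sqdistE -mulrA mulrAC.
  have dd : d ^+ 2 <= 4 * enorm (z - y) ^+ 2.
    rewrite (_ : 4 * _ = (2 * enorm (z - y)) ^+ 2); last by ring.
    by rewrite lerXn2r// nnegrE// ?mulr_ge0 ?enorm_ge0// ltW.
  rewrite mulrA ler_pdivlMr ?exprn_gt0//; nra.
exists p; split => // y yr; have := pu y yr.
by rewrite /= /ball_proj yr mulrC divfK.
Qed.

End Weierstrass_ball.

(** * Interior estimates for harmonic polynomials *)
Section Harmonic.
Context {R : realType} {n : nat}.
Implicit Types (x y a : 'rV[R]_n) (i j k : 'I_n) (p q h : 'rV[R]_n -> R).

Lemma pderC i j q : is_poly q -> pder i (pder j q) = pder j (pder i q).
Proof.
move=> [d]; elim: d q => [|d IH] q.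
  by move=> qd; rewrite !(poly_deg_pder0 _ qd) !pder_cst.
move=> [p0 [p [p0d pd ->]]].
have P0 : is_poly p0 by exists d.
have P k : is_poly (p k) by exists d; exact: pd.
have PX k l : is_poly (fun x => x ord0 l * pder k (p l) x).
  by apply: is_polyM; [exact: is_poly_coord|exact: is_poly_pder].
have E k l : pder k (pder l (fun x => p0 x + \sum_(m < n) x ord0 m * p m x)) =
    fun x => pder k (p l) x + (pder l (p k) x + (pder k (pder l p0) x +
      \sum_(m < n) x ord0 m * pder k (pder l (p m)) x)).
  rewrite pder_coord_expansion// pderD; [|exact: P|]; last first.
    by apply: is_polyD; [exact: is_poly_pder|exact: is_poly_sum].
  rewrite (pder_coord_expansion k (is_poly_pder l P0))// => m.
  exact: is_poly_pder.
rewrite (E i j) (E j i); apply/funext => x; rewrite [RHS]addrCA.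
rewrite (IH _ p0d); do 3!congr (_ + _).
by apply: eq_bigr => m _; rewrite (IH _ (pd m)).
Qed.

Lemma lap_pder i q : is_poly q ->
  lap (pder i q) = pder i (lap q).
Proof.
move=> qp; rewrite /lap pder_sum => [|k]; last exact/is_poly_pder/is_poly_pder.
apply/funext => x; apply: eq_bigr => k _.
by rewrite (pderC k i)// (pderC k i)//; exact: is_poly_pder.
Qed.

Lemma lap_pder0 i q : is_poly q -> lap q = (fun=> 0) ->
  lap (pder i q) = fun=> 0.
Proof. by move=> qp q0; rewrite lap_pder// q0 pder_cst. Qed.

Lemma lap_sqr q : is_poly q -> lap (fun x => q x * q x) =
  fun x => 2 * q x * lap q x + 2 * \sum_(i < n) pder i q x ^+ 2.
Proof.
move=> qp; rewrite lapM//; apply/funext => x.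
rewrite (eq_bigr (fun i => pder i q x ^+ 2)) => [|i _]; last by rewrite expr2.
by move: (\sum_(i < n) _) (lap q x) (q x) => s l c; ring.
Qed.

(** Bernstein's argument: with the cut-off [eta = rho^2 - |x-a|^2], the function
[eta^2 (d_i h)^2 + A h^2] is subharmonic as soon as [A] dominates the terms
produced by differentiating [eta], so its value at the centre is bounded by the
boundary values of [A h^2]. *)
Lemma gradient_bound h a (rho M : R) i : (0 < n)%N -> 0 < rho -> is_poly h ->
  lap h = (fun=> 0) -> (forall x, enorm (x - a) <= rho -> `|h x| <= M) ->
  rho * `|pder i h a| <= (2 * n%:R + 12) * M.
Proof.
move=> n0 rho0 hp h0 hM.
set p := pder i h; have pp : is_poly p by exact: is_poly_pder.
have p0 : lap p = fun=> 0 by exact: lap_pder0.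
pose C : R := 2 * n%:R + 12; pose A := C * rho ^+ 2.
have n0R : (0 : R) <= n%:R by exact: ler0n.
have aa : enorm (a - a) <= rho by rewrite subrr enorm0 ltW.
have M0 : 0 <= M by exact: le_trans (normr_ge0 _) (hM a aa).
pose eta x := rho ^+ 2 - sqdist a x.
have sp := @is_poly_sqdist R n a.
have etap : is_poly eta by apply: is_polyB => //; exact: is_poly_cst.
have eta2p : is_poly (fun x => eta x * eta x) by exact: is_polyM.
have p2p : is_poly (fun x => p x * p x) by exact: is_polyM.
have h2p : is_poly (fun x => h x * h x) by exact: is_polyM.
have ep2p : is_poly (fun x => (eta x * eta x) * (p x * p x)) by exact: is_polyM.
have Fp : is_poly (fun x => (eta x * eta x) * (p x * p x) + A * (h x * h x)).
  by apply: is_polyD => //; exact: is_polyZ.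
have detai j : pder j eta = fun x => - (2 * (x ord0 j - a ord0 j)).
  rewrite pderB//; last exact: is_poly_cst.
  by rewrite pder_cst pder_sqdist; apply/funext => x; rewrite sub0r.
have leta : lap eta = fun=> - (2 * n%:R).
  rewrite lapB//; last exact: is_poly_cst.
  by rewrite lap_cst lap_sqdist; apply/funext => x; rewrite sub0r.
have sub x : enorm (x - a) < rho ->
    0 <= lap (fun x => (eta x * eta x) * (p x * p x) + A * (h x * h x)) x.
  move=> xa.
  rewrite lapD//; last exact: is_polyZ.
  rewrite lapZ// lapM// !lap_sqr// p0 h0 leta.
  rewrite !mulr0 !add0r.
  have sE : sqdist a x < rho ^+ 2.
    by rewrite sqdistE ltrXn2r// ?nnegrE ?enorm_ge0// ltW.
  have s0 : 0 <= sqdist a x by rewrite sqdistE sqr_ge0.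
  have -> : \sum_(j < n) pder j eta x ^+ 2 = 4 * sqdist a x.
    by rewrite mulr_sumr; apply: eq_bigr => j _; rewrite detai; ring.
  have -> : \sum_(j < n) pder j (fun x => eta x * eta x) x * pder j (fun x => p x * p x) x =
      \sum_(j < n) (2 * eta x * pder j eta x) * (2 * p x * pder j p x).
    apply: eq_bigr => j _; rewrite !pderM//.
    by move: (pder j eta x) (eta x) (pder j p x) (p x) => c1 c2 c3 c4; ring.
  have hi : p x ^+ 2 <= \sum_(j < n) pder j h x ^+ 2.
    rewrite (bigD1 i)//= lerDl; apply: sumr_ge0 => j _; exact: sqr_ge0.
  have cross : - (6 * (4 * sqdist a x) * p x ^+ 2) <=
      2 * (4 * sqdist a x) * p x ^+ 2 +
      2 * \sum_(j < n) (2 * eta x * pder j eta x) * (2 * p x * pder j p x) +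
      2 * eta x ^+ 2 * \sum_(j < n) pder j p x ^+ 2.
    have -> : 4 * sqdist a x = \sum_(j < n) pder j eta x ^+ 2.
      by rewrite mulr_sumr; apply: eq_bigr => j _; rewrite detai; ring.
    rewrite !mulr_sumr !mulr_suml -sumrN -!big_split/=; apply: ler_sum => j _.
    rewrite -subr_ge0.
    rewrite [leRHS](_ : _ = 2 * (eta x * pder j p x + 2 * pder j eta x * p x) ^+ 2).
      by rewrite mulr_ge0// sqr_ge0.
    by move: (pder j eta x) (eta x) (pder j p x) (p x) => c1 c2 c3 c4; ring.
  have etax : 0 <= eta x <= rho ^+ 2 by rewrite /eta; apply/andP; split; lra.
  move: cross hi; rewrite /A /C.
  set S1 := \sum_(j < n) (_ * _); set S2 := \sum_(j < n) pder j p x ^+ 2.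
  set S3 := \sum_(j < n) pder j h x ^+ 2; move: S1 S2 S3 => S1 S2 S3 cross hi.
  move: etax => /andP[e0 e1].
  have P2 : 0 <= p x ^+ 2 by exact: sqr_ge0.
  have t1 : 0 <= n%:R * p x ^+ 2 * (rho ^+ 2 - eta x).
    by apply: mulr_ge0; [exact: mulr_ge0|rewrite subr_ge0].
  have t2 : 0 <= p x ^+ 2 * (rho ^+ 2 - sqdist a x).
    by apply: mulr_ge0 => //; rewrite subr_ge0 ltW.
  have t3 : 0 <= (2 * n%:R + 12) * rho ^+ 2 * (S3 - p x ^+ 2).
    apply: mulr_ge0; last by rewrite subr_ge0.
    by apply: mulr_ge0; [lra|exact: sqr_ge0].
  move: (p x) (eta x) (sqdist a x) (n%:R : R) P2 t1 t2 t3 cross hi => P e s N *.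
  lra.
have C1 : 1 <= C by rewrite /C; lra.
have A0 : 0 <= A by apply: mulr_ge0; [lra|exact: sqr_ge0].
have bd x : enorm (x - a) = rho ->
    (eta x * eta x) * (p x * p x) + A * (h x * h x) <= A * M ^+ 2.
  move=> xa; rewrite /eta sqdistE xa subrr !mul0r add0r ler_wpM2l//.
  rewrite -expr2 -real_normK ?num_real// lerXn2r ?nnegrE//.
  by apply: hM; rewrite xa.
have := max_principle n0 Fp sub bd aa.
have -> : eta a = rho ^+ 2 by rewrite /eta sqdistE subrr enorm0 expr0n subr0.
rewrite -/p => Fa.
have sq : (rho * `|p a|) ^+ 2 <= (C * M) ^+ 2.
  rewrite exprMn real_normK ?num_real//.
  have r2 : 0 < rho ^+ 2 by rewrite exprn_gt0.
  rewrite -(ler_pM2l r2); apply: (@le_trans _ _ (A * M ^+ 2)).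
    apply: le_trans Fa; rewrite -[leLHS]addr0 lerD//.
      by rewrite le_eqVlt; apply/orP; left; apply/eqP; ring.
    by apply: mulr_ge0 => //; rewrite -expr2 sqr_ge0.
  rewrite /A exprMn [C * _]mulrC -mulrA ler_wpM2l ?sqr_ge0//.
  by rewrite ler_wpM2r ?sqr_ge0// expr2 ler_peMl//; lra.
rewrite -(@ler_pXn2r _ 2)// nnegrE; first by rewrite mulr_ge0// ltW.
by apply: mulr_ge0 => //; lra.
Qed.

Let C : R := 2 * n%:R + 12.

Lemma gradient_bound_ball h a (rho d M : R) i : (0 < n)%N -> 0 < d -> is_poly h ->
  lap h = (fun=> 0) -> (forall x, enorm (x - a) <= rho + d -> `|h x| <= M) ->
  forall x, enorm (x - a) <= rho -> `|pder i h x| <= C / d * M.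
Proof.
move=> n0 d0 hp h0 hM x xa; rewrite mulrAC ler_pdivlMr// mulrC.
apply: gradient_bound => // y yx; apply: hM.
by apply: le_trans (enorm_triangle x _ _) _; lra.
Qed.

(** The factor [1/2] makes [b] and [A] the gradient at [a] and the Hessian when [A]
is symmetric. *)
Definition quad a (c : R) (b : 'I_n -> R) (A : 'I_n -> 'I_n -> R) x : R :=
  c + \sum_(i < n) b i * (x ord0 i - a ord0 i) +
  2^-1 * \sum_(i < n) \sum_(j < n) A i j * ((x ord0 i - a ord0 i) * (x ord0 j - a ord0 j)).

Definition symmetric (A : 'I_n -> 'I_n -> R) := forall i j, A i j = A j i.

Definition tr (A : 'I_n -> 'I_n -> R) : R := \sum_(i < n) A i i.

Lemma is_poly_centred a i : is_poly (fun x => x ord0 i - a ord0 i).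
Proof. by apply: is_polyB; [exact: is_poly_coord|exact: is_poly_cst]. Qed.

Lemma is_poly_linear a (b : 'I_n -> R) :
  is_poly (fun x => \sum_(i < n) b i * (x ord0 i - a ord0 i)).
Proof. by apply: is_poly_sum => i; apply/is_polyZ/is_poly_centred. Qed.

Lemma pder_centred a i j :
  pder i (fun x => x ord0 j - a ord0 j) = fun=> (j == i)%:R.
Proof.
rewrite pderB; [|exact: is_poly_coord|exact: is_poly_cst].
by rewrite pder_coord pder_cst; apply/funext => x; rewrite subr0.
Qed.

Lemma pder_linear a (b : 'I_n -> R) i :
  pder i (fun x => \sum_(j < n) b j * (x ord0 j - a ord0 j)) = fun=> b i.
Proof.
rewrite pder_sum => [|j]; last exact/is_polyZ/is_poly_centred.
apply/funext => x; rewrite (bigD1 i)//= big1 ?addr0 => [|j ji].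
  by rewrite pderZ ?pder_centred ?eqxx ?mulr1//; exact: is_poly_centred.
by rewrite pderZ ?pder_centred ?(negbTE ji) ?mulr0//; exact: is_poly_centred.
Qed.

Lemma is_poly_quadratic a (A : 'I_n -> 'I_n -> R) :
  is_poly (fun x => \sum_(i < n) \sum_(j < n)
    A i j * ((x ord0 i - a ord0 i) * (x ord0 j - a ord0 j))).
Proof.
apply: is_poly_sum => i; apply: is_poly_sum => j; apply: is_polyZ.
by apply: is_polyM; exact: is_poly_centred.
Qed.

Lemma is_poly_quad a c b A : is_poly (quad a c b A).
Proof.
apply: is_polyD; last exact/is_polyZ/is_poly_quadratic.
by apply: is_polyD; [exact: is_poly_cst|exact: is_poly_linear].
Qed.

Lemma pder_quad a c b A k : symmetric A -> pder k (quad a c b A) =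
  fun x => b k + \sum_(j < n) A k j * (x ord0 j - a ord0 j).
Proof.
move=> As.
have pq i j : is_poly (fun x => A i j * ((x ord0 i - a ord0 i) * (x ord0 j - a ord0 j))).
  by apply: is_polyZ; apply: is_polyM; exact: is_poly_centred.
have pc := is_poly_centred a.
rewrite pderD; [|by apply: is_polyD; [exact: is_poly_cst|exact: is_poly_linear]
  |exact/is_polyZ/is_poly_quadratic].
rewrite pderD; [|exact: is_poly_cst|exact: is_poly_linear].
rewrite pder_cst pder_linear pderZ; last exact: is_poly_quadratic.
rewrite pder_sum => [|i]; last exact: is_poly_sum.
apply/funext => x; rewrite add0r; congr (_ + _).
have -> : \sum_(i < n) pder k (fun x => \sum_(j < n)
    A i j * ((x ord0 i - a ord0 i) * (x ord0 j - a ord0 j))) x =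
  \sum_(i < n) \sum_(j < n) A i j * ((i == k)%:R * (x ord0 j - a ord0 j)) +
  \sum_(i < n) \sum_(j < n) A i j * ((x ord0 i - a ord0 i) * (j == k)%:R).
  rewrite -big_split; apply: eq_bigr => i _ /=.
  rewrite pder_sum// -big_split; apply: eq_bigr => j _ /=.
  rewrite pderZ; last by apply: is_polyM.
  by rewrite pderM// !pder_centred -mulrDr.
have -> : \sum_(i < n) \sum_(j < n) A i j * ((x ord0 i - a ord0 i) * (j == k)%:R) =
    \sum_(j < n) A k j * (x ord0 j - a ord0 j).
  apply: eq_bigr => i _; rewrite (bigD1 k)//= big1 ?addr0 => [|j /negbTE ->].
    by rewrite eqxx mulr1 As.
  by rewrite !mulr0.
rewrite (bigD1 k)//= [X in _ + X + _]big1 ?addr0 => [|i /negbTE ik]; last first.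
  by apply: big1 => j _; rewrite ik mul0r mulr0.
under eq_bigr do rewrite eqxx mul1r.
by rewrite -mulr2n -[X in _ * X]mulr_natl mulKf.
Qed.

Lemma pder2_quad a c b A k l : symmetric A ->
  pder l (pder k (quad a c b A)) = fun=> A k l.
Proof.
move=> As; rewrite pder_quad// pderD; [|exact: is_poly_cst|exact: is_poly_linear].
by rewrite pder_cst pder_linear; apply/funext => x; rewrite add0r.
Qed.

Lemma lap_quad a c b A : symmetric A -> lap (quad a c b A) = fun=> tr A.
Proof.
move=> As; apply/funext => x; apply: eq_bigr => i _.
by rewrite pder2_quad.
Qed.

Lemma quad_centre a c b A : quad a c b A a = c.
Proof.
rewrite /quad big1 ?addr0 => [|i _]; last by rewrite subrr mulr0.
rewrite big1 ?mulr0 ?addr0// => i _; apply: big1 => j _.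
by rewrite subrr mul0r mulr0.
Qed.

Lemma quadD a c b A c' b' A' x :
  quad a (c + c') (fun i => b i + b' i) (fun i j => A i j + A' i j) x =
  quad a c b A x + quad a c' b' A' x.
Proof.
rewrite /quad.
have -> : \sum_(i < n) (b i + b' i) * (x ord0 i - a ord0 i) =
    \sum_(i < n) b i * (x ord0 i - a ord0 i) + \sum_(i < n) b' i * (x ord0 i - a ord0 i).
  by rewrite -big_split; apply: eq_bigr => i _; rewrite mulrDl.
have -> : \sum_(i < n) \sum_(j < n) (A i j + A' i j) * ((x ord0 i - a ord0 i) * (x ord0 j - a ord0 j)) =
    \sum_(i < n) \sum_(j < n) A i j * ((x ord0 i - a ord0 i) * (x ord0 j - a ord0 j)) +
    \sum_(i < n) \sum_(j < n) A' i j * ((x ord0 i - a ord0 i) * (x ord0 j - a ord0 j)).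
  rewrite -big_split; apply: eq_bigr => i _; rewrite -big_split.
  by apply: eq_bigr => j _; rewrite mulrDl.
by ring.
Qed.

Lemma quadN a c b A x :
  quad a (- c) (fun i => - b i) (fun i j => - A i j) x = - quad a c b A x.
Proof.
apply/eqP; rewrite -addr_eq0 -quadD addNr /quad.
rewrite big1 => [|i _]; last by rewrite addNr mul0r.
rewrite big1 ?mulr0 ?addr0// => i _; apply: big1 => j _.
by rewrite addNr mul0r.
Qed.

Lemma mvt_poly q a (s D : R) : (0 < n)%N -> is_poly q -> q a = 0 ->
  (forall i x, `|x - a| <= s -> `|pder i q x| <= D) ->
  forall x, `|x - a| <= s -> `|q x| <= n%:R * D * s.
Proof.
move=> n0 qp qa qD x xs.
have aa : `|a - a| <= s by rewrite subrr normr0; apply: le_trans xs.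
have D0 : 0 <= D by apply: le_trans (qD (Ordinal n0) _ aa).
have qD' y i : `|y - a| <= s -> `|partial i q y| <= D by rewrite -pderE; exact: qD.
have := mvt_coord (fun y i _ => @derivable_poly R n q y _ qp) qD' aa xs.
rewrite qa subr0 => /le_trans; apply.
apply: (@le_trans _ _ (\sum_(i < n) D * s)).
  apply: ler_sum => i _; rewrite ler_wpM2l//; apply: le_trans xs.
  by have := le_coord_norm (x - a) i; rewrite !mxE.
by rewrite sumr_const card_ord -mulrA mulr_natl.
Qed.

(** Second-order Taylor expansion at the centre: the remainder and its first
two derivatives vanish there, and its third derivatives are those of [h], which
are bounded by three applications of the gradient estimate. *)
Lemma harmonic_taylor h a (rho s M : R) : (0 < n)%N -> 0 < rho -> is_poly h ->
  lap h = (fun=> 0) -> (forall x, enorm (x - a) <= rho -> `|h x| <= M) ->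
  n%:R * s <= rho / 2 ->
  forall x, `|x - a| <= s ->
  `|h x - quad a (h a) (fun i => pder i h a) (fun i j => pder j (pder i h) a) x|
  <= (6 * n%:R * C) ^+ 3 * (s / rho) ^+ 3 * M.
Proof.
move=> n0 rho0 hp h0 hM ns.
set T := quad a _ _ _.
have As : symmetric (fun i j => pder j (pder i h) a).
  by move=> i j; rewrite pderC.
have Tp : is_poly T by exact: is_poly_quad.
have d0 : 0 < rho / 6 by rewrite divr_gt0.
have hi i := is_poly_pder i hp.
have hij i j := is_poly_pder j (hi i).
have li i := lap_pder0 i hp h0.
have lij i j := lap_pder0 j (hi i) (li i).
have [E1 E2 E3] : [/\ 5 * (rho / 6) + rho / 6 = rho, 4 * (rho / 6) + rho / 6 = 5 * (rho / 6) &
    rho / 2 + rho / 6 = 4 * (rho / 6)] by split; field.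
have B1 i x : enorm (x - a) <= 5 * (rho / 6) -> `|pder i h x| <= C / (rho / 6) * M.
  by apply: gradient_bound_ball => //; rewrite E1.
have B2 i j x : enorm (x - a) <= 4 * (rho / 6) ->
    `|pder j (pder i h) x| <= C / (rho / 6) * (C / (rho / 6) * M).
  by apply: gradient_bound_ball => //; rewrite E2; exact: B1.
have B3 i j k x : enorm (x - a) <= rho / 2 ->
    `|pder k (pder j (pder i h)) x| <= C / (rho / 6) * (C / (rho / 6) * (C / (rho / 6) * M)).
  by apply: gradient_bound_ball => //; rewrite E3; exact: B2.
have Es x : `|x - a| <= s -> enorm (x - a) <= rho / 2.
  move=> xs; apply: le_trans (enorm_le_norm _) (le_trans _ ns).
  by rewrite ler_wpM2l.
pose r x := h x - T x; have rp : is_poly r by exact: is_polyB.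
have ri i : pder i r = fun x => pder i h x - pder i T x by rewrite pderB.
have Ti i := is_poly_pder i Tp.
have rij i j : pder j (pder i r) = fun x => pder j (pder i h) x - pder j (pder i h) a.
  rewrite ri pderB//; apply/funext => x; congr (_ - _).
  by rewrite pder2_quad.
have rijk i j k : pder k (pder j (pder i r)) = pder k (pder j (pder i h)).
  rewrite rij pderB//; last exact: is_poly_cst.
  by rewrite pder_cst; apply/funext => x; rewrite subr0.
pose D3 := C / (rho / 6) * (C / (rho / 6) * (C / (rho / 6) * M)).
have R2 i j x : `|x - a| <= s -> `|pder j (pder i r) x| <= n%:R * D3 * s.
  apply: mvt_poly => //; first by apply/is_poly_pder/is_poly_pder.
    by rewrite rij subrr.
  by move=> k y ya; rewrite rijk; apply: B3; exact: Es.
have R1 i x : `|x - a| <= s -> `|pder i r x| <= n%:R * (n%:R * D3 * s) * s.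
  apply: mvt_poly => //; first exact: is_poly_pder.
    rewrite ri pder_quad//= big1 ?addr0 ?subrr// => j _.
    by rewrite subrr mulr0.
  by move=> k y ya; exact: R2.
have R0 x : `|x - a| <= s -> `|r x| <= n%:R * (n%:R * (n%:R * D3 * s) * s) * s.
  apply: mvt_poly => //.
    by rewrite /r /T quad_centre subrr.
move=> x xs; apply: le_trans (R0 x xs) _; rewrite le_eqVlt; apply/orP; left; apply/eqP.
by rewrite /D3; field; rewrite gt_eqF.
Qed.

(** One step of the approximation scheme: replace [p] by the harmonic polynomial
with the same boundary values, and this one by its Taylor polynomial. *)
Lemma poisson_step p a (rho s eta M : R) : (0 < n)%N -> 0 < rho -> 0 <= eta -> is_poly p ->
  (forall x, enorm (x - a) <= rho -> `|p x| <= M) ->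
  (forall x, enorm (x - a) < rho -> `|lap p x| <= eta) ->
  n%:R * s <= rho / 2 ->
  exists c b A, [/\ symmetric A, tr A = 0 & forall x, enorm (x - a) <= s ->
    `|p x - quad a c b A x| <= eta * rho ^+ 2 + (6 * n%:R * C) ^+ 3 * (s / rho) ^+ 3 * M].
Proof.
move=> n0 rho0 eta0 pp pM peta ns.
have [h [hp h0 hb]] := poly_dirichlet a n0 rho0 pp (is_poly_cst 0).
exists (h a), (fun i => pder i h a), (fun i j => pder j (pder i h) a); split.
- by move=> i j; rewrite pderC.
- by rewrite /tr; have /(congr1 (fun u => u a)) := h0.
- move=> x xs.
  have hM y : enorm (y - a) <= rho -> `|h y| <= M.
    apply: (max_principle_abs n0 hp) => z za; first by rewrite h0.
    by rewrite hb// pM// za.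
  have xr : enorm (x - a) <= rho.
    have : s <= n%:R * s.
      by rewrite ler_peMl ?ler1n//; apply: le_trans (enorm_ge0 _) xs.
    lra.
  have ph : `|p x - h x| <= 0 + eta * rho ^+ 2.
    have php : is_poly (fun x => p x - h x) by exact: is_polyB.
    apply: (poisson_bound n0 eta0 php) xr => z za.
      by rewrite lapB// h0 subr0 peta.
    by rewrite hb// subrr normr0.
  have xs' : `|x - a| <= s by apply: le_trans (norm_le_enorm _) xs.
  have := harmonic_taylor n0 rho0 hp h0 hM ns xs'.
  set T := quad _ _ _ _ _ => hT.
  rewrite (_ : p x - T = (p x - h x) + (h x - T)); last by ring.
  by apply: le_trans (ler_normD _ _) _; rewrite add0r in ph; exact: lerD.
Qed.

End Harmonic.

(** * Approximation by quadratic polynomials at all scales *)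
Section Sequences.
Context {R : realType}.
Implicit Types (s : nat -> R) (C mu : R).

Lemma geometric_small C mu e : 0 <= mu < 1 -> 0 < e -> exists j, C * mu ^+ j < e.
Proof.
move=> /andP[mu0 mu1] e0.
have : C * mu ^+ j @[j --> \oo] --> (C * 0 : R).
  apply: cvgM; first exact: cvg_cst.
  by apply: cvg_expr; rewrite ger0_norm.
rewrite mulr0 => /cvgrPdist_lt/(_ _ e0)[j _ /(_ j (leqnn j))].
by rewrite /= sub0r normrN => H; exists j; exact: le_lt_trans (ler_norm _) H.
Qed.

Lemma eq0_geometric C mu (x : R) : 0 <= mu < 1 -> (forall j, `|x| <= C * mu ^+ j) -> x = 0.
Proof.
move=> mu01 xC; apply/eqP; rewrite -normr_eq0; apply: contraT => x0.
have [|j] := @geometric_small C mu `|x| mu01; first by rewrite lt_neqAle eq_sym x0 normr_ge0.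
by rewrite ltNge xC.
Qed.

(** The intervals [s j - 2 C mu^j, s j + 2 C mu^j] are nested. *)
Lemma geometric_limit s C mu : 0 <= C -> 0 <= mu <= 2^-1 ->
  (forall j, `|s j.+1 - s j| <= C * mu ^+ j) ->
  exists l, forall j, `|s j - l| <= 2 * C * mu ^+ j.
Proof.
move=> C0 /andP[mu0 mu1] sC.
pose d j := 2 * C * mu ^+ j.
have dS j : `|s j.+1 - s j| + d j.+1 <= d j.
  have := sC j; rewrite /d exprS.
  have : 0 <= C * mu ^+ j by rewrite mulr_ge0// exprn_ge0.
  move: (mu ^+ j) `|_| => m D; nra.
have d0 j : 0 <= d j by rewrite !mulr_ge0// exprn_ge0.
have nest i j : s i - d i <= s (i + j)%N - d (i + j)%N /\ s (i + j)%N + d (i + j)%N <= s i + d i.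
  elim: j => [|j [IH1 IH2]]; first by rewrite addn0.
  rewrite addnS; have := dS (i + j)%N.
  have := ler_norm (s (i + j).+1 - s (i + j)%N).
  have := ler_norm (- (s (i + j).+1 - s (i + j)%N)); rewrite normrN.
  by move=> *; split; lra.
have cross i j : s i - d i <= s j + d j.
  have [h1 _] := nest i j; have [_ h2] := nest j i.
  rewrite [(j + i)%N]addnC in h2; have := d0 (i + j)%N; lra.
pose S := [set s i - d i | i in [set: nat]].
have Sne : S !=set0 by exists (s 0%N - d 0%N); exists 0%N.
exists (sup S) => j.
have up : sup S <= s j + d j by apply: ge_sup => // _ [i _ <-]; exact: cross.
have lo : s j - d j <= sup S.
  apply: ub_le_sup; last by exists j.
  by exists (s j + d j) => _ [i _ <-]; exact: cross.
by rewrite -/(d j) ler_norml; apply/andP; split; lra.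
Qed.

Lemma geometric_scale (rho lam t : R) : 0 < rho -> 0 < lam < 1 -> 0 < t <= rho ->
  exists j, rho * lam ^+ j.+1 < t <= rho * lam ^+ j.
Proof.
move=> rho0 /andP[l0 l1] /andP[t0 tr].
have ex : exists j, rho * lam ^+ j < t.
  by apply: geometric_small => //; rewrite ltW.
have [j jt jmin] := ex_minnP ex.
case: j jt jmin => [|j] jt jmin.
  by rewrite expr0 mulr1 ltNge tr in jt.
exists j; rewrite jt/= leNgt; apply/negP => /jmin.
by rewrite ltnn.
Qed.

End Sequences.

Section Quadratic.
Context {R : realType} {n : nat}.
Implicit Types (x y a : 'rV[R]_n) (i j k : 'I_n).

Local Notation e_ i := (delta_mx ord0 i : 'rV[R]_n).

Lemma sum_delta (F : 'I_n -> R) i (t : R) :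
  \sum_(k < n) F k * (t *: e_ i) ord0 k = F i * t.
Proof.
rewrite (bigD1 i)//= big1 ?addr0 => [|k /negbTE ki]; first by rewrite !mxE !eqxx mulr1.
by rewrite !mxE ki andbF !mulr0.
Qed.

Definition bilin (A : 'I_n -> 'I_n -> R) x y : R :=
  \sum_(i < n) \sum_(j < n) A i j * (x ord0 i * y ord0 j).

Lemma bilinDl A x x' y : bilin A (x + x') y = bilin A x y + bilin A x' y.
Proof.
rewrite /bilin -big_split; apply: eq_bigr => i _; rewrite -big_split.
by apply: eq_bigr => j _ /=; rewrite mxE mulrDl mulrDr.
Qed.

Lemma bilinC A x y : symmetric A -> bilin A x y = bilin A y x.
Proof.
move=> As; rewrite /bilin exchange_big; apply: eq_bigr => i _.
by apply: eq_bigr => j _; rewrite As [x _ _ * _]mulrC.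
Qed.

Lemma bilinDr A x y y' : symmetric A -> bilin A x (y + y') = bilin A x y + bilin A x y'.
Proof. by move=> As; rewrite ![bilin A x _]bilinC// bilinDl. Qed.

Lemma bilinZl A (t : R) x y : bilin A (t *: x) y = t * bilin A x y.
Proof.
rewrite /bilin mulr_sumr; apply: eq_bigr => i _; rewrite mulr_sumr.
by apply: eq_bigr => j _; rewrite mxE; ring.
Qed.

Lemma bilinZr A (t : R) x y : bilin A x (t *: y) = t * bilin A x y.
Proof.
rewrite /bilin mulr_sumr; apply: eq_bigr => i _; rewrite mulr_sumr.
by apply: eq_bigr => j _; rewrite mxE; ring.
Qed.

Lemma bilin_delta A i j : bilin A (e_ i) (e_ j) = A i j.
Proof.
rewrite /bilin (bigD1 i)//= [X in _ + X]big1 ?addr0 => [|k /negbTE ki]; last first.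
  by apply: big1 => l _; rewrite mxE ki andbF mul0r mulr0.
rewrite (bigD1 j)//= big1 ?addr0 => [|k /negbTE kj]; first by rewrite !mxE !eqxx !mulr1.
by rewrite !mxE kj andbF !mulr0.
Qed.

Lemma quadE a c b A y : quad a c b A (a + y) =
  c + \sum_(i < n) b i * y ord0 i + 2^-1 * bilin A y y.
Proof.
rewrite /quad /bilin; congr (_ + _ + _ * _).
  by apply: eq_bigr => i _; rewrite mxE [a _ _ + _]addrC addrK.
apply: eq_bigr => i _; apply: eq_bigr => j _.
by rewrite !mxE ![a _ _ + _]addrC !addrK.
Qed.

Lemma quad_recentre a a' c b A x : symmetric A -> quad a c b A x =
  quad a' (quad a c b A a') (fun i => b i + \sum_(j < n) A i j * (a' ord0 j - a ord0 j)) A x.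
Proof.
move=> As.
have [d ->] : exists d, a' = a + d by exists (a' - a); rewrite addrC subrK.
have [y ->] : exists y, x = a + d + y by exists (x - (a + d)); rewrite addrC subrK.
rewrite [RHS]quadE -[in LHS](addrA a) !quadE.
rewrite bilinDl !bilinDr// (bilinC y d)//.
have -> : \sum_(i < n) b i * (d + y) ord0 i =
    \sum_(i < n) b i * d ord0 i + \sum_(i < n) b i * y ord0 i.
  by rewrite -big_split; apply: eq_bigr => i _; rewrite mxE mulrDr.
have -> : \sum_(i < n) (b i + \sum_(j < n) A i j * ((a + d) ord0 j - a ord0 j)) * y ord0 i =
    \sum_(i < n) b i * y ord0 i + bilin A d y.
  rewrite (bilinC d y)// /bilin -big_split; apply: eq_bigr => i _ /=.
  rewrite mulrDl mulr_suml; congr (_ + _); apply: eq_bigr => j _.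
  by rewrite !mxE; ring.
by field.
Qed.

(** The coefficients are recovered from the values by centred differences. *)
Lemma quad_coef_bound a c b A (rho M : R) : symmetric A -> 0 < rho ->
  (forall x, enorm (x - a) <= rho -> `|quad a c b A x| <= M) ->
  [/\ `|c| <= M, forall i, rho * `|b i| <= M & forall i j, rho ^+ 2 * `|A i j| <= 8 * M].
Proof.
move=> As rho0 qM.
have qM' y : enorm y <= rho -> `|quad a c b A (a + y)| <= M.
  by move=> yr; apply: qM; rewrite [a + y]addrC addrK.
have cM : `|c| <= M.
  by have := qM a; rewrite subrr enorm0 quad_centre; apply; exact: ltW.
have bN y : bilin A (- y) (- y) = bilin A y y.
  by rewrite -scaleN1r bilinZl bilinZr mulrA mulrNN !mul1r.
have biM y : enorm y <= rho -> `|bilin A y y| <= 4 * M.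
  move=> yr; have yr' : enorm (- y) <= rho by rewrite enormN.
  have := qM' _ yr; have := qM' _ yr'; rewrite !quadE bN.
  have -> : \sum_(i < n) b i * (- y) ord0 i = - \sum_(i < n) b i * y ord0 i.
    by rewrite -sumrN; apply: eq_bigr => i _; rewrite mxE mulrN.
  move: cM; rewrite !ler_norml => /andP[c1 c2] /andP[u1 u2] /andP[t1 t2].
  by apply/andP; split; lra.
have en i : enorm (rho *: e_ i) = rho by rewrite enormZ enorm_delta mulr1 gtr0_norm.
split => // [i|i j].
  have yr : enorm (rho *: e_ i) <= rho by rewrite en.
  have yr' : enorm (- (rho *: e_ i)) <= rho by rewrite enormN.
  have := qM' _ yr; have := qM' _ yr'; rewrite !quadE bN.
  have -> : \sum_(k < n) b k * (- (rho *: e_ i)) ord0 k = - (b i * rho).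
    by rewrite -scaleNr sum_delta mulrN.
  rewrite sum_delta -[X in X * `|b i|](gtr0_norm rho0) -normrM [rho * b i]mulrC.
  rewrite !ler_norml => /andP[u1 u2] /andP[t1 t2].
  by apply/andP; split; lra.
pose y1 := (rho / 2) *: (e_ i + e_ j); pose y2 := (rho / 2) *: (e_ i + (-1) *: e_ j).
have h0 : 0 <= rho / 2 by rewrite divr_ge0// ltW.
have n1 : enorm y1 <= rho.
  rewrite enormZ ger0_norm//; have := enormD (e_ i) (e_ j); rewrite !enorm_delta; nra.
have n2 : enorm y2 <= rho.
  rewrite enormZ ger0_norm//; have := enormD (e_ i) (-1 *: e_ j).
  by rewrite scaleN1r enormN !enorm_delta; nra.
have := biM _ n1; have := biM _ n2.
have E : bilin A y1 y1 - bilin A y2 y2 = rho ^+ 2 * A i j.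
  rewrite /y1 /y2 !bilinZl !bilinZr !bilinDl !bilinDr//.
  by rewrite !bilinZl !bilinZr !bilin_delta (As j i); field.
rewrite -[X in X * `|A i j|](@ger0_norm _ (rho ^+ 2)) ?sqr_ge0// -normrM -E.
rewrite !ler_norml => /andP[u1 u2] /andP[t1 t2].
by apply/andP; split; lra.
Qed.

Lemma quadB a c b A c' b' A' x :
  quad a (c - c') (fun i => b i - b' i) (fun i j => A i j - A' i j) x =
  quad a c b A x - quad a c' b' A' x.
Proof. by rewrite -quadN -quadD. Qed.

Lemma quad_bound a c b A (s B al : R) x : 0 <= s ->
  (forall i, `|b i| <= B) -> (forall i j, `|A i j| <= al) -> enorm (x - a) <= s ->
  `|quad a c b A x| <= `|c| + n%:R * B * s + n%:R ^+ 2 * al * s ^+ 2.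
Proof.
move=> s0 bB Aal xs.
have xi i : `|x ord0 i - a ord0 i| <= s.
  by apply: le_trans xs; have := le_coord_enorm (x - a) i; rewrite !mxE.
apply: le_trans (ler_normD _ _) _; apply: lerD.
  apply: le_trans (ler_normD _ _) _; rewrite lerD2l.
  apply: le_trans (ler_norm_sum _ _ _) _.
  apply: (@le_trans _ _ (\sum_(i < n) B * s)).
    by apply: ler_sum => i _; rewrite normrM ler_pM.
  by rewrite sumr_const card_ord -mulrA mulr_natl.
have S : `|\sum_(i < n) \sum_(j < n) A i j * ((x ord0 i - a ord0 i) * (x ord0 j - a ord0 j))|
    <= n%:R ^+ 2 * al * s ^+ 2.
  apply: le_trans (ler_norm_sum _ _ _) _.
  apply: (@le_trans _ _ (\sum_(i < n) \sum_(j < n) al * s ^+ 2)).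
    apply: ler_sum => i _; apply: le_trans (ler_norm_sum _ _ _) _.
    apply: ler_sum => j _; rewrite !normrM expr2.
    by apply: ler_pM => //; exact: ler_pM.
  rewrite !sumr_const card_ord -mulrnA -[leLHS]mulr_natr natrM.
  by rewrite le_eqVlt; apply/orP; left; apply/eqP; ring.
rewrite normrM ger0_norm ?invr_ge0//; apply: le_trans S.
by rewrite ler_piMl// invf_le1// ler1n.
Qed.

End Quadratic.

(** * Interior regularity for the Poisson equation *)
Lemma exprn_split (R : comPzRingType) (x : R) j :
  (x ^+ 7) ^+ j = x ^+ j * ((x ^+ 3) ^+ j) ^+ 2.
Proof. by rewrite !(exprAC _ _ j) -[in RHS]exprM -exprS. Qed.

(** Second-order expansion of [v] at [a] evaluated at [x]: [b] and [A] play the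
role of the gradient and of the Hessian.  The cubes encode Hoelder exponents
[4/3] and [1/3] without fractional powers. *)
Definition expands_at (R : realType) (n : nat) (v : 'rV[R]_n -> R)
    (b : 'rV[R]_n -> 'I_n -> R) (A : 'rV[R]_n -> 'I_n -> 'I_n -> R) (C D : R) a x :=
  [/\ `|v x - v a - \sum_(i < n) b a i * (x ord0 i - a ord0 i)| <= C * enorm (x - a) ^+ 2,
      forall i, `|b x i - b a i - \sum_(k < n) A a i k * (x ord0 k - a ord0 k)| ^+ 3 <=
        D * enorm (x - a) ^+ 4 &
      forall i k, `|A x i k - A a i k| ^+ 3 <= D * enorm (x - a)].

Section Campanato.
Context {R : realType} {n : nat}.
Implicit Types (x y a : 'rV[R]_n) (i : 'I_n) (j : nat).

Variables (v w : 'rV[R]_n -> R) (r V W L : R).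
Hypothesis n0 : (0 < n)%N.
Hypothesis vV : forall x, enorm x <= r -> `|v x| <= V.
Hypothesis wW : forall x, enorm x <= r -> `|w x| <= W.
Hypothesis L0 : 0 <= L.
Hypothesis wL : forall x y, enorm x <= r -> enorm y <= r ->
  `|w x - w y| ^+ 3 <= L * enorm (x - y).
(** [v] solves the Poisson equation with right-hand side [w] in the sense that it
is a uniform limit of polynomials whose Laplacians converge uniformly to [w]. *)
Hypothesis approx : forall d : R, 0 < d -> exists p, [/\ is_poly p,
  forall x, enorm x <= r -> `|p x - v x| <= d &
  forall x, enorm x <= r -> `|lap p x - w x| <= d].

Variable rho : R.
Hypothesis rho0 : 0 < rho.

Let C0 : R := (6 * n%:R * (2 * n%:R + 12)) ^+ 3.
(* [C0] is the constant of [poisson_step].  The choice of [N] gives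
   [n nu <= 1/2], which keeps the next ball within half of the present one, and
   [C0 nu <= 1/2], by which the Taylor remainder is absorbed. *)
Let N : R := 2 + 2 * n%:R + 2 * C0.
Let nu : R := N^-1.
Let lam := nu ^+ 3.
Let q := nu ^+ 7.

Let C0_ge0 : 0 <= C0.
Proof. by rewrite exprn_ge0// !mulr_ge0// addr_ge0// mulr_ge0. Qed.

Let N_ge2 : 2 <= N.
Proof. by rewrite /N; have := C0_ge0; have : (0 : R) <= n%:R by []; lra. Qed.

Let nu_gt0 : 0 < nu.
Proof. by rewrite invr_gt0; apply: lt_le_trans N_ge2. Qed.

Let nu_le : nu <= 2^-1.
Proof. by rewrite lef_pV2// posrE//; apply: lt_le_trans N_ge2. Qed.

Let nu_N : nu * N = 1.
Proof. by rewrite mulVf// gt_eqF//; apply: lt_le_trans N_ge2. Qed.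

Let n_nu : n%:R * nu <= 2^-1.
Proof.
have := nu_N; rewrite /N; have := mulr_ge0 (ltW nu_gt0) C0_ge0; have := nu_gt0; nra.
Qed.

Let C0_nu : C0 * nu <= 2^-1.
Proof.
have := nu_N; rewrite /N; have : 0 <= nu * n%:R by rewrite mulr_ge0// ltW.
by have := nu_gt0; nra.
Qed.

Let nuX m : 0 < nu ^+ m.
Proof. by rewrite exprn_gt0. Qed.

Let nuX1 m : nu ^+ m <= 1.
Proof. by rewrite exprn_ile1 ?ltW//; have := nu_le; lra. Qed.

Let lam_gt0 : 0 < lam. Proof. exact: nuX. Qed.

Let lam_nu : lam <= nu.
Proof.
rewrite /lam exprS ler_piMr ?(ltW nu_gt0)//; exact: nuX1.
Qed.

Let q_gt0 : 0 < q. Proof. exact: nuX. Qed.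

Let rhoj j := rho * lam ^+ j.

Let rhoj_gt0 j : 0 < rhoj j. Proof. by rewrite mulr_gt0// exprn_gt0. Qed.

Let H : R := 1 + L * rho.

Let H_ge0 : 0 <= H.
Proof. by rewrite /H addr_ge0// mulr_ge0// ltW. Qed.

Let w_scale a x j : enorm a + rho <= r -> enorm (x - a) <= rhoj j ->
  enorm x <= r /\ `|w x - w a| <= H * nu ^+ j.
Proof.
move=> ar xa.
have lj : lam ^+ j <= 1.
  by rewrite exprn_ile1 ?(ltW lam_gt0)//; exact: nuX1.
have xr : enorm x <= r.
  have := enormD (x - a) a; rewrite subrK.
  have : rhoj j <= rho by rewrite /rhoj ler_piMr// ltW.
  by lra.
have aR : enorm a <= r by have := rho0; lra.
split => //.
rewrite -(@ler_pXn2r _ 3)// ?nnegrE ?mulr_ge0 ?(ltW (nuX j))//.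
apply: le_trans (wL xr aR) _.
rewrite exprMn -exprM mulnC exprM -/lam.
apply: (@le_trans _ _ (L * rhoj j)); first by rewrite ler_wpM2l.
rewrite /rhoj mulrA ler_wpM2r ?exprn_ge0 ?(ltW nu_gt0)//.
have h : 0 <= L * rho by rewrite mulr_ge0// ltW.
rewrite /H; move: (L * rho) h => t t0.
have t2 := mulr_ge0 t0 t0; have t3 := mulr_ge0 t2 t0.
by rewrite (_ : (1 + t) ^+ 3 = 1 + 3 * t + 3 * (t * t) + t * t * t); [lra|ring].
Qed.

(* [B q^j] bounds the part of the error created at step [j]; [K] is the fixed point
   of [K |-> (B + q / 2 * (K + 1)) / q], enlarged to cover the initial step. *)
Let B : R := 1 + (1 + H) * rho ^+ 2.
Let K : R := V + W * rho ^+ 2 + 2 * B / q + 1.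

Hypothesis V0 : 0 <= V.
Hypothesis W0 : 0 <= W.

Let B_ge0 : 0 <= B.
Proof. by rewrite /B addr_ge0// mulr_ge0 ?sqr_ge0// addr_ge0. Qed.

Let K_ge0 : 0 <= K.
Proof.
have h1 : 0 <= W * rho ^+ 2 by apply: mulr_ge0 => //; exact: sqr_ge0.
have h2 : 0 <= 2 * B / q by apply: divr_ge0; [exact: mulr_ge0|exact: ltW].
by rewrite /K; do 3!apply: addr_ge0 => //.
Qed.

(** One step of [poisson_step] multiplies the scale by [lam] and the error by
[q = lam^2 nu], because the cubic Taylor remainder gains [lam^3], much less than
[lam^2 nu]. *)
Lemma quad_approx a j : enorm a + rho <= r ->
  exists c b A, [/\ symmetric A, tr A = w a & forall x, enorm (x - a) <= rhoj j ->
    `|v x - quad a c b A x| <= K * q ^+ j].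
Proof.
move=> ar; have aR : enorm a <= r by have := rho0; lra.
elim: j => [|j [c [b [A [As Aw Q]]]]].
  (* The first polynomial only has to have the right Laplacian. *)
  exists 0, (fun=> 0), (fun i k => if i == k then w a / n%:R else 0); split.
  - by move=> i k; rewrite eq_sym; case: eqVneq => // ->.
  - rewrite /tr (eq_bigr (fun=> w a / n%:R)) => [|i _]; last by rewrite eqxx.
    by rewrite sumr_const card_ord -mulr_natl; field; rewrite pnatr_eq0 -lt0n.
  - move=> x xa; rewrite expr0 mulr1.
    have [xr _] := w_scale ar xa.
    have xa' : enorm (x - a) <= rho by move: xa; rewrite /rhoj expr0 mulr1.
    have -> : quad a 0 (fun=> 0) (fun i k => if i == k then w a / n%:R else 0) x =
        w a / (2 * n%:R) * sqdist a x.
      rewrite /quad big1 => [|i _]; last by rewrite mul0r.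
      rewrite addr0 add0r /sqdist !mulr_sumr; apply: eq_bigr => i _.
      rewrite (bigD1 i)//= eqxx big1 ?addr0 => [|k ki]; last first.
        by rewrite eq_sym (negbTE ki) mul0r.
      by field; rewrite pnatr_eq0 -lt0n.
    apply: le_trans (ler_normB _ _) _.
    have h1 := vV xr; have h2 : `|w a / (2 * n%:R) * sqdist a x| <= W * rho ^+ 2.
      rewrite sqdistE normrM [X in _ * X]ger0_norm ?sqr_ge0//.
      apply: ler_pM => //; first exact: sqr_ge0; last first.
        by rewrite lerXn2r ?nnegrE ?enorm_ge0// ltW.
      apply: le_trans (wW aR); rewrite normrM ler_piMr// normfV ger0_norm ?mulr_ge0//.
      have : (1 : R) <= n%:R by rewrite ler1n.
      by move=> n1; rewrite invf_le1; lra.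
    have : 0 <= 2 * B / q by rewrite divr_ge0 ?mulr_ge0// ltW.
    by rewrite /K; lra.
pose d := q ^+ j; have d0 : 0 < d by rewrite exprn_gt0.
have [pk [pkp pkv pkw]] := approx d0.
pose p x := pk x - quad a c b A x.
have pp : is_poly p by apply: is_polyB => //; exact: is_poly_quad.
have pM x : enorm (x - a) <= rhoj j -> `|p x| <= (K + 1) * d.
  move=> xa; have [xr _] := w_scale ar xa.
  rewrite /p (_ : _ - _ = (pk x - v x) + (v x - quad a c b A x)); last by ring.
  apply: le_trans (ler_normD _ _) _.
  by have := pkv x xr; have := Q x xa; rewrite -/d; lra.
have nuj := ltW (nuX j).
have peta x : enorm (x - a) < rhoj j -> `|lap p x| <= (1 + H) * nu ^+ j.
  move=> /ltW xa; have [xr wxa] := w_scale ar xa.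
  rewrite lapB//; last exact: is_poly_quad.
  rewrite lap_quad// Aw.
  rewrite (_ : _ - _ = (lap pk x - w x) + (w x - w a)); last by ring.
  apply: le_trans (ler_normD _ _) _; rewrite mulrDl mul1r; apply: lerD => //.
  apply: le_trans (pkw x xr) _; rewrite /d /q -exprM mulnC exprM.
  by rewrite exprS ler_piMr// exprn_ile1.
have H1 : 0 <= (1 + H) * nu ^+ j by rewrite mulr_ge0// addr_ge0.
have ns : n%:R * rhoj j.+1 <= rhoj j / 2.
  rewrite /rhoj exprS [rho * (lam * _)]mulrCA mulrA.
  have := rhoj_gt0 j; rewrite /rhoj; have : n%:R * lam <= 2^-1.
    by apply: le_trans n_nu; rewrite ler_wpM2l.
  by nra.
have [c' [b' [A' [As' Aw' Q']]]] := poisson_step n0 (rhoj_gt0 j) H1 pp pM peta ns.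
exists (c + c'), (fun i => b i + b' i), (fun i k => A i k + A' i k); split.
- by move=> i k; rewrite As As'.
- by rewrite /tr big_split/= -/(tr A) -/(tr A') Aw Aw' addr0.
move=> x xa.
have xa' : enorm (x - a) <= rhoj j.
  apply: le_trans xa _; rewrite /rhoj ler_wpM2l ?(ltW rho0)// exprS.
  by rewrite ler_piMl ?exprn_ge0 ?(ltW nu_gt0)//; exact: nuX1.
have [xr _] := w_scale ar xa'.
rewrite quadD (_ : _ - _ = (v x - pk x) + (p x - quad a c' b' A' x)); last by rewrite /p; ring.
apply: le_trans (ler_normD _ _) _.
have h1 : `|v x - pk x| <= d by rewrite distrC pkv.
have h2 := Q' x xa.
have E1 : (1 + H) * nu ^+ j * rhoj j ^+ 2 = (1 + H) * rho ^+ 2 * d.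
  have -> : d = nu ^+ j * (lam ^+ j) ^+ 2.
    by rewrite /d exprn_split.
  by rewrite /rhoj exprMn; ring.
have E2 : rhoj j.+1 / rhoj j = lam.
  rewrite /rhoj exprS; field; rewrite (gt_eqF rho0) andbT expf_neq0//.
  by rewrite gt_eqF.
rewrite E1 E2 -/C0 in h2.
have E3 : C0 * lam ^+ 3 <= q / 2.
  rewrite /lam /q -exprM (_ : 3 * 3 = 2 + 7)%N// exprD mulrA.
  rewrite [leRHS]mulrC ler_wpM2r ?(ltW (nuX _))// expr2 mulrA.
  apply: le_trans C0_nu; rewrite ler_piMr ?mulr_ge0 ?(ltW nu_gt0)//.
  by have := nu_le; lra.
have E4 : C0 * lam ^+ 3 * ((K + 1) * d) <= q / 2 * ((K + 1) * d).
  by apply: ler_wpM2r E3; apply: mulr_ge0; [exact: addr_ge0|exact: ltW].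
have E5 : B + q / 2 * (K + 1) <= K * q.
  have : q * (2 * B / q) = 2 * B by rewrite mulrC divfK// gt_eqF.
  have : 0 <= q * (V + W * rho ^+ 2).
    by rewrite mulr_ge0 ?(ltW q_gt0)// addr_ge0// mulr_ge0// sqr_ge0.
  rewrite /K; lra.
apply: (@le_trans _ _ ((B + q / 2 * (K + 1)) * d)).
  by rewrite /B; lra.
by rewrite exprS mulrA -/d ler_wpM2r// ltW.
Qed.

Let pow_q j : q ^+ j = nu ^+ j * (lam ^+ j) ^+ 2.
Proof. exact: exprn_split. Qed.

Let pow_lam j : lam ^+ j = (nu ^+ j) ^+ 3.
Proof. by rewrite /lam -!exprM mulnC. Qed.

Let lamX j : 0 < lam ^+ j. Proof. by rewrite exprn_gt0. Qed.

Let qX j : 0 < q ^+ j. Proof. by rewrite exprn_gt0. Qed.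

Let q1 : q <= 1. Proof. exact: nuX1. Qed.

Let rl_gt0 : 0 < rho * lam. Proof. exact: mulr_gt0. Qed.

Let rhojS j : rhoj j.+1 = rho * lam * lam ^+ j.
Proof. by rewrite /rhoj exprS mulrA. Qed.

Let K1 : R := K * (2 + 4 * n%:R / lam + 32 * n%:R ^+ 2 / lam ^+ 2).

Let K1_ge0 : 0 <= K1.
Proof.
apply: mulr_ge0 => //; apply: addr_ge0.
  by apply: addr_ge0 => //; apply: divr_ge0; [exact: mulr_ge0|exact: ltW].
by apply: divr_ge0; [apply: mulr_ge0 => //; exact: sqr_ge0|exact: sqr_ge0].
Qed.

(** Successive approximations differ by at most [2 K q^j] on the ball of radius
[rho lam^(j+1)], so their coefficients converge geometrically. *)
Lemma quad_limit a : enorm a + rho <= r ->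
  exists b A, [/\ symmetric A, tr A = w a & forall j x, enorm (x - a) <= rhoj j ->
    `|v x - quad a (v a) b A x| <= K1 * q ^+ j].
Proof.
move=> ar.
have /choice[Q QP] : forall j, exists Q : R * ('I_n -> R) * ('I_n -> 'I_n -> R),
    [/\ symmetric Q.2, tr Q.2 = w a & forall x, enorm (x - a) <= rhoj j ->
    `|v x - quad a Q.1.1 Q.1.2 Q.2 x| <= K * q ^+ j].
  by move=> j; have [c [b [A QA]]] := quad_approx j ar; exists (c, b, A).
have mono j : rhoj j.+1 <= rhoj j.
  by rewrite /rhoj exprS ler_wpM2l ?(ltW rho0)// ler_piMl ?(ltW (lamX j))//; exact: nuX1.
have dQ (j : nat) x : enorm (x - a) <= rhoj j.+1 ->
    `|quad a ((Q j.+1).1.1 - (Q j).1.1) (fun i => (Q j.+1).1.2 i - (Q j).1.2 i)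
      (fun i k => (Q j.+1).2 i k - (Q j).2 i k) x| <= 2 * K * q ^+ j.
  move=> xa; rewrite quadB.
  have [_ _ /(_ _ xa) h1] := QP j.+1.
  have [_ _ /(_ _ (le_trans xa (mono j))) h2] := QP j.
  set X := quad _ _ _ _ _ in h1 *; set Y := quad _ _ _ _ _ in h2 *.
  rewrite (_ : X - Y = (v x - Y) - (v x - X)); last by ring.
  apply: le_trans (ler_normB _ _) _.
  have : K * q ^+ j.+1 <= K * q ^+ j.
    by rewrite ler_wpM2l// exprS ler_piMl// ltW.
  lra.
have coef j : (forall i, rhoj j.+1 * `|(Q j.+1).1.2 i - (Q j).1.2 i| <= 2 * K * q ^+ j) /\
    forall i k, rhoj j.+1 ^+ 2 * `|(Q j.+1).2 i k - (Q j).2 i k| <= 8 * (2 * K * q ^+ j).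
  have sym : symmetric (fun i k => (Q j.+1).2 i k - (Q j).2 i k).
    by move=> i k; have [-> _ _] := QP j.+1; have [-> _ _] := QP j.
  by have [_ ? ?] := quad_coef_bound sym (rhoj_gt0 j.+1) (dQ j).
pose CB := 2 * K / (rho * lam); pose CA := 16 * K / (rho * lam) ^+ 2.
have CB0 : 0 <= CB by apply: divr_ge0; [exact: mulr_ge0|exact: ltW].
have CA0 : 0 <= CA by apply: divr_ge0; [exact: mulr_ge0|exact: sqr_ge0].
have nu4 : 0 <= nu ^+ 4 <= 2^-1.
  rewrite (ltW (nuX 4))/=; apply: le_trans nu_le.
  by rewrite exprS ler_piMr ?(ltW nu_gt0)//; exact: nuX1.
have nu1 : 0 <= nu <= 2^-1 by rewrite nu_le ltW.
have /choice[b bP] : forall i, exists l, forall j, `|(Q j).1.2 i - l| <= 2 * CB * (nu ^+ 4) ^+ j.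
  move=> i; apply: (@geometric_limit _ (fun j => (Q j).1.2 i) CB (nu ^+ 4) CB0 nu4) => j.
  have [/(_ i) h _] := coef j.
  rewrite -(ler_pM2l (rhoj_gt0 j.+1)); apply: le_trans h _.
  rewrite le_eqVlt; apply/orP; left; apply/eqP.
  rewrite rhojS /CB [(nu ^+ 4) ^+ j]exprAC pow_q pow_lam; field.
  by rewrite (gt_eqF rho0) (gt_eqF lam_gt0).
have /choice[A AP] : forall ik : 'I_n * 'I_n, exists l, forall j, `|(Q j).2 ik.1 ik.2 - l| <= 2 * CA * nu ^+ j.
  move=> ik; apply: (@geometric_limit _ (fun j => (Q j).2 ik.1 ik.2) CA nu CA0 nu1) => j.
  have [_ /(_ ik.1 ik.2) h] := coef j.
  have r2 : 0 < rhoj j.+1 ^+ 2 by rewrite exprn_gt0.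
  rewrite -(ler_pM2l r2); apply: le_trans h _.
  rewrite le_eqVlt; apply/orP; left; apply/eqP.
  rewrite rhojS /CA pow_q; field.
  by rewrite (gt_eqF rho0) (gt_eqF lam_gt0).
have nu01 : 0 <= nu < 1 by move: nu1 => /andP[-> h]/=; lra.
exists b, (fun i k => A (i, k)); split.
- move=> i k; apply/eqP; rewrite -subr_eq0; apply/eqP.
  apply: (@eq0_geometric _ (4 * CA) nu) => // j.
  have h1 := AP (i, k) j; have h2 := AP (k, i) j; have [s _ _] := QP j.
  rewrite /= s in h1; move: h1 h2 => /=.
  rewrite !ler_norml => /andP[? ?] /andP[? ?]; apply/andP; split; lra.
- apply/eqP; rewrite -subr_eq0; apply/eqP.
  apply: (@eq0_geometric _ (n%:R * (2 * CA)) nu) => // j.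
  have [_ <- _] := QP j; rewrite /tr -sumrB; apply: le_trans (ler_norm_sum _ _ _) _.
  apply: (@le_trans _ _ (\sum_(i < n) 2 * CA * nu ^+ j)).
    by apply: ler_sum => i _; rewrite distrC; exact: (AP (i, i) j).
  by rewrite sumr_const card_ord -[leRHS]mulrA [leRHS]mulr_natl.
move=> j x xa; have [_ _ Qj] := QP j.
have cj : `|(Q j).1.1 - v a| <= K * q ^+ j.
  have := Qj a; rewrite subrr enorm0 quad_centre distrC; apply; exact: ltW.
set c := (Q j).1.1 in Qj cj *; set bj := (Q j).1.2 in Qj *; set Aj := (Q j).2 in Qj *.
have D := @quad_bound _ _ a (c - v a) (fun i => bj i - b i) (fun i k => Aj i k - A (i, k))
  (rhoj j) (2 * CB * (nu ^+ 4) ^+ j) (2 * CA * nu ^+ j) x (ltW (rhoj_gt0 j))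
  (fun i => bP i j) (fun i k => AP (i, k) j) xa.
rewrite quadB in D; have h := Qj x xa.
rewrite (_ : v x - _ = (v x - quad a c bj Aj x) +
  (quad a c bj Aj x - quad a (v a) b (fun i k => A (i, k)) x)); last by ring.
apply: le_trans (ler_normD _ _) _.
have E1 : n%:R * (2 * CB * (nu ^+ 4) ^+ j) * rhoj j = K * (4 * n%:R / lam) * q ^+ j.
  rewrite /CB /rhoj [(nu ^+ 4) ^+ j]exprAC pow_q pow_lam; field.
  by rewrite (gt_eqF rho0) (gt_eqF lam_gt0).
have E2 : n%:R ^+ 2 * (2 * CA * nu ^+ j) * rhoj j ^+ 2 =
    K * (32 * n%:R ^+ 2 / lam ^+ 2) * q ^+ j.
  rewrite /CA /rhoj pow_q; field.
  by rewrite (gt_eqF rho0) (gt_eqF lam_gt0).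
rewrite E1 E2 in D.
have -> : K1 * q ^+ j = K * q ^+ j + (K * q ^+ j + K * (4 * n%:R / lam) * q ^+ j +
    K * (32 * n%:R ^+ 2 / lam ^+ 2) * q ^+ j) by rewrite /K1; ring.
apply: lerD => //; apply: le_trans D _.
by rewrite !lerD2r.
Qed.

Let K2 : R := (16 * K1 / (rho * lam) ^+ 2) ^+ 3 / (rho * lam ^+ 2) +
  (2 * K1 / (rho * lam)) ^+ 3 / (rho * lam ^+ 2) ^+ 4.

(** The quadratic polynomials attached to two points at distance about
[rho lam^j] are close on a ball of that radius, hence so are their coefficients;
cubing turns the factor [nu^j] into the distance itself. *)
Lemma taylor_expansions : exists s0 D b A, [/\ 0 < s0, 0 <= D &
  forall a, enorm a + rho <= r ->
  tr (A a) = w a /\ exists C, forall x, enorm x + rho <= r ->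
    enorm (x - a) <= s0 -> expands_at v b A C D a x].
Proof.
have /choice[bA bAP] : forall a, exists bA : ('I_n -> R) * ('I_n -> 'I_n -> R),
    enorm a + rho <= r -> [/\ symmetric bA.2, tr bA.2 = w a &
    forall j x, enorm (x - a) <= rhoj j ->
    `|v x - quad a (v a) bA.1 bA.2 x| <= K1 * q ^+ j].
  move=> a; have [ar|ar] := pselect (enorm a + rho <= r).
    by have [b [A ?]] := quad_limit ar; exists (b, A).
  by exists (fun=> 0, fun=> fun=> 0).
have k1 : 0 <= (16 * K1 / (rho * lam) ^+ 2) ^+ 3.
  by apply: exprn_ge0; apply: divr_ge0; [exact: mulr_ge0|exact: sqr_ge0].
have k2 : 0 <= (2 * K1 / (rho * lam)) ^+ 3.
  by apply: exprn_ge0; apply: divr_ge0; [exact: mulr_ge0|exact: ltW].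
have rl2 : 0 < rho * lam ^+ 2 by rewrite mulr_gt0.
exists (rho * lam), K2, (fun a => (bA a).1), (fun a => (bA a).2); split => //.
  by apply: addr_ge0; apply: divr_ge0 => //; [exact: ltW|exact/exprn_ge0/ltW].
move=> a ar; have [As Aw Qa] := bAP a ar; split => //.
pose al := \sum_(i < n) \sum_(k < n) `|(bA a).2 i k|.
have Aal i k : `|(bA a).2 i k| <= al.
  rewrite /al (bigD1 i)//= (bigD1 k)//= -addrA lerDl addr_ge0//.
    exact: sumr_ge0.
  by apply: sumr_ge0 => m _; exact: sumr_ge0.
exists (K1 / (rho * lam ^+ 2) ^+ 2 + n%:R ^+ 2 * al) => x xr xa.
have [/enorm_eq0/eqP|x0] := eqVneq (enorm (x - a)) 0.
  rewrite subr_eq0 => /eqP ->; split => [|i|i k].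
  - rewrite !subrr enorm0 big1 => [|i _]; last by rewrite subrr mulr0.
    by rewrite subr0 normr0 expr0n mulr0.
  - rewrite !subrr enorm0 big1 => [|k _]; last by rewrite subrr mulr0.
    by rewrite subr0 normr0 !expr0n mulr0.
  - by rewrite !subrr enorm0 normr0 expr0n mulr0.
have t0 : 0 < enorm (x - a) by rewrite lt_neqAle eq_sym x0 enorm_ge0.
have [||j /andP[jt tj]] := @geometric_scale _ (rho * lam) lam (enorm (x - a)) rl_gt0.
  by rewrite lam_gt0/=; apply: le_lt_trans lam_nu _; have := nu_le; lra.
  by rewrite t0.
set t := enorm (x - a) in t0 jt tj *.
pose u := t / (rho * lam ^+ 2).
have u0 : 0 <= u by rewrite divr_ge0// ltW.
have lu : lam ^+ j <= u.
  rewrite /u ler_pdivlMr//; apply: ltW; apply: le_lt_trans jt.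
  by rewrite [lam ^+ j.+1]exprS le_eqVlt; apply/orP; left; apply/eqP; ring.
rewrite -rhojS in tj.
have mono : 2 * rhoj j.+1 <= rhoj j.
  rewrite /rhoj exprS; have := rhoj_gt0 j; rewrite /rhoj.
  have := lam_nu; have := nu_le; nra.
have tj' : t <= rhoj j by have := rhoj_gt0 j.+1; lra.
have [Xs _ Qx] := bAP x xr.
have rj := rhoj_gt0 j.+1.
have dQ z : enorm (z - x) <= rhoj j.+1 -> `|quad x
    (v x - quad a (v a) (bA a).1 (bA a).2 x)
    (fun i => (bA x).1 i - ((bA a).1 i + \sum_(k < n) (bA a).2 i k * (x ord0 k - a ord0 k)))
    (fun i k => (bA x).2 i k - (bA a).2 i k) z| <= 2 * K1 * q ^+ j.
  move=> zx; rewrite quadB -quad_recentre//.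
  have za : enorm (z - a) <= rhoj j.
    by apply: le_trans (enorm_triangle x _ _) _; rewrite -/t; lra.
  have h1 := Qx _ _ zx; have h2 := Qa _ _ za.
  set X := quad _ _ _ _ _ in h1 *; set Y := quad _ _ _ _ _ in h2 *.
  rewrite (_ : X - Y = (v z - Y) - (v z - X)); last by ring.
  apply: le_trans (ler_normB _ _) _.
  have : K1 * q ^+ j.+1 <= K1 * q ^+ j.
    by rewrite ler_wpM2l// exprS ler_piMl// ltW.
  lra.
have sym : symmetric (fun i k => (bA x).2 i k - (bA a).2 i k).
  by move=> i k; rewrite Xs As.
have [_ cb cA] := quad_coef_bound sym rj dQ.
split.
- have h := Qa _ _ tj'.
  have b0 i : `|(fun=> 0 : R) i| <= (0 : R) by rewrite normr0.
  have q2 := quad_bound 0 (ltW t0) b0 Aal (lexx t).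
  rewrite normr0 mulr0 mul0r !add0r in q2.
  have -> : v x - v a - \sum_(i < n) (bA a).1 i * (x ord0 i - a ord0 i) =
    (v x - quad a (v a) (bA a).1 (bA a).2 x) + quad a 0 (fun=> 0) (bA a).2 x.
    rewrite /quad [X in 0 + X]big1 => [|i _]; last by rewrite mul0r.
    by ring.
  apply: le_trans (ler_normD _ _) _; rewrite mulrDl; apply: lerD => //.
  apply: le_trans h _; rewrite -mulrA ler_wpM2l//.
  rewrite (_ : _ * t ^+ 2 = u ^+ 2); last by rewrite /u; field; rewrite !gt_eqF.
  rewrite pow_q; apply: (@le_trans _ _ ((lam ^+ j) ^+ 2)).
    by apply: ler_piMl; [exact: sqr_ge0|exact: nuX1].
  by rewrite lerXn2r ?nnegrE ?(ltW (lamX j)).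
- move=> i; have h := cb i; rewrite opprD addrA in h.
  set D := `|_| in h *; have D0 : 0 <= D by exact: normr_ge0.
  have DB : D <= 2 * K1 / (rho * lam) * (nu ^+ j * lam ^+ j).
    rewrite -(ler_pM2l rj); apply: le_trans h _.
    rewrite le_eqVlt; apply/orP; left; apply/eqP.
    rewrite rhojS pow_q; field.
    by rewrite (gt_eqF rho0) (gt_eqF lam_gt0).
  apply: (@le_trans _ _ ((2 * K1 / (rho * lam)) ^+ 3 * u ^+ 4)).
    apply: (@le_trans _ _ ((2 * K1 / (rho * lam)) ^+ 3 * (lam ^+ j) ^+ 4)).
      rewrite (_ : (lam ^+ j) ^+ 4 = (nu ^+ j * lam ^+ j) ^+ 3); last first.
        by rewrite [RHS]exprMn -pow_lam exprS.
      by rewrite -exprMn lerXn2r ?nnegrE ?(le_trans D0 DB).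
    by rewrite ler_wpM2l// lerXn2r ?nnegrE ?(ltW (lamX j)).
  rewrite /K2 [leRHS]mulrDl -[leLHS]add0r; apply: lerD.
    by apply: mulr_ge0; [apply: divr_ge0 => //; exact: ltW|exact/exprn_ge0/ltW].
  rewrite le_eqVlt; apply/orP; left; apply/eqP; rewrite -/t /u; field.
  by rewrite (gt_eqF rho0) (gt_eqF lam_gt0).
- move=> i k; have h := cA i k.
  set D := `|_| in h *; have D0 : 0 <= D by exact: normr_ge0.
  have DB : D <= 16 * K1 / (rho * lam) ^+ 2 * nu ^+ j.
    have r2 : 0 < rhoj j.+1 ^+ 2 by rewrite exprn_gt0.
    rewrite -(ler_pM2l r2); apply: le_trans h _.
    rewrite le_eqVlt; apply/orP; left; apply/eqP.
    rewrite rhojS pow_q; field.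
    by rewrite (gt_eqF rho0) (gt_eqF lam_gt0).
  apply: (@le_trans _ _ ((16 * K1 / (rho * lam) ^+ 2) ^+ 3 * u)).
    apply: (@le_trans _ _ ((16 * K1 / (rho * lam) ^+ 2) ^+ 3 * lam ^+ j)).
      by rewrite pow_lam -exprMn lerXn2r// nnegrE//; exact: le_trans DB.
    by rewrite ler_wpM2l.
  rewrite /K2 [leRHS]mulrDl -[leLHS]addr0; apply: lerD; last first.
    by apply: mulr_ge0; [apply: divr_ge0 => //; exact/exprn_ge0/ltW|exact: ltW].
  rewrite le_eqVlt; apply/orP; left; apply/eqP; rewrite -/t /u; field.
  by rewrite (gt_eqF rho0) (gt_eqF lam_gt0).
Qed.

End Campanato.

Section Regularity.
Context {R : realType} {n : nat}.
Implicit Types (x y a : 'rV[R]_n) (i k : 'I_n) (f v w : 'rV[R]_n -> R).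

Local Notation e_ i := (delta_mx ord0 i : 'rV[R]_n).

Lemma cube_small (C e s x : R) : 0 <= C -> 0 < e -> 0 <= x -> s < e ^+ 3 / (C + 1) ->
  x ^+ 3 <= C * s -> x < e.
Proof.
move=> C0 e0 x0 se xs; have C1 : 0 < C + 1 by lra.
rewrite ltr_pdivlMr// in se.
have e3 : 0 < e ^+ 3 by rewrite exprn_gt0.
have : x ^+ 3 < e ^+ 3.
  apply: le_lt_trans xs _; have [s0|s0] := leP 0 s; first by lra.
  by apply: le_lt_trans e3; rewrite mulr_ge0_le0// ltW.
by rewrite ltr_pXn2r ?nnegrE// ltW.
Qed.

(** Since the cube of the remainder is [O(t^4)], the remainder is [o(t)]. *)
Lemma is_derive_expansion f a i (c C s0 : R) : 0 <= C -> 0 < s0 ->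
  (forall t : R, `|t| <= s0 -> `|f (a + t *: e_ i) - f a - c * t| ^+ 3 <= C * `|t| ^+ 4) ->
  is_derive a (e_ i) f c.
Proof.
move=> C0 s00 fE.
have lim : h^-1 *: ((f \o shift a) (h *: e_ i) - f a) @[h --> 0^'] --> c.
  apply/cvgrPdist_lt => e e0.
  have d0 : 0 < e ^+ 3 / (C + 1) by rewrite divr_gt0 ?exprn_gt0//; lra.
  near=> h; have h0 : h != 0 by near: h; exact: nbhs_dnbhs_neq.
  have hs : `|h| < s0.
    by near: h; apply: dnbhs0_lt.
  have hd : `|h| < e ^+ 3 / (C + 1).
    by near: h; apply: dnbhs0_lt.
  apply: (cube_small C0 e0 (normr_ge0 _) hd).
  have h3 : 0 < `|h| ^+ 3 by rewrite exprn_gt0// normr_gt0.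
  rewrite -(ler_pM2l h3) -exprMn -normrM.
  have -> : h * (c - h^-1 *: ((f \o shift a) (h *: e_ i) - f a)) =
      - (f (a + h *: e_ i) - f a - c * h).
    by rewrite /shift/= [h *: e_ i + a]addrC /GRing.scale/=; field.
  rewrite normrN; apply: le_trans (fE h (ltW hs)) _.
  by rewrite le_eqVlt; apply/orP; left; apply/eqP; ring.
apply: DeriveDef; first by apply/cvg_ex; exists c.
exact: cvg_lim lim.
Unshelve. all: by end_near. Qed.

Lemma continuous_expansion f a (g : 'I_n -> R) (C s0 : R) : 0 <= C -> 0 < s0 ->
  (forall x, enorm (x - a) <= s0 ->
    `|f x - f a - \sum_(k < n) g k * (x ord0 k - a ord0 k)| ^+ 3 <= C * enorm (x - a)) ->
  {for a, continuous f}.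
Proof.
move=> C0 s00 fE; apply/(@cvgrPdist_lt _ _ _ (nbhs a)) => e e0.
have e20 : 0 < e / 2 by rewrite divr_gt0.
have d0 : 0 < (e / 2) ^+ 3 / (C + 1) by rewrite divr_gt0 ?exprn_gt0//; lra.
pose l x : R := \sum_(k < n) g k * (x ord0 k - a ord0 k).
have lc : {for a, continuous l}.
  exact: (continuous_poly (is_poly_linear a g) a).
have la : l a = 0 by rewrite /l big1// => k _; rewrite subrr mulr0.
have near1 : \forall x \near a, `|l x| < e / 2.
  by have := near_dist_lt lc e20; rewrite la; apply: filterS => x; rewrite subr0.
have near2 (d : R) : 0 < d -> \forall x \near a, enorm (x - a) < d.
  by move=> dd; apply: near_ball; rewrite subrr enorm0.
apply: filterS3 near1 (near2 _ s00) (near2 _ d0) => x h1 h2 h3.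
have h4 := cube_small C0 e20 (normr_ge0 _) h3 (fE x (ltW h2)).
rewrite distrC (_ : f x - f a = (f x - f a - l x) + l x); last by ring.
by apply: le_lt_trans (ler_normD _ _) _; rewrite /l in h1 *; lra.
Qed.

Lemma powR_third (t beta : R) : 0 < t <= 1 -> beta <= 3^-1 -> t <= (t `^ beta) ^+ 3.
Proof.
move=> t01 b3; have t0 : 0 <= t by move: t01 => /andP[/ltW].
rewrite -powR_mulrn ?powR_ge0// -powRrM -[leLHS]powRr1//.
apply: ger_powR => //.
by rewrite -[leRHS](_ : 3^-1 * 3%:R = 1) ?ler_wpM2r// mulVf.
Qed.

Section Poisson.
Variables (v w : 'rV[R]_n -> R) (r V W L : R).
Hypothesis n0 : (0 < n)%N.
Hypothesis vV : forall x, enorm x <= r -> `|v x| <= V.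
Hypothesis wW : forall x, enorm x <= r -> `|w x| <= W.
Hypotheses (L0 : 0 <= L) (V0 : 0 <= V) (W0 : 0 <= W).
Hypothesis wL : forall x y, enorm x <= r -> enorm y <= r ->
  `|w x - w y| ^+ 3 <= L * enorm (x - y).
Hypothesis approx : forall d : R, 0 < d -> exists p, [/\ is_poly p,
  forall x, enorm x <= r -> `|p x - v x| <= d &
  forall x, enorm x <= r -> `|lap p x - w x| <= d].

Let hess i k x := partial k (partial i v) x.

Lemma interior_derivatives (rho : R) : 0 < rho -> exists s0 D, [/\ 0 < s0, 0 <= D &
  forall a, enorm a < r - rho ->
  [/\ {for a, continuous v},
      forall i, derivable v a (e_ i) /\ {for a, continuous (partial i v)},
      forall i k, derivable (partial i v) a (e_ k) /\ {for a, continuous (hess i k)},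
      laplacian v a = w a &
      forall x, enorm x < r - rho -> enorm (x - a) <= s0 ->
        forall i k, `|hess i k x - hess i k a| ^+ 3 <= D * enorm (x - a)]].
Proof.
move=> rho0.
have [s0 [D [b [A [s00 D0 E]]]]] := taylor_expansions n0 vV wW L0 wL approx rho0 V0 W0.
pose U := [set a : 'rV[R]_n | enorm a < r - rho].
have UE a : U a -> exists2 d, 0 < d & forall x, enorm (x - a) <= d -> U x.
  move=> Ua; exists ((r - rho - enorm a) / 2); first by rewrite divr_gt0// subr_gt0.
  move=> x xa; rewrite /U/=; have := enormD (x - a) a; rewrite subrK.
  by move: Ua; rewrite /U/=; lra.
have UR a : U a -> enorm a + rho <= r by rewrite /U/=; lra.
have nearU a : U a -> \forall x \near a, U x.
  by move=> Ua; have := @near_ball R n 0 (r - rho) a; rewrite subr0 => /(_ Ua);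
    apply: filterS => x; rewrite subr0.
have E' a : U a -> exists C d, [/\ 0 < d, d <= 1, 0 <= C &
    forall x, enorm (x - a) <= d -> U x /\ expands_at v b A C D a x].
  move=> Ua; have [_ [C HC]] := E a (UR a Ua); have [d d0 dU] := UE a Ua.
  exists `|C|, (Num.min 1 (Num.min d s0)); split => //.
  - by rewrite !lt_min ltr01 d0.
  - by rewrite ge_min lexx.
  move=> x; rewrite !le_min => /and3P[_ xd xs]; have Ux := dU x xd; split => //.
  have [h1 h2 h3] := HC x (UR x Ux) xs; split => //.
  by apply: le_trans h1 _; rewrite ler_wpM2r ?sqr_ge0// ler_norm.
have pert a i (t : R) : enorm (a + t *: e_ i - a) = `|t|.
  by rewrite [a + _]addrC addrK enormZ enorm_delta mulr1.
have lin a (g : 'I_n -> R) i (t : R) :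
    \sum_(k < n) g k * ((a + t *: e_ i) ord0 k - a ord0 k) = g i * t.
  rewrite -(sum_delta g i t); apply: eq_bigr => k _.
  by rewrite mxE [a _ _ + _]addrC addrK.
have d1 a i : U a -> is_derive a (e_ i) v (b a i).
  move=> Ua; have [C [d [d0 dle C0 H]]] := E' a Ua.
  apply: (@is_derive_expansion _ _ _ _ (C ^+ 3) d) => // [|t td]; first exact: exprn_ge0.
  have := H (a + t *: e_ i); rewrite pert => /(_ td)[_ []].
  rewrite pert lin => h _ _.
  apply: (@le_trans _ _ ((C * `|t| ^+ 2) ^+ 3)); first by rewrite lerXn2r ?nnegrE ?mulr_ge0 ?sqr_ge0.
  rewrite exprMn -exprM ler_wpM2l ?exprn_ge0// ler_wiXn2l//.
  exact: le_trans td dle.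
have gradE i a : U a -> partial i v a = b a i.
  by move=> Ua; have [_ <-] := d1 a i Ua.
have d2 a i k : U a -> is_derive a (e_ k) (partial i v) (A a i k).
  move=> Ua; have [C [d [d0 dle C0 H]]] := E' a Ua.
  apply: (@near_eq_is_derive _ _ _ (fun x => b x i)).
    by apply: filterS (nearU a Ua) => x Ux; rewrite gradE.
  apply: (@is_derive_expansion _ _ _ _ D d) => // t td.
  have := H (a + t *: e_ k); rewrite pert => /(_ td)[_ [_ /(_ i) + _]].
  by rewrite pert lin.
have hessE i k a : U a -> hess i k a = A a i k.
  by move=> Ua; have [_ <-] := d2 a i k Ua.
have near_cont f g a : U a -> (forall x, U x -> g x = f x) ->
    {for a, continuous f} -> {for a, continuous g}.
  move=> Ua fg fc; suff h : g x @[x --> a] --> f a by rewrite -(fg a Ua) in h.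
  apply: cvg_trans fc; apply: (@near_eq_cvg _ _ (nbhs a)).
  by apply: (@filterS _ (nbhs a)) (nearU a Ua) => x Ux; rewrite fg.
have c0 a : U a -> {for a, continuous v}.
  move=> Ua; have [C [d [d0 dle C0 H]]] := E' a Ua.
  apply: (@continuous_expansion _ _ (b a) (C ^+ 3) d) => // [|x xa]; first exact: exprn_ge0.
  have [_ [h _ _]] := H x xa.
  apply: (@le_trans _ _ ((C * enorm (x - a) ^+ 2) ^+ 3)).
    by rewrite lerXn2r ?nnegrE ?mulr_ge0 ?enorm_ge0.
  rewrite exprMn -exprM ler_wpM2l ?exprn_ge0//.
  by rewrite -[leRHS]expr1 ler_wiXn2l ?enorm_ge0 ?(le_trans xa dle).
have c1 a i : U a -> {for a, continuous (partial i v)}.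
  move=> Ua; have [C [d [d0 dle C0 H]]] := E' a Ua.
  apply: (near_cont (fun x => b x i)) => // [x Ux|]; first exact: gradE.
  apply: (@continuous_expansion _ _ (A a i) D d) => // x xa.
  have [_ [_ h _]] := H x xa; apply: le_trans (h i) _; rewrite ler_wpM2l//.
  by rewrite -[leRHS]expr1 ler_wiXn2l ?enorm_ge0 ?(le_trans xa dle).
have c2 a i k : U a -> {for a, continuous (hess i k)}.
  move=> Ua; have [C [d [d0 dle C0 H]]] := E' a Ua.
  apply: (near_cont (fun x => A x i k)) => // [x Ux|]; first exact: hessE.
  apply: (@continuous_expansion _ _ (fun=> 0) D d) => // x xa.
  rewrite big1 ?subr0 => [|m _]; last by rewrite mul0r.
  by have [_ [_ _ h]] := H x xa; exact: h.
exists s0, D; split => // a Ua; split.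
- exact: c0.
- by move=> i; split; [have [] := d1 a i Ua|exact: c1].
- by move=> i k; split; [have [] := d2 a i k Ua|exact: c2].
- have [<- _] := E a (UR a Ua); apply: eq_bigr => i _; exact: hessE.
- move=> x Ux xs i k; rewrite !hessE//.
  by have [_ [C HC]] := E a (UR a Ua); have [_ _] := HC x (UR x Ux) xs; exact.
Qed.

Lemma ball_exhaustion a : enorm a < r -> exists2 rho, 0 < rho & enorm a < r - rho.
Proof. by move=> ar; exists ((r - enorm a) / 2); [rewrite divr_gt0// subr_gt0|lra]. Qed.

Theorem poisson_Ck2 : Ck 2 (eball r) v.
Proof.
have P a : eball r a -> [/\ {for a, continuous v},
      forall i, derivable v a (e_ i) /\ {for a, continuous (partial i v)} &
      forall i k, derivable (partial i v) a (e_ k) /\ {for a, continuous (hess i k)}].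
  move=> /ball_exhaustion[rho rho0 ar].
  by have [s0 [D [_ _ /(_ a ar)[]]]] := interior_derivatives rho0.
split => [a /P[]//|i]; split => [a /P[_ /(_ i)[]]//|].
split => [a /P[_ /(_ i)[]]//|k]; split => [a /P[_ _ /(_ i k)[]]//|].
by split => // a /P[_ _ /(_ i k)[]].
Qed.

Theorem poisson_laplacian x : eball r x -> laplacian v x = w x.
Proof.
move=> /ball_exhaustion[rho rho0 xr].
by have [s0 [D [_ _ /(_ x xr)[]]]] := interior_derivatives rho0.
Qed.

(** Nearby points are covered by the local estimate, distant ones by the
boundedness of the second derivatives on a compact set. *)
Theorem poisson_holder beta : 0 < beta -> beta <= 3^-1 ->
  Ck_holder 2 beta (eball r) v.
Proof.
move=> beta0 beta3; split; first exact: poisson_Ck2.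
case=> [//|i [//|k [|//]]] _ K cK KU /=; rewrite -/(hess k i).
have [K0|/set0P[z Kz]] := eqVneq K set0; first by exists 0 => x y; rewrite K0.
have [c Kc cmax] : exists2 c, c \in K & forall t, t \in K -> enorm t <= enorm c.
  apply: compact_EVT_max => //; first by exists z.
  by apply: continuous_subspaceT; exact: enorm_continuous.
rewrite inE in Kc; have [rho rho0 cr] := ball_exhaustion (KU c Kc).
have KR x : K x -> enorm x < r - rho.
  by move=> Kx; apply: le_lt_trans cr; apply: cmax; rewrite inE.
have [s0 [D [s00 D0 H]]] := interior_derivatives rho0.
have [S S0 HS] : exists2 S, 0 < S & forall x, K x -> `|hess k i x| <= S.
  have /ex_strict_bound_gt0[S S0 HS] : bounded_set (hess k i @` K).
    apply/compact_bounded/continuous_compact => //.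
    rewrite continuous_subspace_in => x; rewrite inE => Kx.
    apply: continuous_subspaceT_for => //.
    by have [_ _ /(_ k i)[]] := H x (KR x Kx).
  by exists S => // x Kx; apply/ltW/HS; exists x.
pose s1 := Num.min s0 1; have s10 : 0 < s1 by rewrite lt_min s00 ltr01.
pose T := s1 `^ beta; have T0 : 0 < T by rewrite powR_gt0.
exists ((D + 1) + 2 * S / T) => x y Kx Ky.
have tail0 : 0 <= 2 * S / T.
  by apply: divr_ge0; [apply: mulr_ge0 => //; exact: ltW|exact: ltW].
have [/enorm_eq0/eqP|xy0] := eqVneq (enorm (x - y)) 0.
  rewrite subr_eq0 => /eqP ->; rewrite subrr normr0 mulr_ge0 ?powR_ge0//.
  by rewrite addr_ge0// addr_ge0.
have t0 : 0 < enorm (x - y) by rewrite lt_neqAle eq_sym xy0 enorm_ge0.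
set t := enorm (x - y) in t0 xy0 *.
have p0 := powR_ge0 t beta.
rewrite mulrDl; have [ts|ts] := leP t s1.
  have t1 : t <= 1 by move: ts; rewrite le_min => /andP[].
  have ts0 : t <= s0 by move: ts; rewrite le_min => /andP[].
  apply: (@le_trans _ _ ((D + 1) * t `^ beta)); last by rewrite lerDl; exact: mulr_ge0.
  have [_ _ _ _ /(_ x (KR x Kx) ts0 k i) h] := H y (KR y Ky).
  rewrite -(@ler_pXn2r _ 3)// ?nnegrE ?mulr_ge0 ?addr_ge0//.
  apply: le_trans h _; rewrite -/t exprMn.
  have t01 : 0 < t <= 1 by rewrite t0.
  have tp := powR_third t01 beta3.
  have D3 : D <= (D + 1) ^+ 3.
    rewrite (_ : (D + 1) ^+ 3 = 1 + 3 * D + 3 * (D * D) + D * D * D); last by ring.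
    by have := mulr_ge0 D0 D0; have := mulr_ge0 (mulr_ge0 D0 D0) D0; lra.
  by apply: ler_pM => //; exact: ltW.
have h : `|hess k i x - hess k i y| <= 2 * S.
  apply: le_trans (ler_normB _ _) _; rewrite mulr2n mulrDl mul1r.
  by apply: lerD; exact: HS.
apply: (@le_trans _ _ (2 * S / T * t `^ beta)); last first.
  by rewrite lerDr; apply: mulr_ge0 => //; exact: addr_ge0.
apply: le_trans h _; rewrite mulrAC ler_pdivlMr// ler_pM2l ?mulr_gt0//.
by apply: ge0_ler_powR => //; rewrite ?nnegrE ?ltW.
Qed.

End Poisson.
End Regularity.

(** * Existence for the Poisson equation with continuous data *)
Section PoissonExistence.
Context {R : realType} {n : nat}.
Implicit Types (x y : 'rV[R]_n) (p v w g : 'rV[R]_n -> R).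

(** Approximate both data by polynomials within [2^-k]; by the maximum principle
the polynomial solutions converge uniformly. *)
Theorem poisson_exists w g (r : R) : (0 < n)%N -> 0 < r ->
  {within eclosed_ball r, continuous w} -> {within eclosed_ball r, continuous g} ->
  exists v, [/\ {within eclosed_ball r, continuous v},
    forall x, esphere r x -> v x = g x &
    forall d : R, 0 < d -> exists p, [/\ is_poly p,
      forall x, enorm x <= r -> `|p x - v x| <= d &
      forall x, enorm x <= r -> `|lap p x - w x| <= d]].
Proof.
move=> n0 r0 wc gc.
have e0 (k : nat) : 0 < (2^-1 : R) ^+ k by rewrite exprn_gt0.
have half : 0 <= (2^-1 : R) < 1 by apply/andP; split; lra.
have /choice[p pP] : forall k : nat, exists p, [/\ is_poly p,
    forall x, enorm x = r -> `|p x - g x| <= 2^-1 ^+ k &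
    forall x, enorm x <= r -> `|lap p x - w x| <= 2^-1 ^+ k].
  move=> k; have [wk [wkp wkE]] := weierstrass_ball n0 r0 (e0 k) wc.
  have [gk [gkp gkE]] := weierstrass_ball n0 r0 (e0 k) gc.
  have [v [vp vl vb]] := poly_dirichlet 0 n0 r0 gkp wkp.
  exists v; split => // x xr; last by rewrite vl; exact: wkE.
  by rewrite vb ?subr0//; apply: gkE; rewrite xr.
pose C := 2 * (1 + r ^+ 2).
have C0 : 0 <= C by rewrite mulr_ge0// addr_ge0// sqr_ge0.
have step k x : enorm x <= r -> `|p k.+1 x - p k x| <= C * 2^-1 ^+ k.
  move=> xr; have [pp pb pl] := pP k; have [pp' pb' pl'] := pP k.+1.
  have qp : is_poly (fun x => p k.+1 x - p k x) by exact: is_polyB.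
  have S k' : (2^-1 : R) ^+ k'.+1 <= 2^-1 ^+ k' by rewrite exprS ler_piMl ?(ltW (e0 k'))//; lra.
  have tri (a b c e : R) : `|a - c| <= e -> `|b - c| <= e -> `|a - b| <= 2 * e.
    move=> h1 h2; rewrite (_ : a - b = (a - c) - (b - c)); last by ring.
    by apply: le_trans (ler_normB _ _) _; lra.
  have b1 y : enorm (y - 0) < r -> `|lap (fun x => p k.+1 x - p k x) y| <= 2 * 2^-1 ^+ k.
    rewrite subr0 => /ltW yr; rewrite lapB//; apply: tri (pl y yr).
    exact: le_trans (pl' y yr) (S k).
  have b2 y : enorm (y - 0) = r -> `|p k.+1 y - p k y| <= 2 * 2^-1 ^+ k.
    rewrite subr0 => yr; apply: tri (pb y yr); exact: le_trans (pb' y yr) (S k).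
  have e2 : 0 <= 2 * (2^-1 : R) ^+ k by rewrite mulr_ge0// ltW.
  have := poisson_bound n0 e2 qp b1 b2 (x := x); rewrite subr0 => /(_ xr) h.
  by apply: le_trans h _; rewrite le_eqVlt; apply/orP; left; apply/eqP; rewrite /C; ring.
have /choice[v vP] : forall x, exists l, enorm x <= r ->
    forall k, `|p k x - l| <= 2 * C * 2^-1 ^+ k.
  move=> x; have [xr|xr] := pselect (enorm x <= r); last by exists 0.
  have half' : 0 <= (2^-1 : R) <= 2^-1 by apply/andP; split; lra.
  have [l lP] := geometric_limit (s := fun k => p k x) C0 half' (fun k => step k x xr).
  by exists l.
exists v; split.
- apply/within_continuousP => x xr e ep.
  have ep3 : 0 < e / 3 by rewrite divr_gt0.
  have [k kE] := geometric_small (2 * C) half ep3.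
  have [pp _ _] := pP k.
  have /nearP[d d0 H] := near_dist_lt (continuous_poly pp x) ep3.
  exists d => // y yr yx; have h1 := H y yx; have h2 := vP x xr k; have h3 := vP y yr k.
  rewrite (_ : v y - v x = (p k y - p k x) - (p k y - v y) + (p k x - v x)); last by ring.
  apply: le_lt_trans (ler_normD _ _) _.
  have := ler_normB (p k y - p k x) (p k y - v y); lra.
- move=> x; rewrite /esphere/= => xr; apply/eqP; rewrite -subr_eq0; apply/eqP.
  apply: (@eq0_geometric _ (2 * C + 1) 2^-1) => // k.
  have [_ pb _] := pP k; have xr' : enorm x <= r by rewrite xr.
  rewrite (_ : v x - g x = (p k x - g x) - (p k x - v x)); last by ring.
  apply: le_trans (ler_normB _ _) _.
  by have := pb x xr; have := vP x xr' k; lra.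
- move=> d d0; have [k kE] := geometric_small (2 * C + 1) half d0.
  have kE' : 0 <= 2 * C * 2^-1 ^+ k.
    by apply: mulr_ge0; [exact: mulr_ge0|exact: ltW].
  have := e0 k; exists (p k); have [pp _ pl] := pP k; split => // x xr.
    by apply: le_trans (vP x xr k) _; lra.
  by apply: le_trans (pl x xr) _; lra.
Qed.

End PoissonExistence.

(** * The first-order equation *)
Section SmoothFunctions.
Context {R : realType} {n : nat}.
Implicit Types (x y : 'rV[R]_n) (i : 'I_n) (u v phi q : 'rV[R]_n -> R).

Local Notation e_ i := (delta_mx ord0 i : 'rV[R]_n).

Lemma partial_near i u v x : (\forall y \near x, u y = v y) ->
  partial i u x = partial i v x.
Proof. by move=> uv; exact: near_eq_derive. Qed.

Lemma Ck_ext k (U : set 'rV[R]_n) u v : open U -> (forall x, U x -> u x = v x) ->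
  Ck k U u -> Ck k U v.
Proof.
move=> oU; elim: k u v => [|k IH] u v uv.
all: have near_uv x : U x -> \forall y \near x, u y = v y
  by move=> Ux; apply: filterS (open_nbhs_nbhs (conj oU Ux)) => y; exact: uv.
all: have cont : (forall x, U x -> {for x, continuous u}) -> forall x, U x -> {for x, continuous v}
  by move=> uc x Ux; have h := uc x Ux; suff : v y @[y --> x] --> u x;
    [rewrite (uv x Ux)|apply: cvg_trans h; apply: (@near_eq_cvg _ _ (nbhs x));
     apply: (@filterS _ (nbhs x)) (near_uv x Ux) => y ->].
  by move=> [uc _]; split => //; exact: cont.
move=> [uc ud]; split => [|i]; first exact: cont.
have [udi uk] := ud i; split => [x Ux|].
  apply: near_eq_derivable (udi x Ux); exact: near_uv.
by apply: IH uk => x Ux; apply: partial_near; exact: near_uv.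
Qed.

Lemma Ck_addpoly k (U : set 'rV[R]_n) u q : open U -> is_poly q -> Ck k U u ->
  Ck k U (fun x => u x + q x).
Proof.
move=> oU; elim: k u q => [|k IH] u q qp.
all: have cont : (forall x, U x -> {for x, continuous u}) ->
    forall x, U x -> {for x, continuous (fun x => u x + q x)}
  by move=> uc x Ux; apply: (@cvgD _ _ _ (nbhs x));
    [exact: uc|exact: (continuous_poly qp x)].
  by move=> [uc _]; split => //; exact: cont.
move=> [uc ud]; split => [|i]; first exact: cont.
have [udi uk] := ud i; split => [x Ux|].
  by apply: derivableD; [exact: udi|exact: derivable_poly].
apply: Ck_ext (IH _ _ (is_poly_pder i qp) uk) => // x Ux.
rewrite pderE /partial -deriveD//; [exact: udi|exact: derivable_poly].
Qed.

Lemma partial_addpoly u q x i : derivable u x (e_ i) -> is_poly q ->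
  partial i (fun x => u x + q x) x = partial i u x + partial i q x.
Proof. by move=> ud qp; rewrite /partial -deriveD//; exact: derivable_poly. Qed.

Lemma smooth_derivable (U : set 'rV[R]_n) u x i : smooth_on U u -> U x ->
  derivable u x (e_ i).
Proof. by move=> /(_ 1%N)[_ /(_ i)[ud _]]; exact: ud. Qed.

Lemma smooth_continuous (U : set 'rV[R]_n) u x : smooth_on U u -> U x ->
  {for x, continuous u}.
Proof. by move=> /(_ 0%N)[uc _]; exact: uc. Qed.

Lemma smooth_partial_continuous (U : set 'rV[R]_n) u x i : smooth_on U u -> U x ->
  {for x, continuous (partial i u)}.
Proof. by move=> /(_ 1%N)[_ /(_ i)[_ [uc _]]]; exact: uc. Qed.

Lemma gradient_touch (U : set 'rV[R]_n) u v x : open U -> smooth_on U u -> smooth_on U v ->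
  U x -> (\forall y \near x, u y - v y <= u x - v x) -> gradient u x = gradient v x.
Proof.
move=> oU us vs Ux uv; apply/rowP => i; rewrite !mxE.
have d y : U y -> derivable u y (e_ i) /\ derivable v y (e_ i).
  by move=> Uy; split; [exact: smooth_derivable us Uy|exact: smooth_derivable vs Uy].
have [du dv] := d x Ux.
apply/eqP; rewrite -subr_eq0; apply/eqP; rewrite /partial -deriveB//.
apply: (@partial_locmax _ _ (u - v)) => //.
apply: filterS (open_nbhs_nbhs (conj oU Ux)) => y /d[? ?]; exact: derivableB.
Qed.

Lemma joint_nearP (H : 'rV[R]_n * R -> R) x (s : R) : {for (x, s), continuous H} ->
  0 < H (x, s) -> exists2 d : R, 0 < d &
    forall y t, `|y - x| < d -> `|t - s| < d -> 0 < H (y, t).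
Proof.
move=> Hc H0; have /nbhs_ballP[d /= d0 dH] := near_gt Hc H0.
exists d => // y t yx ts; apply: (dH (y, t)).
by split => /=; rewrite -ball_normE/= distrC.
Qed.

(** A Lipschitz bound for a cube is a Hoelder bound of exponent [1/3]. *)
Lemma cube_dist (a b : R) : 0 <= a -> 0 <= b -> `|a - b| ^+ 3 <= `|a ^+ 3 - b ^+ 3|.
Proof.
wlog ab : a b / b <= a => [th|] a0 b0.
  have [ba|ab] := leP b a; first exact: th.
  by rewrite distrC [leRHS]distrC; apply: th => //; exact: ltW.
have ab3 : b ^+ 3 <= a ^+ 3 by rewrite lerXn2r.
rewrite !ger0_norm ?subr_ge0// -subr_ge0.
rewrite (_ : _ - _ = 3 * (a * b * (a - b))); last by ring.
by rewrite !mulr_ge0// subr_ge0.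
Qed.

Lemma cube_le (a b : R) : a <= b -> a ^+ 3 <= b ^+ 3.
Proof.
move=> ab; rewrite -subr_ge0.
rewrite (_ : _ - _ = (b - a) * ((a + b / 2) ^+ 2 + 3 / 4 * b ^+ 2)); last by field.
apply: mulr_ge0; first by rewrite subr_ge0.
apply: addr_ge0; first exact: sqr_ge0.
by apply: mulr_ge0; [exact: divr_ge0|exact: sqr_ge0].
Qed.

Lemma cubeB_le (W s : R) : 0 <= s <= W -> W ^+ 3 - s ^+ 3 <= 3 * W ^+ 2 * (W - s).
Proof.
move=> /andP[s0 sW]; rewrite -subr_ge0.
rewrite (_ : _ - _ = (W - s) * ((W - s) * (2 * W + s))); last by ring.
have W0 := le_trans s0 sW.
by rewrite !mulr_ge0 ?subr_ge0// addr_ge0// mulr_ge0.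
Qed.

End SmoothFunctions.

Section Perron.
Context {R : realType} {n : nat}.
Variables (eps r F : R) (f : 'rV[R]_n -> R).
Implicit Types (x y : 'rV[R]_n) (i : 'I_n) (u w phi : 'rV[R]_n -> R).
Hypotheses (eps0 : 0 < eps) (r0 : 0 < r).
Hypothesis f0 : forall x, enorm x <= r -> 0 <= f x.
Hypothesis fF : forall x, enorm x <= r -> f x <= F.
Hypothesis fc : forall x, eball r x -> {for x, continuous f}.

Local Notation e_ i := (delta_mx ord0 i : 'rV[R]_n).
Local Notation G := (first_order_op eps f).
Local Notation B := (eball r : set 'rV[R]_n).

(** Where [w >= 0] is differentiable the equation gives
[|D(w^3)|^2 = 9 w^4 |Dw|^2 <= 9 w f <= 9 F^2 / eps], so [L] bounds the
partial derivatives of [w^3]. *)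
Let L : R := 3 * (F + 1) * (1 + eps^-1).

Let F0 : 0 <= F.
Proof.
have h : enorm (0 : 'rV[R]_n) <= r by rewrite enorm0 ltW.
exact: le_trans (f0 h) (fF h).
Qed.

Let epsV : 0 < eps^-1. Proof. by rewrite invr_gt0. Qed.

Let L0 : 0 < L.
Proof. by rewrite /L !mulr_gt0// ltr_wpDl//; exact: ltW. Qed.

(** The bounds force the boundary values; the Lipschitz bound is kept in the class
so that the supremum is continuous. *)
Record perron_class w : Prop := PerronClass {
  perron_bounds : forall x, enorm x <= r -> 0 <= w x <= f x / eps;
  perron_lipschitz : forall x y, enorm x <= r -> enorm y <= r ->
    w x ^+ 3 - w y ^+ 3 <= L * l1norm (x - y);
  perron_subsolution : viscosity_subsolution G B w }.

Lemma perron_zero : perron_class (fun=> 0).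
Proof.
split => [x xr|x y xr yr|phi x _ /eballS xr _].
- by rewrite lexx divr_ge0 ?f0// ltW.
- by rewrite subrr mulr_ge0 ?l1norm_ge0// ltW.
- by rewrite /first_order_op mulr0 expr0n mul0r !add0r oppr_le0 f0.
Qed.

Definition perron_sup x : R := sup [set w x | w in perron_class].

Local Notation W := perron_sup.

Let perron_ub x : enorm x <= r -> ubound [set w x | w in perron_class] (f x / eps).
Proof. by move=> xr _ [w ww <-]; have /andP[] := perron_bounds ww xr. Qed.

Lemma perron_sup_ge w x : perron_class w -> enorm x <= r -> w x <= W x.
Proof.
move=> ww xr; apply: ub_le_sup; last by exists w.
by exists (f x / eps); exact: perron_ub.
Qed.

Lemma perron_sup_adherent x (d : R) : enorm x <= r -> 0 < d ->
  exists2 w, perron_class w & W x - d < w x.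
Proof.
move=> xr d0; have [_ [w ww <-] h] : exists2 e, [set w x | w in perron_class] e & W x - d < e.
  apply: sup_adherent => //; split; first by exists 0, (fun=> 0) => //; exact: perron_zero.
  by exists (f x / eps); exact: perron_ub.
by exists w.
Qed.

Lemma perron_sup_bounds x : enorm x <= r -> 0 <= W x <= f x / eps.
Proof.
move=> xr; rewrite (perron_sup_ge perron_zero xr)/=.
apply: ge_sup; last exact: perron_ub.
by exists 0, (fun=> 0) => //; exact: perron_zero.
Qed.

Lemma perron_sup_lipschitz x y : enorm x <= r -> enorm y <= r ->
  W x ^+ 3 - W y ^+ 3 <= L * l1norm (x - y).
Proof.
move=> xr yr; rewrite leNgt; apply/negP => H.
have /andP[Wx0 _] := perron_sup_bounds xr; have /andP[Wy0 _] := perron_sup_bounds yr.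
pose K := W y ^+ 3 + L * l1norm (x - y); have KW : 0 < W x ^+ 3 - K by rewrite /K; lra.
have c0 : 0 < 3 * W x ^+ 2 + 1 by rewrite ltr_wpDl// mulr_ge0// sqr_ge0.
have [w ww wx] := perron_sup_adherent xr (divr_gt0 KW c0).
have /andP[w0 _] := perron_bounds ww xr; have /andP[wy0 _] := perron_bounds ww yr.
have wW := perron_sup_ge ww xr.
have h1 : W x ^+ 3 - w x ^+ 3 <= 3 * W x ^+ 2 * (W x - w x).
  by apply: cubeB_le; rewrite w0.
have h2 := perron_lipschitz ww xr yr.
have h3 : w y ^+ 3 <= W y ^+ 3 by rewrite lerXn2r// perron_sup_ge.
have h4 : (W x - w x) * (3 * W x ^+ 2 + 1) < W x ^+ 3 - K.
  by rewrite -ltr_pdivlMr//; lra.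
have : W x - w x >= 0 by rewrite subr_ge0.
by rewrite /K in KW h4 *; nra.
Qed.

Lemma lipschitz_cube_continuous w : (forall x, enorm x <= r -> 0 <= w x) ->
  (forall x y, enorm x <= r -> enorm y <= r -> w x ^+ 3 - w y ^+ 3 <= L * l1norm (x - y)) ->
  {within eclosed_ball r, continuous w}.
Proof.
move=> w0 wL; apply/within_continuousP => x xr e e0.
have c0 : 0 < L * n%:R + 1 by rewrite ltr_wpDl// mulr_ge0// ltW.
exists (e ^+ 3 / (L * n%:R + 1)); first by rewrite divr_gt0// exprn_gt0.
move=> y yr; rewrite ltr_pdivlMr// => yx.
have h : `|w y - w x| ^+ 3 < e ^+ 3.
  apply: le_lt_trans (cube_dist (w0 _ yr) (w0 _ xr)) _.
  apply: (@le_lt_trans _ _ (L * l1norm (y - x))).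
    rewrite ler_norml lerNl opprB [X in _ && X]wL// andbT.
    by rewrite l1normB wL.
  apply: le_lt_trans yx; have h := l1norm_le_norm (y - x).
  have : L * l1norm (y - x) <= L * (n%:R * `|y - x|) by rewrite ler_wpM2l// ltW.
  have := normr_ge0 (y - x); lra.
by rewrite ltr_pXn2r ?nnegrE// ltW in h.
Qed.

Lemma perron_continuous w : perron_class w -> {within eclosed_ball r, continuous w}.
Proof.
move=> ww; apply: lipschitz_cube_continuous; last exact: perron_lipschitz.
by move=> x /(perron_bounds ww)/andP[].
Qed.

Lemma perron_sup_continuous : {within eclosed_ball r, continuous W}.
Proof.
apply: lipschitz_cube_continuous; last exact: perron_sup_lipschitz.
by move=> x /perron_sup_bounds/andP[].
Qed.

Let cont_fst u x (s : R) : {for x, continuous u} ->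
  {for (x, s), continuous (fun z : 'rV[R]_n * R => u z.1)}.
Proof.
move=> uc; apply: (@continuous_comp _ _ _ fst u (x, s)); [exact: cvg_fst|exact: uc].
Qed.

Let cont_pow x (s : R) k :
  {for (x, s), continuous (fun z : 'rV[R]_n * R => z.2 ^+ k)}.
Proof.
apply: (@continuous_comp _ _ _ snd (fun t : R => t ^+ k) (x, s)); first exact: cvg_snd.
exact: exprn_continuous.
Qed.

Let sqgrad phi y : R := \sum_(i < n) partial i phi y ^+ 2.

Let sqgradE phi y : enorm (gradient phi y) ^+ 2 = sqgrad phi y.
Proof. by rewrite sqr_enorm; apply: eq_bigr => i _; rewrite mxE. Qed.

Let cont_sqgrad phi x : smooth_on B phi -> B x -> {for x, continuous (sqgrad phi)}.
Proof.
move=> ps Bx; apply: (@cvg_sumr R n _ (nbhs x) _ (fun i y => partial i phi y ^+ 2)) => i.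
apply: (@continuous_comp _ _ _ (partial i phi) (fun t : R => t ^+ 2) x).
  exact: smooth_partial_continuous ps Bx.
exact: exprn_continuous.
Qed.

(** The operator as a continuous function of the point and of the value, the
gradient being that of a fixed test function; [a], [c], [c'] and [k] cover the
variants in which some terms are dropped or have the opposite sign. *)
Let cont_op phi x (s a c c' : R) k : smooth_on B phi -> B x ->
  {for (x, s), continuous (fun z : 'rV[R]_n * R =>
    a * z.2 + c * (z.2 ^+ k * sqgrad phi z.1) + c' * f z.1)}.
Proof.
move=> ps Bx.
apply: (@cvgD _ _ _ (nbhs (x, s))); first apply: (@cvgD _ _ _ (nbhs (x, s))).
- apply: (@cvgM _ _ (nbhs (x, s))); [exact: cvg_cst|exact: cvg_snd].
- apply: (@cvgM _ _ (nbhs (x, s))); first exact: cvg_cst.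
  apply: (@cvgM _ _ (nbhs (x, s))); first exact: cont_pow.
  by apply: cont_fst; exact: cont_sqgrad.
- apply: (@cvgM _ _ (nbhs (x, s))); first exact: cvg_cst.
  by apply: cont_fst; exact: fc.
Qed.

(** Adding the squared distance to [x0] to the test function makes the maximum of
[W - phi] at [x0] strict, so a member [w] of the class with [w x0] close to
[W x0] is touched by it at some [x1] near [x0], with [w x1] close to [W x0]; the
inequality for [w] at [x1] contradicts the opposite strict inequality, which
persists near [x0] by continuity. *)
Lemma perron_sup_subsolution : viscosity_subsolution G B W.
Proof.
move=> phi x0 ps Bx0 nearW; rewrite leNgt; apply/negP => G0.
have oB : open B := @open_eball R n r.
pose phi2 y := phi y + sqdist x0 y.
have ps2 : smooth_on B phi2.
  by move=> k; apply: Ck_addpoly (ps k) => //; exact: is_poly_sqdist.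
have grad0 : sqgrad phi2 x0 = sqgrad phi x0.
  apply: eq_bigr => i _; congr (_ ^+ 2); rewrite partial_addpoly; last exact: is_poly_sqdist.
    by rewrite -(pderE i (sqdist x0)) pder_sqdist subrr mulr0 addr0.
  exact: smooth_derivable ps Bx0.
have := @cont_op phi2 x0 (W x0) eps 1 (-1) 3%N ps2 Bx0.
move=> /joint_nearP/=; rewrite grad0 -sqgradE mul1r mulN1r => /(_ G0)[d d0 Hd].
have d20 : 0 < d / 2 by rewrite divr_gt0.
have pc : {for x0, continuous phi} := smooth_continuous ps Bx0.
have near_phi : \forall y \near x0, `|phi y - phi x0| < d / 2.
  exact: near_dist_lt.
have [e e0 He] : exists2 e, 0 < e & forall y, `|y - x0| < e ->
    [/\ W y - phi y <= W x0 - phi x0, `|phi y - phi x0| < d / 2 & B y].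
  by apply/nearP; apply: filterS3 nearW near_phi (open_nbhs_nbhs (conj oB Bx0)).
pose t := Num.min d e / 2.
have de0 : 0 < Num.min d e by rewrite lt_min d0.
have t0 : 0 < t by rewrite divr_gt0.
have td : t < d by have : Num.min d e <= d by [rewrite ge_min lexx]; rewrite /t; lra.
have te : t < e by have : Num.min d e <= e by [rewrite ge_min lexx orbT]; rewrite /t; lra.
pose K := [set y : 'rV[R]_n | enorm (y - x0) <= t].
have Kn y : K y -> `|y - x0| <= t by apply: le_trans; exact: norm_le_enorm.
have KB y : K y -> B y by move=> /Kn yt; have [] := He y (le_lt_trans yt te).
pose del := Num.min (d / 2) (t ^+ 2).
have del0 : 0 < del by rewrite lt_min d20 exprn_gt0.
have deld : del <= d / 2 by rewrite ge_min lexx.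
have delt : del <= t ^+ 2 by rewrite ge_min lexx orbT.
have [w ww wx0] := perron_sup_adherent (eballS Bx0) del0.
have cK : {within K, continuous (fun y => w y - phi2 y)}.
  apply/within_continuousP => y Ky z z0.
  have z20 : 0 < z / 2 by rewrite divr_gt0.
  have [d1 d10 h1] := (within_continuousP _ _).1 (perron_continuous ww) y (eballS (KB y Ky)) _ z20.
  have pc2 : {for y, continuous phi2} := smooth_continuous ps2 (KB y Ky).
  have /nearP[d2 d2p h2] : \forall y' \near y, `|phi2 y' - phi2 y| < z / 2.
    exact: near_dist_lt.
  exists (Num.min d1 d2); first by rewrite lt_min d10.
  move=> y' Ky'; rewrite lt_min => /andP[u1 u2].
  have := h1 y' (eballS (KB _ Ky')) u1; have := h2 y' u2.
  rewrite (_ : w y' - phi2 y' - (w y - phi2 y) = (w y' - w y) - (phi2 y' - phi2 y)); last by ring.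
  move=> *; apply: le_lt_trans (ler_normB _ _) _; lra.
have [|||x1] := @compact_EVT_max _ _ (fun y => w y - phi2 y) K.
- by exists x0; rewrite /K/= subrr enorm0 ltW.
- exact: compact_cball.
- exact: cK.
rewrite inE => Kx1 x1max.
have Bx1 := KB _ Kx1; have x1t := Kn _ Kx1.
have [h1 h2 _] := He x1 (le_lt_trans x1t te).
have h3 : w x0 - phi x0 <= w x1 - (phi x1 + sqdist x0 x1).
  have := x1max x0; rewrite inE /K/= /phi2 subrr enorm0 => /(_ (ltW t0)).
  by rewrite sqdistE subrr enorm0 expr0n addr0.
have h4 := perron_sup_ge ww (eballS Bx1).
have h5 : 0 <= sqdist x0 x1 by rewrite sqdistE sqr_ge0.
have x1in : enorm (x1 - x0) < t.
  rewrite -(@ltr_pXn2r _ 2)// ?nnegrE ?enorm_ge0 ?(ltW t0)//.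
  by rewrite -sqdistE; lra.
have near1 : \forall y \near x1, w y - phi2 y <= w x1 - phi2 x1.
  apply: filterS (near_ball x1in) => y yt.
  by apply: x1max; rewrite inE /K/= ltW.
have := perron_subsolution ww ps2 Bx1 near1.
rewrite /first_order_op sqgradE leNgt => /negP; apply.
have := Hd x1 (w x1) (le_lt_trans x1t td); rewrite /= mul1r mulN1r; apply.
move: h2; rewrite !ltr_norml => /andP[? ?]; apply/andP; split; lra.
Qed.

(** If [psi] satisfies on a cube the inequalities that define the class and lies
below [W] near the boundary of the cube, then the function equal to [max W psi]
in the cube and to [W] elsewhere belongs to the class, hence does not exceed
[W].  The Lipschitz estimate for the maximum is first obtained between two
points of the cube, then along the segment to an exterior point, which crosses
the boundary of the cube where the maximum is [W]. *)
Lemma perron_bump psi x0 (rho : R) : 0 < rho -> smooth_on B psi ->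
  (forall y, `|y - x0| <= rho -> B y) ->
  (forall y, `|y - x0| <= rho -> [/\ G y (psi y) (gradient psi y) <= 0,
    psi y <= f y / eps & forall i, `|3 * psi y ^+ 2 * partial i psi y| <= L]) ->
  (forall y, rho / 2 <= `|y - x0| -> `|y - x0| <= rho -> psi y <= W y) ->
  psi x0 <= W x0.
Proof.
move=> rho0 psis QB Qpsi Qbd.
have oB : open B := @open_eball R n r.
pose m y := if `|y - x0| < rho then Num.max (W y) (psi y) else W y.
have mW y : W y <= m y by rewrite /m; case: ifP => // _; rewrite le_max lexx.
have mpsi y : `|y - x0| <= rho -> psi y <= m y.
  rewrite le_eqVlt /m => /orP[/eqP yr|->]; last by rewrite le_max lexx orbT.
  by rewrite yr ltxx; apply: Qbd; rewrite yr//; lra.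
have mcase y : m y = W y \/ [/\ `|y - x0| < rho, m y = psi y & W y < psi y].
  rewrite /m; case: ifP => [yr|_]; last by left.
  by case: (leP (psi y) (W y)) => h; [left|right].
have dpsi y i : `|y - x0| <= rho -> derivable psi y (e_ i).
  by move=> /QB; exact: smooth_derivable.
have psi3 x y : `|x - x0| <= rho -> `|y - x0| <= rho ->
    psi x ^+ 3 - psi y ^+ 3 <= L * l1norm (x - y).
  move=> xr yr; apply: le_trans (ler_norm _) _.
  have qE z : (psi ^+ 3) z = psi z ^+ 3 by rewrite exprfctE.
  have qd z i : `|z - x0| <= rho -> derivable (psi ^+ 3) z (e_ i).
    by move=> zr; apply: (@derivableX _ _ psi 3); exact: dpsi.
  have qD z i : `|z - x0| <= rho -> `|partial i (psi ^+ 3) z| <= L.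
    move=> zr; have [_ _ /(_ i)] := Qpsi z zr.
    by rewrite {2}/partial (deriveX 3 (dpsi z i zr)).
  have := mvt_coord qd qD yr xr; rewrite !qE -mulr_sumr => /le_trans; apply.
  rewrite ler_wpM2l ?(ltW L0)//; apply: ler_sum => i _.
  by rewrite !mxE.
have closedB y : `|y - x0| <= rho -> enorm y <= r by move=> /QB /ltW.
have lip_in x y : enorm x <= r -> `|x - x0| <= rho -> `|y - x0| <= rho ->
    m x ^+ 3 - m y ^+ 3 <= L * l1norm (x - y).
  move=> xr xc yc; have yr := closedB y yc.
  have [->|[_ -> _]] := mcase x.
    by apply: le_trans (perron_sup_lipschitz xr yr); rewrite lerD2l lerN2 cube_le.
  by apply: le_trans (psi3 x y xc yc); rewrite lerD2l lerN2 cube_le// mpsi.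
have lip_m x y : enorm x <= r -> enorm y <= r -> m x ^+ 3 - m y ^+ 3 <= L * l1norm (x - y).
  move=> xr yr; have [mx|[xc mx Wx]] := mcase x.
    rewrite mx; apply: le_trans (perron_sup_lipschitz xr yr).
    by rewrite lerD2l lerN2 cube_le.
  have [yc|yc] := leP `|y - x0| rho; first by apply: lip_in => //; exact: ltW.
  pose h (t : R) := `|x - x0 + t *: (y - x)|.
  have hc : {within `[0, 1], continuous h}.
    apply: continuous_subspaceT => t.
    apply: (@continuous_comp _ _ _ (fun t : R => x - x0 + t *: (y - x)) Num.norm t).
      apply: (@cvgD _ _ _ (nbhs t)); first exact: cvg_cst.
      by apply: (@cvgZl _ _ _ (nbhs t)); exact: cvg_id.
    exact: norm_continuous.
  have h0 : h 0 = `|x - x0| by rewrite /h scale0r addr0.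
  have h1 : h 1 = `|y - x0|.
    by rewrite /h scale1r; congr `|_|; rewrite addrC addrA subrK.
  have [t] : exists2 t, t \in `[0, 1]%R & h t = rho.
    apply: IVT => //; rewrite h0 h1; apply/andP; split.
      by rewrite ge_min (ltW xc).
    by rewrite le_max (ltW yc) orbT.
  rewrite in_itv/= => /andP[t0 t1] ht.
  pose z := x + t *: (y - x).
  have zc : `|z - x0| = rho by rewrite -ht /h /z addrAC.
  have mz : m z = W z by rewrite /m zc ltxx.
  have my : m y = W y by rewrite /m ltNge (ltW yc).
  have zr : enorm z <= r by apply: closedB; rewrite zc.
  have xz : l1norm (x - z) = t * l1norm (x - y).
    rewrite (_ : x - z = t *: (x - y)) ?l1normZ ?ger0_norm//.
    by rewrite /z opprD addrA subrr add0r -scalerN opprB.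
  have zy : l1norm (z - y) = (1 - t) * l1norm (x - y).
    rewrite (_ : z - y = (1 - t) *: (x - y)) ?l1normZ ?ger0_norm ?subr_ge0//.
    by rewrite scalerBl scale1r -scalerN opprB /z addrAC.
  have := lip_in x z xr (ltW xc); rewrite zc => /(_ (lexx _)).
  have := perron_sup_lipschitz zr yr; rewrite mz my xz zy.
  by lra.
have m_class : perron_class m.
  split=> [x xr|x y xr yr|phi x ps Bx near_m].
  - have /andP[W0 W1] := perron_sup_bounds xr; rewrite (le_trans W0 (mW x))/=.
    have [->//|[xc -> _]] := mcase x; by have [] := Qpsi x (ltW xc).
  - exact: lip_m.
  have [mx|[xc mx Wx]] := mcase x.
    rewrite mx; apply: perron_sup_subsolution => //.
    apply: filterS near_m => y; rewrite mx => h; apply: le_trans h.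
    by rewrite lerD2r.
  have near_c : \forall y \near x, `|y - x0| < rho.
    apply/nearP; exists (rho - `|x - x0|); first by rewrite subr_gt0.
    move=> y yx; rewrite -[y - x0](_ : (y - x) + (x - x0) = _); last by rewrite addrA subrK.
    by apply: le_lt_trans (ler_normD _ _) _; lra.
  have touch : gradient psi x = gradient phi x.
    apply: gradient_touch oB psis ps Bx _.
    apply: filterS2 near_m near_c => y h yc; rewrite -mx; apply: le_trans h.
    by rewrite lerD2r mpsi// ltW.
  by rewrite mx -touch; have [] := Qpsi x (ltW xc).
have cc : `|x0 - x0| <= rho by rewrite subrr normr0 ltW.
apply: le_trans (mpsi _ cc) _.
by apply: perron_sup_ge => //; exact: closedB.
Qed.

(** If the supersolution inequality fails at [x0], normalize the test function to
agree with [W] there, lower it by the squared distance to [x0] and raise it by a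
small constant [dl].  The inequalities required by [perron_bump] hold strictly at
[x0] before raising, hence near [x0] after it, and the conclusion of that lemma
is violated at [x0]. *)
Lemma perron_sup_supersolution : viscosity_supersolution G B W.
Proof.
move=> phi x0 ps Bx0 nearW; rewrite leNgt; apply/negP => G0.
have oB : open B := @open_eball R n r.
have x0r := eballS Bx0; have /andP[W0 Wf] := perron_sup_bounds x0r.
pose q y := - sqdist x0 y.
have qp : is_poly q.
  rewrite (_ : q = fun y => 0 - sqdist x0 y); last by apply/funext => y; rewrite sub0r.
  by apply: is_polyB; [exact: is_poly_cst|exact: is_poly_sqdist].
pose psi0 y := phi y + q y.
have ps0 : smooth_on B psi0 by move=> k; exact: Ck_addpoly.
have pdq i y : partial i q y = - (2 * (y ord0 i - x0 ord0 i)).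
  rewrite -pderE (_ : q = fun y => -1 * sqdist x0 y); last first.
    by apply/funext => z; rewrite mulN1r.
  by rewrite pderZ ?pder_sqdist ?mulN1r//; exact: is_poly_sqdist.
have pd0 i : partial i psi0 x0 = partial i phi x0.
  rewrite partial_addpoly//; last exact: smooth_derivable ps Bx0.
  by rewrite pdq subrr mulr0 oppr0 addr0.
have grad0 : sqgrad psi0 x0 = sqgrad phi x0.
  by apply: eq_bigr => i _; rewrite pd0.
have N0 : 0 <= sqgrad phi x0 by apply: sumr_ge0 => i _; exact: sqr_ge0.
move: G0; rewrite /first_order_op sqgradE => G0.
have W3 : 0 <= W x0 ^+ 3 * sqgrad phi x0 by rewrite mulr_ge0// exprn_ge0.
have eW : 0 <= eps * W x0 by rewrite mulr_ge0// ltW.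
have [d1 d10 H1] : exists2 d, 0 < d & forall y t, `|y - x0| < d -> `|t - W x0| < d ->
    0 < - eps * t + -1 * (t ^+ 3 * sqgrad psi0 y) + 1 * f y.
  apply: (joint_nearP (@cont_op psi0 x0 (W x0) (- eps) (-1) 1 3%N ps0 Bx0)) => /=.
  by rewrite grad0; lra.
have [d2 d20 H2] : exists2 d, 0 < d & forall y t, `|y - x0| < d -> `|t - W x0| < d ->
    0 < - eps * t + 0 * (t ^+ 3 * sqgrad psi0 y) + 1 * f y.
  apply: (joint_nearP (@cont_op psi0 x0 (W x0) (- eps) 0 1 3%N ps0 Bx0)) => /=.
  by lra.
have lipc : 9 * (W x0 ^+ 4 * sqgrad phi x0) < L ^+ 2.
  have fF0 := fF x0r; have WF : eps * W x0 <= F by lra.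
  have W3F : W x0 ^+ 3 * sqgrad phi x0 <= F by lra.
  have W4 : eps * (W x0 ^+ 4 * sqgrad phi x0) <= F * F.
    rewrite (_ : eps * _ = (eps * W x0) * (W x0 ^+ 3 * sqgrad phi x0)); last by ring.
    exact: ler_pM.
  have h : W x0 ^+ 4 * sqgrad phi x0 <= F * F * eps^-1.
    by rewrite ler_pdivlMr// mulrC.
  apply: le_lt_trans (_ : 9 * (F * F * eps^-1) < _); first by rewrite ler_pM2l.
  rewrite /L; move: eps^-1 epsV => e ev.
  rewrite (_ : (3 * (F + 1) * (1 + e)) ^+ 2 = 9 * ((F * F + 2 * F + 1) * (1 + 2 * e + e * e))); last by ring.
  rewrite ltr_pM2l//; have FF := mulr_ge0 F0 F0; have ee := mulr_ge0 (ltW ev) (ltW ev).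
  have t1 := mulr_ge0 FF (ltW ev); have t2 := mulr_ge0 FF ee; have t3 := mulr_ge0 F0 (ltW ev).
  have t4 := mulr_ge0 F0 ee; lra.
have [d3 d30 H3] : exists2 d, 0 < d & forall y t, `|y - x0| < d -> `|t - W x0| < d ->
    9 * (t ^+ 4 * sqgrad psi0 y) < L ^+ 2.
  have c : {for (x0, W x0), continuous (fun z : 'rV[R]_n * R =>
      L ^+ 2 + (0 * z.2 + - 9 * (z.2 ^+ 4 * sqgrad psi0 z.1) + 0 * f z.1))}.
    apply: (@cvgD _ _ _ (nbhs (x0, W x0))); first exact: cvg_cst.
    exact: (@cont_op psi0 x0 (W x0) 0 (- 9) 0 4%N ps0 Bx0).
  have [|d d0 Hd] := joint_nearP c; first by rewrite /= grad0; lra.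
  by exists d => // y t yd td; have := Hd y t yd td; rewrite /=; lra.
pose d := Num.min d1 (Num.min d2 d3).
have d0 : 0 < d by rewrite !lt_min d10 d20.
have dd (t : R) : t < d -> [/\ t < d1, t < d2 & t < d3].
  by rewrite !lt_min => /and3P[].
have d_2 : 0 < d / 2 by rewrite divr_gt0.
have psic : {for x0, continuous psi0} := smooth_continuous ps0 Bx0.
have [e e0 He] : exists2 e, 0 < e & forall y, `|y - x0| < e ->
    [/\ W x0 - phi x0 <= W y - phi y, `|psi0 y - psi0 x0| < d / 2 & B y].
  apply/nearP; apply: filterS3 nearW (near_dist_lt psic d_2) (open_nbhs_nbhs (conj oB Bx0)).
  by [].
pose rho := Num.min d e / 2.
have de0 : 0 < Num.min d e by rewrite lt_min d0.
have rho0 : 0 < rho by rewrite divr_gt0.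
have rd : rho < d by have : Num.min d e <= d by [rewrite ge_min lexx]; rewrite /rho; lra.
have re : rho < e by have : Num.min d e <= e by [rewrite ge_min lexx orbT]; rewrite /rho; lra.
pose dl := Num.min (d / 2) ((rho / 2) ^+ 2).
have r20 : 0 < rho / 2 by rewrite divr_gt0.
have dl0 : 0 < dl by rewrite lt_min d_2 exprn_gt0.
have dld : dl <= d / 2 by rewrite ge_min lexx.
have dlr : dl <= (rho / 2) ^+ 2 by rewrite ge_min lexx orbT.
have q0 : q x0 = 0 by rewrite /q sqdistE subrr enorm0 expr0n oppr0.
have psi00 : psi0 x0 = phi x0 by rewrite /psi0 q0 addr0.
pose c0 := W x0 - phi x0 + dl.
pose psi y := psi0 y + c0.
have pss : smooth_on B psi by move=> k; apply: Ck_addpoly => //; exact: is_poly_cst.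
have pdpsi y i : B y -> partial i psi y = partial i psi0 y.
  move=> By; rewrite partial_addpoly; [|exact: smooth_derivable ps0 By|exact: is_poly_cst].
  by rewrite -(pderE i (fun=> c0)) pder_cst addr0.
have sgpsi y : B y -> sqgrad psi y = sqgrad psi0 y.
  by move=> By; apply: eq_bigr => i _; rewrite pdpsi.
have : psi x0 <= W x0; last first.
  by rewrite /psi psi00 /c0; lra.
apply: (@perron_bump psi x0 rho) => //.
- by move=> y yr; have [] := He y (le_lt_trans yr re).
- move=> y yr; have [h1 h2 By] := He y (le_lt_trans yr re).
  have ys : `|psi y - W x0| < d.
    have -> : psi y - W x0 = (psi0 y - psi0 x0) + dl.
      have alg (a b c e' : R) : a + (b - c + e') - b = a - c + e' by ring.
      by rewrite psi00; exact: alg.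
    by apply: le_lt_trans (ler_normD _ _) _; rewrite (gtr0_norm dl0); lra.
  have [y1 y2 y3] := dd _ (le_lt_trans yr rd); have [s1 s2 s3] := dd _ ys.
  split.
  + rewrite /first_order_op sqgradE sgpsi//.
    by have := H1 y (psi y) y1 s1; lra.
  + rewrite ler_pdivlMr//; have := H2 y (psi y) y2 s2; lra.
  + move=> i; rewrite pdpsi// -(@ler_pXn2r _ 2)// ?nnegrE ?(ltW L0)//.
    rewrite real_normK ?num_real//; apply: le_trans (ltW (H3 y (psi y) y3 s3)).
    have alg (a b : R) : (3 * a ^+ 2 * b) ^+ 2 = 9 * (a ^+ 4 * b ^+ 2) by ring.
    rewrite alg ler_pM2l// ler_wpM2l//; first by rewrite (exprM _ 2 2) sqr_ge0.
    by rewrite /sqgrad (bigD1 i)//= lerDl; apply: sumr_ge0 => k _; exact: sqr_ge0.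
- move=> y y2 yr; have [h1 _ _] := He y (le_lt_trans yr re).
  have sq : (rho / 2) ^+ 2 <= sqdist x0 y.
    rewrite sqdistE lerXn2r ?nnegrE ?enorm_ge0 ?(ltW r20)//.
    exact: le_trans y2 (norm_le_enorm _).
  by rewrite /psi /psi0 /q /c0; lra.
Qed.

End Perron.

(** Perron's method: [0] is a subsolution and [f / eps] a supersolution, and both
vanish on the sphere. *)
Theorem first_order_solution (R : realType) (n : nat) (eps r : R) (f : 'rV[R]_n -> R) :
  0 < eps -> 0 < r ->
  (forall x, enorm x <= r -> 0 <= f x) ->
  (forall x, eball r x -> {for x, continuous f}) ->
  {within eclosed_ball r, continuous f} ->
  (forall x, enorm x = r -> f x = 0) ->
  exists w, [/\ {within eclosed_ball r, continuous w},
    viscosity_solution (first_order_op eps f) (eball r) w,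
    forall x, esphere r x -> w x = 0 &
    exists2 L, 0 <= L & forall x y, enorm x <= r -> enorm y <= r ->
      `|w x - w y| ^+ 3 <= L * enorm (x - y)].
Proof.
move=> eps0 r0 f0 fc fcw fr.
have [F F0 fF] := within_bounded fcw.
have fF' x (xr : enorm x <= r) : f x <= F by exact: le_trans (ler_norm _) (fF x xr).
exists (perron_sup eps r F f); split.
- exact: perron_sup_continuous.
- by split; [exact: perron_sup_subsolution|exact: perron_sup_supersolution].
- move=> x xr; have xr' : enorm x <= r by rewrite xr.
  have := perron_sup_bounds eps0 r0 f0 fF' xr'; rewrite (fr x xr) mul0r => h.
  by apply/eqP; rewrite eq_le andbC.
- pose L := 3 * (F + 1) * (1 + eps^-1).
  have L0 : 0 <= L.
    apply: mulr_ge0; first by apply: mulr_ge0 => //; lra.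
    by rewrite addr_ge0// invr_ge0 ltW.
  exists (L * n%:R); first by rewrite mulr_ge0.
  move=> x y xr yr.
  have W0 z : enorm z <= r -> 0 <= perron_sup eps r F f z.
    by move=> zr; have /andP[] := perron_sup_bounds eps0 r0 f0 fF' zr.
  apply: le_trans (cube_dist (W0 x xr) (W0 y yr)) _.
  apply: (@le_trans _ _ (L * l1norm (x - y))).
    have h a b : enorm a <= r -> enorm b <= r -> perron_sup eps r F f a ^+ 3 -
        perron_sup eps r F f b ^+ 3 <= L * l1norm (a - b).
      exact: perron_sup_lipschitz.
    rewrite ler_norml lerNl opprB h// andbT l1normB; exact: h.
  rewrite -[leRHS]mulrA ler_wpM2l//; apply: le_trans (l1norm_le_norm _) _.
  by rewrite ler_wpM2l// norm_le_enorm.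
Qed.

(** * The boundary value problem *)
Theorem theorem1p1 (R : realType) (n : nat) (alpha eps r : R)
    (f g : 'rV[R]_n -> R) :
  (0 < n)%N -> 0 < alpha -> alpha < 1 -> 0 < eps -> 0 < r ->
  (forall x, eclosed_ball r x -> 0 <= f x) ->
  Ck_holder 0 alpha (eball r) f ->
  {within eclosed_ball r, continuous f} ->
  {within eclosed_ball r, continuous g} ->
  (exists C : R, forall x, eclosed_ball r x ->
     f x <= C * (r ^+ 2 - enorm x ^+ 2) ^+ 3 * enorm x ^+ 2) ->
  exists v : 'rV[R]_n -> R,
    [/\ viscosity_solution_bvp eps r f g v,
        exists beta : R, [/\ 0 < beta, beta <= alpha &
          Ck_holder 2 beta (eball r) v]
      & {within eclosed_ball r, continuous v}].
Proof.
move=> n0 alpha0 _ eps0 r0 f0 [[fc _] _] fcw gcw [C fC].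
have f_sphere x : enorm x = r -> f x = 0.
  move=> xr; have xr' : eclosed_ball r x by rewrite /eclosed_ball/= xr.
  apply/eqP; rewrite eq_le f0// andbT; apply: le_trans (fC x xr') _.
  by rewrite xr subrr expr0n mulr0 mul0r.
have [w [wc wvisc w_sphere [L L0 wL]]] := first_order_solution eps0 r0 f0 fc fcw f_sphere.
have [v [vc v_sphere v_approx]] := poisson_exists n0 r0 wc gcw.
have [V V0 vV] := within_bounded vc; have [W W0 wW] := within_bounded wc.
exists v; split => //.
  exists w; split; first by split.
  split; last exact: v_sphere.
    exact: poisson_Ck2 n0 vV wW L0 V0 W0 wL v_approx.
  exact: poisson_laplacian n0 vV wW L0 V0 W0 wL v_approx.
have beta0 : 0 < Num.min alpha 3^-1 by rewrite lt_min alpha0 invr_gt0 ltr0n.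
have beta3 : Num.min alpha 3^-1 <= 3^-1 by rewrite ge_min lexx orbT.
exists (Num.min alpha 3^-1); split => //; first by rewrite ge_min lexx.
exact: poisson_holder n0 vV wW L0 V0 W0 wL v_approx _ beta0 beta3.
Qed.
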